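(* Let $\mathcal{H}$ be a finite dimensional complex Hilbert space with a standard subspace $H\subset\mathcal{H}$, and let $T\in\mathcal{T}_{>}(H)$ be a (compatible) crossing symmetric and braided twist on $\mathcal{H}$ with $\|T\|=q<1$. Let $(e_1,\dots,e_d)$ be a linear basis of $\mathcal{H}$ and let $(f_1,\dots,f_d)$ be its dual basis in $\mathcal{H}$, i.e. $\langle f_i,e_j\rangle=\delta_{ij}$. Consider the twisted Araki-Woods von Neumann algebra $\mathcal{L}_T(H)$ with the vacuum state $\varphi_\Omega$ and generators $X_T(e_1),\dots,X_T(e_d)$. Then the conjugate system $(\Xi_1,\dots,\Xi_d)$ for $(X_T(e_1),\dots,X_T(e_d))$ with respect to the free difference quotients exists and $$\Xi_i=\sum_{n=0}^{\infty}(-1)^n P_{T,2n+1}^{-1}\sum_{\pi\in B(2n+1)}(W^T_\pi)^*f_i\in\mathcal{F}_T(\mathcal{H}),\qquad 1\le i\le d,$$ where $B(2n+1)\subseteq\mathcal{P}_{1,2}(2n+1)$ is the set of incomplete matchings such that $n+1$ is a singleton and each $1\le k\le n$ is paired with an element of $\{n+2,\dots,2n+1\}$. Here the adjoints $(W^T_\pi)^*$ are taken with respect to the untwisted inner products on the tensor powers $\mathcal{H}^{\otimes t}$.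
   Context: Inner products are linear in the second variable. A standard subspace $H$ of a complex Hilbert space $\mathcal{H}$ is a closed real linear subspace with $H\cap iH=\{0\}$ and $H+iH$ dense in $\mathcal{H}$. $S_H$ is the closed antilinear operator with domain $H+iH$, $S_H(h+ih')=h-ih'$ ($h,h'\in H$), with polar decomposition $S_H=J_H\Delta_H^{1/2}$. (If $\dim\mathcal{H}<\infty$, $S_H$ is bounded and defined on all of $\mathcal{H}$.) Twists. Let $T\in B(\mathcal{H}\otimes\mathcal{H})$ be self-adjoint with $\|T\|\le1$. On $\mathcal{H}^{\otimes n}$ put $T_k=1^{\otimes(k-1)}\otimes T\otimes1^{\otimes(n-k-1)}$, $R_{T,n}=1+T_1+T_1T_2+\cdots+T_1\cdots T_{n-1}$, $P_{T,1}=1$, $P_{T,n}=(1\otimes P_{T,n-1})R_{T,n}$. $T$ is a twist if $P_{T,n}\ge0$ for all $n\geq 1$, and a strict twist if all $P_{T,n}$ are strictly positive. $T$ is compatible with $H$ if $[\Delta_H^{it}\otimes\Delta_H^{it},T]=0$ for all $t\in\mathbb{R}$; $\mathcal{T}_{>}(H)$ is the set of compatible strict twists. $T$ is braided if $T_1T_2T_1=T_2T_1T_2$ on $\mathcal{H}^{\otimes3}$. $T$ is crossing symmetric (with respect to $H$) if for all $\psi_1,\dots,\psi_4\in\mathcal{H}$ the function $t\mapsto\langle\psi_2\otimes\psi_1,(\Delta_H^{it}\otimes1)T(1\otimes\Delta_H^{-it})(\psi_3\otimes\psi_4)\rangle$, $t\in\mathbb{R}$, extends to a bounded continuous function on $\{0\le\mathrm{Im}\,z\le1/2\}$,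 analytic in the interior, whose value at $t+\frac i2$ ($t\in\mathbb{R}$) is $\langle\psi_1\otimes J_H\psi_4,(1\otimes\Delta_H^{it})T(\Delta_H^{-it}\otimes1)(J_H\psi_2\otimes\psi_3)\rangle$. Twisted Fock space. For a strict twist, $\mathcal{F}_T(\mathcal{H})=\bigoplus_{n\ge0}\mathcal{H}_{T,n}$, where $\mathcal{H}_{T,0}=\mathbb{C}\Omega$ ($\Omega$ the unit vacuum vector) and $\mathcal{H}_{T,n}$ is the completion of $\mathcal{H}^{\otimes n}$ for $\langle f,g\rangle_T=\langle f,P_{T,n}g\rangle$; elements of $\mathcal{H}^{\otimes n}$ are regarded as vectors of $\mathcal{F}_T(\mathcal{H})$. For $h\in\mathcal{H}$, $a_T^*(h)$ is the left creation operator $\Phi\mapsto h\otimes\Phi$ on $\mathcal{F}_T(\mathcal{H})$ and $a_T(h)$ is its adjoint (both bounded when $\|T\|<1$). For $\xi\in H+iH$, $X_T(\xi)=a_T^*(\xi)+a_T(S_H\xi)$. $\mathcal{L}_T(H)$ is the von Neumann algebra on $\mathcal{F}_T(\mathcal{H})$ generated by $\{X_T(\xi):\xi\in H\}$, and $\varphi_\Omega=\langle\Omega,\cdot\,\Omega\rangle_T$. For $T$ compatible, braided and crossing symmetric, $\Omega$ is cyclic and separating, and $L^2(\mathcal{L}_T(H),\varphi_\Omega)$ is identified with $\mathcal{F}_T(\mathcal{H})$ via $A\mapsto A\Omega$. Conjugate system. The free difference quotient $\partial_i:\mathbb{C}\langle x_1,\dots,x_d\rangle\to\mathbb{C}\langle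 x_1,\dots,x_d\rangle\otimes\mathbb{C}\langle x_1,\dots,x_d\rangle$ is the linear map $\partial_i(x_{j_1}\cdots x_{j_k})=\sum_{m=1}^k\delta_{i,j_m}\,x_{j_1}\cdots x_{j_{m-1}}\otimes x_{j_{m+1}}\cdots x_{j_k}$. If $(X_1,\dots,X_d)$ (not necessarily self-adjoint) generates a von Neumann algebra $M$ with faithful normal state $\varphi$, a conjugate system is a family $\Xi_1,\dots,\Xi_d\in L^2(M,\varphi)$ with $\langle\Xi_i,p(X_1,\dots,X_d)\rangle_\varphi=\langle1\otimes1,(\partial_ip)(X_1,\dots,X_d)\rangle_{\varphi\otimes\varphi^{op}}$ for all $p\in\mathbb{C}\langle x_1,\dots,x_d\rangle$ and all $i$. Incomplete matchings and $W^T_\pi$. $[n]=\{1,\dots,n\}$. $\mathcal{P}_{1,2}(n)$ is the set of partitions of $[n]$ with all blocks of size 1 (singletons) or 2 (pairings); $p(\pi)$ is the set of pairings, $s(\pi)$ the set of singletons of $\pi$. For pairings $V=\{i,j\}$, $U=\{k,l\}$, write $V<U$ if $i<k<l<j$. An admissible order on $p(\pi)$ is a strict linear order extending $<$. The contraction $C_i:\mathcal{H}^{\otimes k}\to\mathcal{H}^{\otimes(k-2)}$ is $C_i(\xi_1\otimes\cdots\otimes\xi_k)=\langle S_H\xi_i,\xi_{i+1}\rangle\,\xi_1\otimes\cdots\otimes\xi_{i-1}\otimes\xi_{i+2}\otimes\cdots\otimes\xi_k$ ($1\le i<k$). Put $T_{i,j}=T_iT_{i+1}\cdots T_{j-1}$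 for $j\ge i+1$ and $T_{i,i}=\mathrm{id}$. If $\{i_1,j_1\}<_\varphi\cdots<_\varphi\{i_s,j_s\}$ ($i_m<j_m$) are the pairings of $\pi$ listed in an admissible order $\varphi$, let $r_k(m)$ be the number of elements of $\{i_t,j_t:t<k\}$ that are less than $m$. Then $W^T_\pi:\mathcal{H}^{\otimes n}\to\mathcal{H}^{\otimes|s(\pi)|}$ is $$W^T_\pi=C_{i_s-r_s(i_s)}T_{i_s-r_s(i_s)+1,\,j_s-r_s(j_s)}\cdots C_{i_1-r_1(i_1)}T_{i_1-r_1(i_1)+1,\,j_1-r_1(j_1)}$$ (and $W^T_\pi=\mathrm{id}$ if $p(\pi)=\varnothing$); for $T$ as in the claim this does not depend on the choice of admissible order $\varphi$. *)

(* Defs.v *)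
From HB Require Import structures.
From mathcomp Require Import all_boot all_order all_algebra finmap.
From mathcomp Require Import all_classical all_reals all_analysis.
From mathcomp Require Import complex mxtens.
From mathcomp Require monalg.
(* The notations of [monalg] clash with those loaded above. *)
Import -(notations) monalg.

Set Implicit Arguments.
Unset Strict Implicit.
Unset Printing Implicit Defensive.

Import Order.TTheory GRing.Theory Num.Theory.
Import numFieldNormedType.Exports.

Local Open Scope classical_set_scope.
Local Open Scope ring_scope.

(* The scalars are R[i] with R : realType.  They are written R[i]^o where the
   normed topology of the field over itself is needed. *)

Section OneParticle.
Context (R : realType) (V : vectType R[i]) (dot : {dot V for Num.conj}).

(* A [{dot V for Num.conj}] is linear in its first argument, hence the swap:
   [ip] is linear in the second one. *)
Definition ip (x y : V) : R[i] := dot y x.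

Definition hnorm (x : V) : R := Num.sqrt (complex.Re (ip x x)).

Definition standard_subspace (H : set V) : Prop :=
  [/\ H 0 /\ (forall (a : R) x y, H x -> H y -> H ((a%:C)%C *: x + y)),
      forall x, (forall eps : R, 0 < eps -> exists2 h, H h & hnorm (x - h) < eps) ->
        H x,
      forall h h', H h -> H h' -> h = 'i%C *: h' -> h = 0
    & forall x (eps : R), 0 < eps ->
        exists h h', [/\ H h, H h' & hnorm (x - (h + 'i%C *: h')) < eps]].

(* S_H; the decomposition x = h + i h' is unique for a standard subspace.
   The value is 0 off H + iH, which is all of V in finite dimension. *)
Definition tomita (H : set V) (x : V) : V :=
  xget 0 [set y | exists h h',
    [/\ H h, H h', x = h + 'i%C *: h' & y = h - 'i%C *: h']].

(* Functional calculus of a self-adjoint A (finite dimension): f(A) acts as f(l)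
   on the l-eigenspace of A. *)
Definition fcalc (f : R -> R[i]) (A : 'End(V)) : 'End(V) :=
  xget 0 [set B : 'End(V) |
    forall (l : R) v, A v = (l%:C)%C *: v -> B v = f l *: v].

Definition positive_op (A : 'End(V)) : Prop := forall x, 0 <= ip x (A x).

Definition antiunitary (J : V -> V) : Prop :=
  [/\ forall (a : R[i]) x y, J (a *: x + y) = (a^*)%C *: J x + J y,
      forall x y, ip (J x) (J y) = ip y x
    & forall y, exists x, J x = y].

(* S = J Delta^(1/2), for an antilinear bijection S. *)
Definition polar_decomposition (S J : V -> V) (Delta : 'End(V)) : Prop :=
  [/\ positive_op Delta, antiunitary J
    & forall x, S x = J (fcalc (fun l => ((Num.sqrt l)%:C)%C) Delta x)].

(* Delta^(it): l^(it) = cos (t ln l) + i sin (t ln l) for l > 0. *)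
Definition op_it (Delta : 'End(V)) (t : R) : 'End(V) :=
  fcalc (fun l => (cos (t * ln l) +i* sin (t * ln l))%C) Delta.

End OneParticle.

(* Tensor powers of V are written in coordinates with respect to an orthonormal
   basis b of V: V (x) V is 'cV_(d * d), the entry [mxtens_index (i, j)] being the
   coefficient of b_i (x) b_j, and operators on it are matrices. *)
Section TwoParticles.
Context (R : realType) (V : vectType R[i]) (dot : {dot V for Num.conj}).
Context (d : nat) (b : 'I_d -> V).
Local Notation ip := (ip dot).

Definition linear_basis (e : 'I_d -> V) : Prop := basis_of fullv (codom e).

Definition orthonormal_basis : Prop :=
  linear_basis b /\ forall i j, ip (b i) (b j) = (i == j)%:R.

Definition vec_coord (x : V) : 'cV[R[i]]_d := \col_i ip (b i) x.

Definition op_coord (A : 'End(V)) : 'M[R[i]]_d := \matrix_(i, j) ip (b i) (A (b j)).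

Definition tens2 (x y : V) : 'cV[R[i]]_(d * d) := vec_coord x *t vec_coord y.

Definition ip2 (u v : 'cV[R[i]]_(d * d)) : R[i] := (map_mx Num.conj u^T *m v) 0 0.

Definition norm2 (u : 'cV[R[i]]_(d * d)) : R := Num.sqrt (complex.Re (ip2 u u)).

Definition opnorm (T : 'M[R[i]]_(d * d)) : R :=
  sup [set norm2 (T *m u) | u in [set u | norm2 u <= 1]].

Definition selfadjoint (T : 'M[R[i]]_(d * d)) : Prop := map_mx Num.conj T^T = T.

Definition compatible (Delta : 'End(V)) (T : 'M[R[i]]_(d * d)) : Prop :=
  forall t : R, let U := op_coord (op_it Delta t) in
    (U *t U) *m T = T *m (U *t U).

Definition crossing_symmetric (J : V -> V) (Delta : 'End(V))
    (T : 'M[R[i]]_(d * d)) : Prop :=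
  let U t := op_coord (op_it Delta t) in
  let strip := [set z : R[i]^o | 0 <= complex.Im z <= 2^-1] in
  forall psi1 psi2 psi3 psi4 : V, exists F : R[i]^o -> R[i]^o,
    [/\ exists M : R[i], forall z, strip z -> `|F z| <= M,
        {within strip, continuous F},
        forall z : R[i]^o, 0 < complex.Im z < 2^-1 -> derivable F z 1,
        forall t : R, F (t%:C)%C =
          ip2 (tens2 psi2 psi1)
            ((U t *t 1%:M) *m T *m (1%:M *t U (- t)) *m tens2 psi3 psi4)
      & forall t : R, F (t +i* 2^-1)%C =
          ip2 (tens2 psi1 (J psi4))
            ((1%:M *t U t) *m T *m (U (- t) *t 1%:M) *m tens2 (J psi2) psi3)].

End TwoParticles.

(* An element of the product of all tensor powers of V is a function Phi on words
   over 'I_d: for w of length n, Phi w is the coefficient of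
   b_(w_1) (x) ... (x) b_(w_n) in the component of Phi in the n-th tensor power.
   Operators act on such functions; positions of tensor legs are counted from 1,
   and leg k of a word w is its letter of index k.-1. *)
Definition tensor (R : realType) (d : nat) : Type := seq 'I_d -> R[i].

Definition tensor_op (R : realType) (d : nat) : Type := tensor R d -> tensor R d.

Section TwistedFock.
Context (R : realType) (d : nat) (T : 'M[R[i]]_(d * d)).
Local Notation tensor := (tensor R d).
Local Notation tensor_op := (tensor_op R d).

Definition homogeneous (n : nat) (Phi : tensor) : Prop :=
  forall w, size w != n -> Phi w = 0.

Definition tensor_ip (n : nat) (Phi Psi : tensor) : R[i] :=
  \sum_(w : n.-tuple 'I_d) ((Phi w)^*)%C * Psi w.

Definition twist_at (k : nat) : tensor_op := fun Phi w =>
  if drop k.-1 w is x :: y :: v then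
    \sum_(a < d) \sum_(c < d)
      T (mxtens_index (x, y)) (mxtens_index (a, c)) * Phi (take k.-1 w ++ a :: c :: v)
  else 0.

(* T_i ... T_(j-1) *)
Definition twist_prod (i j : nat) : tensor_op := fun Phi =>
  foldr twist_at Phi (index_iota i j).

Definition braided : Prop := forall (Phi : tensor) w, size w = 3 ->
  twist_at 1 (twist_at 2 (twist_at 1 Phi)) w =
  twist_at 2 (twist_at 1 (twist_at 2 Phi)) w.

Definition twist_R (n : nat) : tensor_op := fun Phi w =>
  \sum_(1 <= k < n.+1) twist_prod 1 k Phi w.

(* 1 (x) A; [fun u => Phi (a :: u)] is the slice of Phi at first letter a. *)
Definition id_tensor (A : tensor_op) : tensor_op := fun Phi w =>
  if w is a :: v then A (fun u => Phi (a :: u)) v else 0.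

(* P_(T,n), meant to be read on words of length n; P_(T,1) = 1 since
   R_(T,1) = 1. *)
Fixpoint twist_P (n : nat) : tensor_op :=
  if n is m.+1 then fun Phi => id_tensor (twist_P m) (twist_R m.+1 Phi)
  else fun Phi => Phi.

Definition twist_Pinv (n : nat) : tensor_op := fun Phi =>
  xget (fun _ => 0) [set Psi | homogeneous n Psi /\
    forall w, size w = n -> twist_P n Psi w = Phi w].

Definition strict_twist : Prop :=
  [/\ selfadjoint T, opnorm T <= 1
    & forall (n : nat) (Phi : tensor), homogeneous n Phi ->
        Phi <> (fun _ => 0) -> 0 < tensor_ip n Phi (twist_P n Phi)].

(* Since V is finite dimensional, the n-th tensor power is complete for <,>_T when
   P_(T,n) > 0, so F_T consists of the square-summable functions on words. *)
Definition twisted_ip (n : nat) (Phi Psi : tensor) : R[i] :=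
  tensor_ip n Phi (twist_P n Psi).

Definition fock : set tensor := [set Phi |
  cvgn (series (fun n => complex.Re (twisted_ip n Phi Phi)))].

Definition fock_ip (Phi Psi : tensor) : R[i] :=
  limn (series (fun n => twisted_ip n Phi Psi : R[i]^o)).

Definition fock_norm (Phi : tensor) : R := Num.sqrt (complex.Re (fock_ip Phi Phi)).

Definition vacuum : tensor := fun w => (w == [::])%:R.

Definition vacuum_state (A : tensor_op) : R[i] := fock_ip vacuum (A vacuum).

(* Operators on F_T are functions on all tensors of which only the restriction to
   F_T is meaningful. *)
Definition bounded_op (A : tensor_op) : Prop :=
  [/\ forall Phi, fock Phi -> fock (A Phi),
      forall (a : R[i]) Phi Psi, fock Phi -> fock Psi ->
        A (fun w => a * Phi w + Psi w) = fun w => a * A Phi w + A Psi w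
    & exists M : R, forall Phi, fock Phi -> fock_norm (A Phi) <= M * fock_norm Phi].

Definition adjoint (A : tensor_op) : tensor_op :=
  xget (fun _ _ => 0) [set B | bounded_op B /\
    forall Phi Psi, fock Phi -> fock Psi ->
      fock_ip Phi (B Psi) = fock_ip (A Phi) Psi].

Definition commutant (S : set tensor_op) : set tensor_op := [set B | bounded_op B /\
  forall A, S A -> forall Phi, fock Phi -> A (B Phi) = B (A Phi)].

Definition von_neumann (S : set tensor_op) : set tensor_op :=
  commutant (commutant (S `|` adjoint @` S)).

(* L^2(M, vacuum_state), realized through A |-> A vacuum as the closure of
   (M vacuum) in F_T. *)
Definition L2_vacuum (M : set tensor_op) : set tensor := [set Phi | fock Phi /\
  forall eps : R, 0 < eps -> exists2 A, M A &
    fock_norm (fun w => Phi w - A vacuum w) < eps].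

End TwistedFock.

(* C<x_1, ..., x_d> is [malg (seq 'I_d) R[i]], the finitely supported functions on
   words; its tensor square has pairs of words as a basis. *)
Section ConjugateSystem.
Context (R : realType) (d : nat) (T : 'M[R[i]]_(d * d)).
Local Notation tensor := (tensor R d).
Local Notation tensor_op := (tensor_op R d).

Definition free_diff (i : 'I_d) (p : malg (seq 'I_d) R[i]) :
    malg (seq 'I_d * seq 'I_d)%type R[i] :=
  \sum_(u <- msupp p) \sum_(m < size u | nth i u m == i)
    mkmalgU (take m u, drop m.+1 u) (mcoeff u p).

Definition eval_word (X : 'I_d -> tensor_op) (u : seq 'I_d) : tensor_op :=
  fun Phi => foldr (fun j Psi => X j Psi) Phi u.

Definition eval_poly (X : 'I_d -> tensor_op) (p : malg (seq 'I_d) R[i]) : tensor_op :=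
  fun Phi w => \sum_(u <- msupp p) mcoeff u p * eval_word X u Phi w.

(* <1 (x) 1, r(X)> with respect to phi (x) phi^op, where phi is the vacuum state:
   a (x) c contributes phi(a) phi(c). *)
Definition state2 (X : 'I_d -> tensor_op)
    (r : malg (seq 'I_d * seq 'I_d)%type R[i]) : R[i] :=
  \sum_(uv <- msupp r) mcoeff uv r *
    (vacuum_state T (eval_word X uv.1) * vacuum_state T (eval_word X uv.2)).

Definition conjugate_system (M : set tensor_op) (X : 'I_d -> tensor_op)
    (Xi : 'I_d -> tensor) : Prop :=
  [/\ M = von_neumann T (range X),
      forall i, L2_vacuum T M (Xi i)
    & forall i p, fock_ip T (Xi i) (eval_poly X p (@vacuum R d)) =
        state2 X (free_diff i p)].

End ConjugateSystem.

Section ArakiWoods.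
Context (R : realType) (V : vectType R[i]) (dot : {dot V for Num.conj}).
Context (d : nat) (b : 'I_d -> V) (T : 'M[R[i]]_(d * d)).
Local Notation ip := (ip dot).

Definition vec_tensor (h : V) : tensor R d := fun w =>
  if w is [:: a] then ip (b a) h else 0.

Definition creation (h : V) : tensor_op R d := fun Phi w =>
  if w is a :: v then ip (b a) h * Phi v else 0.

Definition annihilation (h : V) : tensor_op R d := adjoint T (creation h).

(* Used with S = S_H. *)
Definition field_op (S : V -> V) (xi : V) : tensor_op R d := fun Phi w =>
  creation xi Phi w + annihilation (S xi) Phi w.

Definition araki_woods (H : set V) : set (tensor_op R d) :=
  von_neumann T (field_op (tomita H) @` H).

(* The bilinear form (x, y) |-> <S x, y> is determined by its values at pairs
   of basis vectors. *)
Definition contraction (S : V -> V) (i : nat) : tensor_op R d := fun Phi w =>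
  \sum_(a < d) \sum_(c < d)
    ip (S (b a)) (b c) * Phi (take i.-1 w ++ a :: c :: drop i.-1 w).

(* Number of elements of the pairings in s that are less than m. *)
Definition removed_below (s : seq (nat * nat)) (m : nat) : nat :=
  \sum_(V <- s) ((V.1 < m)%N + (V.2 < m)%N).

(* The factors of W^T_pi for the pairings s that remain after those in prev have
   been contracted; the first listed pairing acts first. *)
Fixpoint W_rec (S : V -> V) (prev s : seq (nat * nat)) (Phi : tensor R d) :
    tensor R d :=
  if s is (i, j) :: s' then
    let i' := (i - removed_below prev i)%N in
    let j' := (j - removed_below prev j)%N in
    W_rec S ((i, j) :: prev) s' (contraction S i' (twist_prod T i'.+1 j' Phi))
  else Phi.

(* W^T_pi, given the list of the pairings of pi in an admissible order; the legs
   1, ..., m are indexed by 'I_m. *)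
Definition W_op (S : V -> V) (m : nat) (s : seq ('I_m * 'I_m)) : tensor_op R d :=
  W_rec S [::] [seq ((val V.1).+1, (val V.2).+1) | V <- s].

(* The adjoint of A from the m-th to the n-th tensor power for the untwisted inner
   products, by its coefficients <b_w, A^* Psi> = <A b_w, Psi>. *)
Definition tensor_adjoint (m n : nat) (A : tensor_op R d) : tensor_op R d :=
  fun Psi w =>
    if size w == m then tensor_ip n (A (fun u => (u == w)%:R)) Psi else 0.

End ArakiWoods.

Section Matchings.
Context (m : nat).
Implicit Types (pi : {set {set 'I_m}}) (s : seq ('I_m * 'I_m)).

(* P_{1,2}(m), the elements 1, ..., m being shifted to 0, ..., m - 1 *)
Definition incomplete_matching pi : bool :=
  finset.partition pi [set: 'I_m]%SET && [forall B in pi, #|B| <= 2]%N.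

Definition nested (V U : 'I_m * 'I_m) : bool := (V.1 < U.1 < U.2)%N && (U.2 < V.2)%N.

(* s lists the pairings of pi as pairs (i, j) with i < j, compatibly with V < U for
   V = {i, j} and U = {k, l} whenever i < k < l < j: the outer pairing comes first. *)
Definition admissible_order pi s : Prop :=
  [/\ uniq s,
      forall V, (V \in s) = (V.1 < V.2)%N && ([set V.1; V.2]%SET \in pi)
    & forall V U, V \in s -> U \in s -> nested V U -> (index V s < index U s)%N].

End Matchings.

(* B(2n+1): n+1 is a singleton and each 1 <= k <= n is paired with an element of
   {n+2, ..., 2n+1}. *)
Definition B_matching (n : nat) (pi : {set {set 'I_(2 * n + 1)}}) : bool :=
  [&& incomplete_matching pi,
      [exists k : 'I_(2 * n + 1), (k == n :> nat) && ([set k]%SET \in pi)]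
    & [forall k : 'I_(2 * n + 1), (k < n)%N ==>
        [exists l : 'I_(2 * n + 1), (n < l)%N && ([set k; l]%SET \in pi)]]].

Section ConjugateTerm.
Context (R : realType) (V : vectType R[i]) (dot : {dot V for Num.conj}).
Context (d : nat) (b : 'I_d -> V) (T : 'M[R[i]]_(d * d)).

(* ord selects an admissible order for each pi. *)
Definition conjugate_term (S : V -> V)
    (ord : forall m, {set {set 'I_m}} -> seq ('I_m * 'I_m)) (n : nat) (h : V) :
    tensor R d := fun w =>
  (-1) ^+ n * twist_Pinv T (2 * n + 1) (fun u =>
    \sum_(pi : {set {set 'I_(2 * n + 1)}} | B_matching pi)
      tensor_adjoint (2 * n + 1) 1 (W_op dot b T S (ord _ pi))
        (vec_tensor dot b h) u) w.

End ConjugateTerm.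

(* Main.v *)
Require Import Defs.
From HB Require Import structures.
From mathcomp Require Import all_boot all_order all_algebra all_fingroup finmap.
From mathcomp Require Import all_classical all_reals all_analysis.
From mathcomp Require Import complex mxtens zify ring lra.
From mathcomp Require monalg.
Import -(notations) monalg.

Set Implicit Arguments.
Unset Strict Implicit.
Unset Printing Implicit Defensive.

Import Order.TTheory GRing.Theory Num.Theory.
Import numFieldNormedType.Exports.

Local Open Scope classical_set_scope.
Local Open Scope ring_scope.

Local Arguments Normc.normc {R} x : simpl never.

Section StringCalculus.
Variables (A : pzRingType) (t c : nat -> A).

Definition braid_product (i j : nat) : A := \prod_(i <= k < j) t k.
Local Notation T := braid_product.

Definition pair_last (s r m : nat) : A := \sum_(s <= k < r) c k * T k.+1 (r + m).
Local Notation L := pair_last.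

Fixpoint pair_right (s r m : nat) : A :=
  if m is m'.+1 then pair_right s r.-1 m' * L s r m else 1.
Local Notation G := pair_right.

Definition pair_first (E : nat) : A := \sum_(1 <= j < E) c 0 * T 1 j.
Local Notation Ann := pair_first.

Hypothesis t_far : forall i j, (i.+1 < j)%N -> t i * t j = t j * t i.
Hypothesis c_t_right : forall i j, (i <= j)%N -> c i * t j.+2 = t j * c i.
Hypothesis c_t_left : forall i j, (j.+1 < i)%N -> c i * t j = t j * c i.

Lemma braid_product_nil i j : (j <= i)%N -> T i j = 1.
Proof. by move=> ji; rewrite /T big_geq. Qed.

Lemma braid_productS i j : (i <= j)%N -> T i j.+1 = T i j * t j.
Proof. by move=> ij; rewrite /T big_nat_recr. Qed.

Lemma braid_product_recl i j : (i < j)%N -> T i j = t i * T i.+1 j.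
Proof. by move=> ij; rewrite /T big_ltn. Qed.

Lemma braid_product_cat i j k : (i <= j <= k)%N -> T i k = T i j * T j k.
Proof. by move=> /andP[ij jk]; rewrite /T -big_cat_nat. Qed.

Lemma comm_braid_product x i j :
  (forall k, (i <= k < j)%N -> x * t k = t k * x) -> x * T i j = T i j * x.
Proof.
move=> xt; rewrite /T big_seq.
elim/big_ind : _ => [|y z xy xz|k]; first by rewrite mulr1 mul1r.
  by rewrite mulrA xy -mulrA xz mulrA.
by rewrite mem_index_iota => /xt.
Qed.

Lemma t_braid_product_far k i j : ((k.+1 < i) || (j < k))%N -> t k * T i j = T i j * t k.
Proof.
move=> h; apply: comm_braid_product => l hl.
have [kl|lk] : (k.+1 < l)%N \/ (l.+1 < k)%N by lia.
- by rewrite t_far.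
- by rewrite (t_far lk).
Qed.

Lemma braid_product_far i j k l :
  (j < k)%N -> T i j * T k l = T k l * T i j.
Proof.
move=> jk; apply: comm_braid_product => m hm.
by apply/esym/t_braid_product_far; lia.
Qed.

Lemma c_braid_product_left k i j : (j < k)%N -> c k * T i j = T i j * c k.
Proof. by move=> jk; apply: comm_braid_product => l hl; rewrite c_t_left //; lia. Qed.

Lemma c_braid_product_right k i j : (k <= i)%N -> c k * T i.+2 j.+2 = T i j * c k.
Proof.
move=> ki; case: (leqP i j) => ij; last by rewrite !braid_product_nil ?mulr1 ?mul1r //; lia.
rewrite -(subnK ij); elim: (j - i)%N => [|n IH].
  by rewrite !braid_product_nil ?mulr1 ?mul1r //; lia.
rewrite addSn braid_productS; last by lia.
rewrite mulrA IH braid_productS; last by lia.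
by rewrite -!mulrA c_t_right //; lia.
Qed.

Hypothesis c_far : forall i j, (i <= j)%N -> c i * c j.+2 = c j * c i.

Lemma pair_swap_disjoint j k M : (0 < j)%N -> (j <= k.+1)%N ->
  c k * T k.+1 M * (c 0 * T 1 j) = c 0 * T 1 j * (c k.+2 * T k.+3 M.+2).
Proof.
move=> j0 jk.
rewrite -!mulrA [T k.+1 _ * _]mulrA -(c_braid_product_right (k := 0)) //.
rewrite !mulrA -c_far // -!mulrA; congr (_ * _).
rewrite -(@braid_product_far 1 j); last by lia.
by rewrite mulrA c_braid_product_left ?mulrA //; lia.
Qed.

Hypothesis t_braid : forall i, t i * t i.+1 * t i = t i.+1 * t i * t i.+1.

Lemma braid_product_shift1 a b i : (a <= i)%N -> (i.+1 < b)%N ->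
  T a b * t i = t i.+1 * T a b.
Proof.
move=> ai ib.
have -> : T a b = T a i * (t i * t i.+1) * T i.+2 b.
  rewrite (@braid_product_cat a i b); last by lia.
  rewrite (@braid_product_cat i i.+2 b); last by lia.
  by rewrite braid_productS // braid_productS // [T i i]braid_product_nil // mul1r mulrA.
rewrite -mulrA -t_braid_product_far; last by lia.
have -> : T a i * (t i * t i.+1) * (t i * T i.+2 b) =
    T a i * (t i * t i.+1 * t i) * T i.+2 b by rewrite !mulrA.
by rewrite t_braid !mulrA t_braid_product_far //; lia.
Qed.

Lemma braid_product_shift a b i j : (a <= i)%N -> (j < b)%N ->
  T a b * T i j = T i.+1 j.+1 * T a b.
Proof.
move=> ai jb; case: (leqP i j) => ij; last by rewrite [T i j]braid_product_nil ?[T i.+1 _]braid_product_nil ?mulr1 ?mul1r //; lia.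
move: jb; rewrite -(subnK ij); elim: (j - i)%N => [|n IH] h.
  by rewrite [T i _]braid_product_nil ?[T i.+1 _]braid_product_nil ?mulr1 ?mul1r //; lia.
rewrite addSn braid_productS; last by lia.
rewrite mulrA IH; last by lia.
rewrite [in RHS]braid_productS; last by lia.
by rewrite -!mulrA braid_product_shift1 //; lia.
Qed.

Definition creation_sum (n : nat) : A := \sum_(0 <= k < n) T 0 k.

Lemma creation_sum_telescope n :
  creation_sum n.+1 * (1 - T 0 n) = (1 - t 0 * T 0 n) * creation_sum n.
Proof.
rewrite mulrBr mulrBl mulr1 mul1r.
have -> : t 0 * T 0 n * creation_sum n = (creation_sum n.+1 - 1) * T 0 n.
  rewrite /creation_sum [in RHS]big_nat_recl // [T 0 0]braid_product_nil // addrC addKr.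
  rewrite mulr_sumr mulr_suml; apply: eq_big_nat => k kn.
  by rewrite -mulrA braid_product_shift // mulrA -braid_product_recl.
rewrite mulrBl mul1r opprB addrA; congr (_ - _).
by rewrite /creation_sum big_nat_recr.
Qed.

Hypothesis c_t_cross : forall i, c i * t i.+1 = c i.+1 * t i.

Lemma pair_swap_crossing s j k M : (s <= k)%N -> (k.+1 < j)%N -> (j <= M.+1)%N ->
  c k * T k.+1 M * (c s * T s.+1 j) = c s * T s.+1 j.-1 * (c k.+1 * T k.+2 M.+2).
Proof.
move=> sk kj jM.
have -> : c k * T k.+1 M * (c s * T s.+1 j) = c s * (c k.+2 * T k.+3 M.+2 * T s.+1 j).
  rewrite !mulrA -[c k * _ * c s]mulrA -c_braid_product_right; last by lia.
  by rewrite mulrA -c_far.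
rewrite -[RHS]mulrA; congr (_ * _).
rewrite (braid_product_cat (i := s.+1) (j := k.+1) (k := j)); last by lia.
rewrite (braid_product_cat (i := s.+1) (j := k.+1) (k := j.-1)); last by lia.
rewrite -[RHS]mulrA [T k.+1 j.-1 * _]mulrA.
have -> : T k.+1 j.-1 * c k.+1 = c k.+1 * T k.+3 j.+1.
  have -> : j.+1 = j.-1.+2 by lia.
  by rewrite c_braid_product_right.
rewrite -[c k.+1 * _ * _]mulrA -(@braid_product_shift k.+2 M.+2 k.+2 j) //.
rewrite mulrA -[c k.+2 * _ * _]mulrA -(@braid_product_far s.+1 k.+1 k.+3) //.
rewrite [c k.+2 * _]mulrA c_braid_product_left; last by lia.
rewrite -!mulrA; congr (_ * _).
rewrite [T k.+1 j]braid_product_recl; last by lia.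
rewrite [T k.+3 _ * _]mulrA -t_braid_product_far; last by lia.
rewrite -[t k.+1 * _ * _]mulrA mulrA -c_t_cross -mulrA; congr (_ * _).
by rewrite mulrA -braid_product_recl //; lia.
Qed.

Lemma pair_firstS E : Ann E.+2 = Ann E.+1 + c 0 * T 1 E.+1.
Proof. by rewrite /Ann big_nat_recr. Qed.

Lemma pair_lastSl r m : (0 < r)%N -> L 0 r m = c 0 * T 1 (r + m) + L 1 r m.
Proof. by move=> r0; rewrite /L big_ltn. Qed.

Lemma pair_lastSr r m : (0 < r)%N ->
  L 1 r.+1 m = L 1 r m.+1 + c r * T r.+1 (r + m).+1.
Proof.
move=> r0; rewrite /L big_nat_recr // addSn; congr (_ + _).
by apply: eq_bigr => k _; rewrite addnS.
Qed.

Lemma pair_last_first e m E : (e <= E <= (e + m).+1)%N ->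
  L 0 e m * Ann E.+1 =
  Ann E * L 1 e.+1 m.+1 + Ann e.+1 * (c e.+1 * T e.+2 (e + m).+2).
Proof.
move=> eE.
pose X j := c 0 * T 1 j.
pose Y k := c k * T k.+1 (e + m).+2.
have -> : L 1 e.+1 m.+1 = \sum_(0 <= k < e) Y k.+1.
  by rewrite /L addSn addnS big_add1.
have -> : L 0 e m * Ann E.+1 =
    \sum_(0 <= k < e) (\sum_(1 <= j < k.+2) X j * Y k.+2 +
                        \sum_(k.+1 <= j < E) X j * Y k.+1).
  rewrite /L mulr_suml; apply: eq_big_nat => k ke.
  rewrite /Ann (@big_cat_nat _ _ _ k.+2) /=; try lia.
  rewrite mulrDr !mulr_sumr; congr (_ + _).
    apply: eq_big_nat => j jk.
    by rewrite pair_swap_disjoint //; lia.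
  rewrite [LHS]big_add1 /=; apply: eq_big_nat => j jk.
  by rewrite pair_swap_crossing //; lia.
pose Z k := \sum_(1 <= j < k.+1) X j * Y k.+1.
have -> : Ann E * (\sum_(0 <= k < e) Y k.+1) =
    \sum_(0 <= k < e) (Z k + \sum_(k.+1 <= j < E) X j * Y k.+1).
  rewrite mulr_sumr; apply: eq_big_nat => k ke.
  rewrite /Ann (@big_cat_nat _ _ _ k.+1) /=; try lia.
  by rewrite mulrDl !mulr_suml.
rewrite !big_split /= [RHS]addrAC; congr (_ + _).
transitivity (\sum_(0 <= k < e.+1) Z k); last by rewrite big_nat_recr //= /Z mulr_suml.
have Z0 : Z 0 = 0 by rewrite /Z big_geq.
by rewrite big_nat_recl // Z0 add0r.
Qed.

Lemma pair_first_right r p : Ann (r - p) * G 1 r p = G 0 r.-2 p * Ann r.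
Proof.
elim: p r => [|p IH] r; first by rewrite subn0 mulr1 mul1r.
have [r1|r1] := leqP r 1.
  have L0 : L 1 r p.+1 = 0 by rewrite /L big_geq.
  have A0 : Ann r = 0 by rewrite /Ann big_geq.
  by rewrite [G 1 r _]/= L0 A0 !mulr0.
have -> : (r - p.+1)%N = (r.-1 - p)%N by lia.
rewrite [G 1 r _]/= [G 0 _ _]/= mulrA IH -!mulrA; congr (_ * _).
case: r r1 => [//|[//|e _]] /=.
rewrite (@pair_last_first e p.+1 e.+1); last by lia.
rewrite -mulrDr; congr (_ * _).
by rewrite pair_lastSr // /L; congr (_ + _); rewrite ?addSn ?addnS.
Qed.

Lemma pair_right_recursion rho m :
  G 0 (rho + m).+1 m.+1 = G 1 (rho + m).+1 m.+1 - Ann rho.+2 * G 1 (rho + m).+2 m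
    + G 0 (rho + m) m * Ann (rho + m.*2).+3.
Proof.
have GE : forall s r m, G s r m.+1 = G s r.-1 m * L s r m.+1 by [].
have G0 : forall s r, G s r 0 = 1 by [].
elim: m => [|m IH].
  rewrite !(GE, G0) !mul1r mulr1 addn0 pair_lastSl // (pair_firstS rho.+1) addn1 addrA subrK.
  by rewrite addrC.
have [r rE] : exists r, r = (rho + m).+2 by eexists.
have -> : (rho + m.+1).+1 = r by rewrite rE addnS.
have -> : (rho + m.+1)%N = r.-1 by rewrite rE addnS.
have -> : (rho + m.+1.*2).+3 = (r + m).+3 by lia.
set Y := c r * T r.+1 (r + m.+1).+1.
have Gexp : G 0 r.-1 m.+1 =
    G 1 r.-1 m.+1 - Ann rho.+2 * G 1 r m + G 0 r.-2 m * Ann (r + m).+1.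
  by rewrite rE IH; congr (_ + _ * Ann _); lia.
have Gann : G 0 r.-1 m.+1 * Ann (r + m).+2 =
    G 0 r.-2 m * Ann (r + m).+1 * L 1 r m.+2 + Ann rho.+2 * G 1 r m * Y.
  have -> : rho.+2 = (r - m)%N by rewrite rE; lia.
  rewrite GE -mulrA (@pair_last_first r.-1 m.+1 (r + m).+1); last by lia.
  have -> : r.-1.+1 = r by rewrite rE.
  rewrite mulrDr !mulrA pair_first_right -!mulrA; congr (_ * _ + _ * (_ * (_ * T _ _))); by rewrite ?rE; lia.
rewrite [LHS]GE pair_lastSl ?rE // -rE mulrDr {2}Gexp.
rewrite [G 1 r m.+2]GE [G 1 r.+1 _]GE [r.+1.-1]/= pair_lastSr ?rE // -rE -/Y.
rewrite (pair_firstS (r + m).+1) [G 0 r.-1 m.+1 * (_ + _)]mulrDr Gann !addnS.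
rewrite !(mulrDl, mulrDr, mulNr) -!mulrA [LHS]addrC [RHS]addrA; congr (_ + _).
by rewrite opprD !addrA [RHS]addrAC subrK.
Qed.

End StringCalculus.

Section TensorEnd.
Context (R : realType) (d : nat).
Local Notation tensor := (tensor R d).

Definition tensor_linear (f : tensor -> tensor) : Prop :=
  forall a Phi Psi, f (fun w => a * Phi w + Psi w) = fun w => a * f Phi w + f Psi w.

Record tensor_end := TensorEnd {
  tensor_end_fun :> tensor -> tensor;
  tensor_end_linear : tensor_linear tensor_end_fun }.

HB.instance Definition _ := gen_eqMixin tensor_end.
HB.instance Definition _ := gen_choiceMixin tensor_end.

Lemma tensor_endP (f g : tensor_end) : (forall Phi w, f Phi w = g Phi w) -> f = g.
Proof.
case: f g => [f fl] [g gl] /= fg.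
have e : f = g by apply/funext => Phi; apply/funext => w; exact: fg.
by subst g; congr TensorEnd; apply: Prop_irrelevance.
Qed.

Lemma tensor_linear0 : tensor_linear (fun _ _ => 0).
Proof. by move=> a Phi Psi; apply/funext => w; rewrite mulr0 addr0. Qed.

Lemma tensor_linear1 : tensor_linear id.
Proof. by []. Qed.

Lemma tensor_linearD (f g : tensor_end) : tensor_linear (fun Phi w => f Phi w + g Phi w).
Proof.
move=> a Phi Psi; apply/funext => w.
by rewrite !tensor_end_linear mulrDr addrACA.
Qed.

Lemma tensor_linearN (f : tensor_end) : tensor_linear (fun Phi w => - f Phi w).
Proof.
by move=> a Phi Psi; apply/funext => w; rewrite !tensor_end_linear opprD mulrN.
Qed.

Lemma tensor_linearM (f g : tensor_end) : tensor_linear (fun Phi => f (g Phi)).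
Proof. by move=> a Phi Psi; rewrite !tensor_end_linear. Qed.

Definition tensor_end0 := TensorEnd tensor_linear0.
Definition tensor_end1 := TensorEnd tensor_linear1.
Definition tensor_end_add f g := TensorEnd (@tensor_linearD f g).
Definition tensor_end_opp f := TensorEnd (@tensor_linearN f).
Definition tensor_end_mul f g := TensorEnd (@tensor_linearM f g).

Lemma tensor_end_addA : associative tensor_end_add.
Proof. by move=> f g h; apply: tensor_endP => Phi w /=; rewrite addrA. Qed.
Lemma tensor_end_addC : commutative tensor_end_add.
Proof. by move=> f g; apply: tensor_endP => Phi w /=; rewrite addrC. Qed.
Lemma tensor_end_add0 : left_id tensor_end0 tensor_end_add.
Proof. by move=> f; apply: tensor_endP => Phi w /=; rewrite add0r. Qed.
Lemma tensor_end_addN : left_inverse tensor_end0 tensor_end_opp tensor_end_add.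
Proof. by move=> f; apply: tensor_endP => Phi w /=; rewrite addNr. Qed.

HB.instance Definition _ := GRing.isZmodule.Build tensor_end
  tensor_end_addA tensor_end_addC tensor_end_add0 tensor_end_addN.

Lemma tensor_end_additive (f : tensor_end) Phi Psi :
  f (fun w => Phi w + Psi w) = fun w => f Phi w + f Psi w.
Proof.
rewrite -[X in f X]/(fun w => Phi w + Psi w).
have -> : (fun w => Phi w + Psi w) = (fun w => 1 * Phi w + Psi w).
  by apply/funext => w; rewrite mul1r.
by rewrite tensor_end_linear; apply/funext => w; rewrite mul1r.
Qed.

Lemma tensor_end_zero (f : tensor_end) : f (fun=> 0) = fun=> 0.
Proof.
have := tensor_end_linear f (-1) (fun=> 0) (fun=> 0).
have -> : (fun w : seq 'I_d => -1 * 0 + 0) = (fun=> 0 : R[i]).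
  by apply/funext => w; rewrite mulr0 addr0.
by move=> {1}->; apply/funext => w; rewrite mulN1r addNr.
Qed.

Lemma tensor_end_scale (f : tensor_end) a Phi :
  f (fun w => a * Phi w) = fun w => a * f Phi w.
Proof.
have -> : (fun w => a * Phi w) = (fun w => a * Phi w + (fun=> 0) w) :> tensor.
  by apply/funext => w; rewrite addr0.
by rewrite tensor_end_linear tensor_end_zero; apply/funext => w; rewrite addr0.
Qed.

Lemma tensor_end_mulA : associative tensor_end_mul.
Proof. by move=> f g h; apply: tensor_endP. Qed.
Lemma tensor_end_mul1l : left_id tensor_end1 tensor_end_mul.
Proof. by move=> f; apply: tensor_endP. Qed.
Lemma tensor_end_mul1r : right_id tensor_end1 tensor_end_mul.
Proof. by move=> f; apply: tensor_endP. Qed.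
Lemma tensor_end_mulDl : left_distributive tensor_end_mul tensor_end_add.
Proof. by move=> f g h; apply: tensor_endP. Qed.
Lemma tensor_end_mulDr : right_distributive tensor_end_mul tensor_end_add.
Proof. by move=> f g h; apply: tensor_endP => Phi w /=; rewrite tensor_end_additive. Qed.

HB.instance Definition _ := GRing.Zmodule_isPzRing.Build tensor_end
  tensor_end_mulA tensor_end_mul1l tensor_end_mul1r tensor_end_mulDl tensor_end_mulDr.

Lemma tensor_end_mulE (f g : tensor_end) Phi : (f * g) Phi = f (g Phi).
Proof. by []. Qed.

Lemma tensor_end_addE (f g : tensor_end) Phi w : (f + g) Phi w = f Phi w + g Phi w.
Proof. by []. Qed.

Lemma tensor_end_oppE (f : tensor_end) Phi w : (- f) Phi w = - f Phi w.
Proof. by []. Qed.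

Lemma tensor_end_sumE I (r : seq I) (P : pred I) (F : I -> tensor_end) Phi w :
  (\sum_(i <- r | P i) F i) Phi w = \sum_(i <- r | P i) F i Phi w.
Proof. by elim/big_rec2 : _ => [//|i y f _ <-]. Qed.

Lemma tensor_end_sum (f : tensor_end) I (r : seq I) (P : pred I) (c : I -> R[i]) (F : I -> tensor) :
  f (fun w => \sum_(i <- r | P i) c i * F i w) = fun w => \sum_(i <- r | P i) c i * f (F i) w.
Proof.
elim: r => [|i r IH].
  have -> : (fun w => \sum_(i <- [::] | P i) c i * F i w) = (fun w => -1 * (0:R[i]) + 0) :> tensor.
    by apply/funext => w; rewrite big_nil mulr0 addr0.
  rewrite (@tensor_end_linear f (-1) (fun _ => 0) (fun _ => 0)).
  by apply/funext => w; rewrite big_nil mulN1r addNr.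
case Pi : (P i); last by under eq_fun do rewrite big_cons Pi; rewrite IH; under [in RHS]eq_fun do rewrite big_cons Pi.
under eq_fun do rewrite big_cons Pi.
by rewrite tensor_end_linear IH; under [in RHS]eq_fun do rewrite big_cons Pi.
Qed.

End TensorEnd.

Lemma split_at (T : Type) k (w : seq T) : (k <= size w)%N ->
  exists p v, w = p ++ v /\ size p = k.
Proof. by move=> kw; exists (take k w), (drop k w); rewrite cat_take_drop size_takel. Qed.

Lemma split_at2 (T : Type) k (w : seq T) : (k.+1 < size w)%N ->
  exists p x y v, w = p ++ x :: y :: v /\ size p = k.
Proof.
move=> kw; have [p [v [wE pk]]] := @split_at _ k w ltac:(lia).
case: v wE => [|x [|y v]] wE.
- by move: kw; rewrite wE size_cat /= pk; lia.
- by move: kw; rewrite wE size_cat /= pk; lia.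
- by exists p, x, y, v.
Qed.

Section LegOperators.
Context (R : realType) (d : nat) (T : 'M[R[i]]_(d * d)) (c : 'I_d -> 'I_d -> R[i]).
Local Notation tensor := (tensor R d).
Local Notation tw x y a b := (T (mxtens_index (x, y)) (mxtens_index (a, b))).

Definition cap (k : nat) (Phi : tensor) : tensor := fun w =>
  if (k <= size w)%N then
    \sum_(a < d) \sum_(b < d) c a b * Phi (take k w ++ a :: b :: drop k w)
  else 0.

Lemma twist_atE k (Phi : tensor) p x y v : size p = k ->
  twist_at T k.+1 Phi (p ++ x :: y :: v) =
  \sum_(a < d) \sum_(b < d) tw x y a b * Phi (p ++ a :: b :: v).
Proof. by move=> pk; rewrite /twist_at /= drop_size_cat // take_size_cat. Qed.

Lemma twist_at_after k (Phi : tensor) p a b m x y v : size (p ++ a :: b :: m) = k ->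
  twist_at T k.+1 Phi (p ++ a :: b :: (m ++ x :: y :: v)) =
  \sum_(a' < d) \sum_(b' < d)
    tw x y a' b' * Phi (p ++ a :: b :: (m ++ a' :: b' :: v)).
Proof.
move=> pk; rewrite -[p ++ _]/(p ++ (a :: b :: m) ++ x :: y :: v) catA twist_atE //.
by apply: eq_bigr => a' _; apply: eq_bigr => b' _; rewrite -catA.
Qed.

Lemma twist_at_short k (Phi : tensor) w : (size w <= k.+1)%N -> twist_at T k.+1 Phi w = 0.
Proof.
move=> wk; rewrite /twist_at /=.
have : (size (drop k w) <= 1)%N by rewrite size_drop; lia.
by case: (drop k w) => [|x [|y v]].
Qed.

Lemma capE k (Phi : tensor) p v : size p = k ->
  cap k Phi (p ++ v) = \sum_(a < d) \sum_(b < d) c a b * Phi (p ++ a :: b :: v).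
Proof.
move=> pk; rewrite /cap drop_size_cat // take_size_cat // size_cat pk.
by rewrite leq_addr.
Qed.

Lemma cap_after k (Phi : tensor) p a b m v : size (p ++ a :: b :: m) = k ->
  cap k Phi (p ++ a :: b :: (m ++ v)) =
  \sum_(a' < d) \sum_(b' < d) c a' b' * Phi (p ++ a :: b :: (m ++ a' :: b' :: v)).
Proof.
move=> pk; rewrite -[p ++ _]/(p ++ (a :: b :: m) ++ v) catA capE //.
by apply: eq_bigr => a' _; apply: eq_bigr => b' _; rewrite -catA.
Qed.

Lemma cap_short k (Phi : tensor) w : (size w < k)%N -> cap k Phi w = 0.
Proof. by move=> wk; rewrite /cap leqNgt wk. Qed.

Lemma twist_at_linear k : tensor_linear (twist_at T k.+1).
Proof.
move=> a Phi Psi; apply/funext => w.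
have [wk|wk] := leqP (size w) k.+1; first by rewrite !twist_at_short // mulr0 addr0.
have [p [x [y [v [-> pk]]]]] := split_at2 wk.
rewrite !twist_atE // mulr_sumr -big_split; apply: eq_bigr => s _ /=.
rewrite mulr_sumr -big_split; apply: eq_bigr => r _ /=.
by rewrite mulrDr mulrCA.
Qed.

Lemma cap_linear k : tensor_linear (cap k).
Proof.
move=> a Phi Psi; apply/funext => w.
have [wk|wk] := ltnP (size w) k; first by rewrite !cap_short // mulr0 addr0.
have [p [v [-> pk]]] := split_at wk.
rewrite !capE // mulr_sumr -big_split; apply: eq_bigr => s _ /=.
rewrite mulr_sumr -big_split; apply: eq_bigr => r _ /=.
by rewrite mulrDr mulrCA.
Qed.

Definition twist_end k : tensor_end R d := TensorEnd (twist_at_linear k).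
Definition cap_end k : tensor_end R d := TensorEnd (cap_linear k).

Local Notation sum4 F := (\sum_(a1 < d) \sum_(b1 < d) \sum_(a2 < d) \sum_(b2 < d) F a1 b1 a2 b2).

Lemma exchange_pairs (F : 'I_d -> 'I_d -> 'I_d -> 'I_d -> R[i]) :
  sum4 F = sum4 (fun a2 b2 a1 b1 => F a1 b1 a2 b2).
Proof.
transitivity (\sum_p \sum_q F p.1 p.2 q.1 q.2).
  rewrite [LHS](pair_bigA _ (fun a1 b1 => \sum_(a2 < d) \sum_(b2 < d) F a1 b1 a2 b2)).
  by apply: eq_bigr => p _; rewrite pair_bigA.
rewrite exchange_big /= [RHS](pair_bigA _ (fun a2 b2 => \sum_(a1 < d) \sum_(b1 < d) F a1 b1 a2 b2)).
by apply: eq_bigr => p _; rewrite pair_bigA.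
Qed.

(* Two operations on disjoint pairs of legs commute. *)
Lemma leg_ops_commute (f g : 'I_d -> 'I_d -> R[i]) (Psi : 'I_d -> 'I_d -> 'I_d -> 'I_d -> R[i]) :
  \sum_(a1 < d) \sum_(b1 < d) f a1 b1 *
    (\sum_(a2 < d) \sum_(b2 < d) g a2 b2 * Psi a1 b1 a2 b2) =
  \sum_(a2 < d) \sum_(b2 < d) g a2 b2 *
    (\sum_(a1 < d) \sum_(b1 < d) f a1 b1 * Psi a1 b1 a2 b2).
Proof.
transitivity (sum4 (fun a1 b1 a2 b2 => f a1 b1 * (g a2 b2 * Psi a1 b1 a2 b2))).
  apply: eq_bigr => a1 _; apply: eq_bigr => b1 _; rewrite mulr_sumr.
  by apply: eq_bigr => a2 _; rewrite mulr_sumr.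
rewrite exchange_pairs; apply: eq_bigr => a1 _; apply: eq_bigr => b1 _; rewrite mulr_sumr.
apply: eq_bigr => a2 _; rewrite mulr_sumr; apply: eq_bigr => b2 _.
exact: mulrCA.
Qed.

Lemma twist_end_far i j : (i.+1 < j)%N -> twist_end i * twist_end j = twist_end j * twist_end i.
Proof.
move=> ij; apply: tensor_endP => Phi w; rewrite !tensor_end_mulE /=.
have [wj|wj] := leqP (size w) j.+1.
  rewrite [RHS]twist_at_short //.
  have [wi|wi] := leqP (size w) i.+1; first by rewrite twist_at_short.
  have [p [x [y [v [wE pi]]]]] := split_at2 wi; rewrite wE twist_atE //.
  apply: big1 => a _; apply: big1 => b _; rewrite twist_at_short ?mulr0 //.
  by move: wj; rewrite wE !size_cat.
have [p [z [u [v [-> pj]]]]] := split_at2 wj.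
have [p1 [x [y [m [pE p1i]]]]] := @split_at2 _ i p ltac:(lia).
rewrite pE in pj *; rewrite [RHS]twist_atE // -[(p1 ++ _) ++ _]catA /= twist_atE //.
have sz a b : size (p1 ++ a :: b :: m) = j by rewrite -pj !size_cat /= ?addnS.
under [LHS]eq_bigr => a _ do under eq_bigr => b _ do rewrite (twist_at_after _ _ _ _ (sz a b)).
under [RHS]eq_bigr => a _ do under eq_bigr => b _ do rewrite -catA /= twist_atE //.
by rewrite leg_ops_commute.
Qed.

Lemma cap_twist_right i j : (i <= j)%N -> cap_end i * twist_end j.+2 = twist_end j * cap_end i.
Proof.
move=> ij; apply: tensor_endP => Phi w; rewrite !tensor_end_mulE /=.
have [wj|wj] := leqP (size w) j.+1.
  rewrite [RHS]twist_at_short //.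
  have [wi|wi] := ltnP (size w) i; first by rewrite cap_short.
  have [p [v [wE pi]]] := split_at wi; rewrite wE capE //.
  apply: big1 => a _; apply: big1 => b _; rewrite twist_at_short ?mulr0 //.
  by move: wj; rewrite wE !size_cat /=; lia.
have [p [z [u [v [-> pj]]]]] := split_at2 wj.
have [p1 [m [pE p1i]]] := @split_at _ i p ltac:(lia).
rewrite pE in pj *; rewrite [RHS]twist_atE // -[(p1 ++ _) ++ _]catA capE //.
have sz a b : size (p1 ++ a :: b :: m) = j.+2 by rewrite -pj !size_cat /= ?addnS.
under [LHS]eq_bigr => a _ do under eq_bigr => b _ do rewrite (twist_at_after _ _ _ _ (sz a b)).
under [RHS]eq_bigr => a _ do under eq_bigr => b _ do rewrite -catA capE //.
by rewrite leg_ops_commute.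
Qed.

Lemma cap_twist_left i j : (j.+1 < i)%N -> cap_end i * twist_end j = twist_end j * cap_end i.
Proof.
move=> ji; apply: tensor_endP => Phi w; rewrite !tensor_end_mulE /=.
have [wi|wi] := ltnP (size w) i.
  rewrite cap_short //.
  have [wj|wj] := leqP (size w) j.+1; first by rewrite twist_at_short.
  have [p [x [y [v [wE pj]]]]] := split_at2 wj; rewrite wE twist_atE //.
  rewrite big1 // => a _; apply: big1 => b _; rewrite cap_short ?mulr0 //.
  by move: wi; rewrite wE !size_cat.
have [p [v [-> pi]]] := split_at wi.
have [p1 [x [y [m [pE p1j]]]]] := @split_at2 _ j p ltac:(lia).
rewrite pE in pi *; rewrite [LHS]capE // -[(p1 ++ _) ++ _ in RHS]catA /= twist_atE //.
have sz a b : size (p1 ++ a :: b :: m) = i by rewrite -pi !size_cat /= ?addnS.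
under [RHS]eq_bigr => a _ do under eq_bigr => b _ do rewrite (cap_after _ _ (sz a b)).
under [LHS]eq_bigr => a _ do under eq_bigr => b _ do rewrite -catA /= twist_atE //.
by rewrite leg_ops_commute.
Qed.

Lemma cap_far i j : (i <= j)%N -> cap_end i * cap_end j.+2 = cap_end j * cap_end i.
Proof.
move=> ij; apply: tensor_endP => Phi w; rewrite !tensor_end_mulE /=.
have [wj|wj] := ltnP (size w) j.
  rewrite [RHS]cap_short //.
  have [wi|wi] := ltnP (size w) i; first by rewrite cap_short.
  have [p [v [wE pi]]] := split_at wi; rewrite wE capE //.
  apply: big1 => a _; apply: big1 => b _; rewrite cap_short ?mulr0 //.
  by move: wj; rewrite wE !size_cat /=; lia.
have [p [v [-> pj]]] := split_at wj.
have [p1 [m [pE p1i]]] := @split_at _ i p ltac:(lia).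
rewrite pE in pj *; rewrite [RHS]capE // -[(p1 ++ _) ++ _]catA capE //.
have sz a b : size (p1 ++ a :: b :: m) = j.+2 by rewrite -pj !size_cat /= ?addnS.
under [LHS]eq_bigr => a _ do under eq_bigr => b _ do rewrite (cap_after _ _ (sz a b)).
under [RHS]eq_bigr => a _ do under eq_bigr => b _ do rewrite -catA capE //.
by rewrite leg_ops_commute.
Qed.

Lemma twist_at_local k (Phi Psi : tensor) w :
  (forall u, size u = size w -> Phi u = Psi u) ->
  twist_at T k.+1 Phi w = twist_at T k.+1 Psi w.
Proof.
move=> e; have [wk|wk] := leqP (size w) k.+1; first by rewrite !twist_at_short.
have [p [x [y [v [wE pk]]]]] := split_at2 wk; rewrite wE !twist_atE //.
apply: eq_bigr => a _; apply: eq_bigr => b _; rewrite e //.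
by rewrite wE !size_cat.
Qed.

Lemma cap_local k (Phi Psi : tensor) w :
  (forall u, size u = (size w).+2 -> Phi u = Psi u) -> cap k Phi w = cap k Psi w.
Proof.
move=> e; have [wk|wk] := ltnP (size w) k; first by rewrite !cap_short.
have [p [v [wE pk]]] := split_at wk; rewrite wE !capE //.
apply: eq_bigr => a _; apply: eq_bigr => b _; rewrite e //.
by rewrite wE !size_cat /= !addnS.
Qed.

Lemma twist_at_cons k (Phi : tensor) x w :
  twist_at T k.+2 Phi (x :: w) = twist_at T k.+1 (fun v => Phi (x :: v)) w.
Proof. by []. Qed.

Lemma cap_cons k (Phi : tensor) x w :
  cap k.+1 Phi (x :: w) = cap k (fun v => Phi (x :: v)) w.
Proof. by []. Qed.

Lemma twist_at_catr k (Phi : tensor) v w : (k.+1 < size w)%N ->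
  twist_at T k.+1 Phi (w ++ v) = twist_at T k.+1 (fun u => Phi (u ++ v)) w.
Proof.
move=> wk; have [p [x [y [u [-> pk]]]]] := split_at2 wk.
rewrite -catA /= !twist_atE //.
by apply: eq_bigr => a _; apply: eq_bigr => b _; rewrite -catA.
Qed.

Lemma cap_catr k (Phi : tensor) v w : (k <= size w)%N ->
  cap k Phi (w ++ v) = cap k (fun u => Phi (u ++ v)) w.
Proof.
move=> wk; have [p [u [-> pk]]] := split_at wk.
rewrite -catA /= !capE //.
by apply: eq_bigr => a _; apply: eq_bigr => b _; rewrite -catA.
Qed.

Lemma twist_end_braid : braided T ->
  forall k, twist_end k * twist_end k.+1 * twist_end k =
    twist_end k.+1 * twist_end k * twist_end k.+1.
Proof.
move=> br k; apply: tensor_endP => Phi w; rewrite !tensor_end_mulE /=.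
elim: k Phi w => [|k IH] Phi w; last first.
  case: w => [|x w]; first by rewrite !twist_at_short.
  by exact: (IH (fun v => Phi (x :: v)) w).
case: w => [|x [|y [|z v]]]; try by rewrite ?[LHS]twist_at_short // ?[RHS]twist_at_short.
  rewrite [RHS]twist_at_short // (@twist_atE 0 _ [::]) //.
  by apply: big1 => a _; apply: big1 => b _; rewrite twist_at_short ?mulr0.
rewrite -[x :: _]/([:: x; y; z] ++ v) (twist_at_catr (k := 0)) // (twist_at_catr (k := 1)) //.
transitivity (twist_at T 1 (twist_at T 2 (twist_at T 1 (fun u => Phi (u ++ v)))) [:: x; y; z]).
  apply: twist_at_local => u us; rewrite (twist_at_catr (k := 1)) ?us //.
  by apply: twist_at_local => u' us'; rewrite (twist_at_catr (k := 0)) ?us' ?us.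
rewrite br //; apply: twist_at_local => u us; rewrite (twist_at_catr (k := 0)) ?us //.
Qed.

Definition cap_crossing : Prop := forall p q r x,
  \sum_(k < d) c p k * tw k x q r = \sum_(k < d) c k r * tw x k p q.

Lemma cap_twist_crossing : cap_crossing ->
  forall k, cap_end k * twist_end k.+1 = cap_end k.+1 * twist_end k.
Proof.
move=> cr k; apply: tensor_endP => Phi w; rewrite !tensor_end_mulE /=.
elim: k Phi w => [|k IH] Phi w; last first.
  case: w => [|x w].
    by rewrite [RHS]cap_short // cap_short.
  by exact: (IH (fun v => Phi (x :: v)) w).
case: w => [|x v].
  rewrite [RHS]cap_short // (@capE 0 _ [::] [::]) //.
  by apply: big1 => a _; apply: big1 => b _; rewrite twist_at_short ?mulr0.
rewrite (@capE 0 _ [::]) // -[x :: v]/([:: x] ++ v) [RHS]capE //=.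
under [LHS]eq_bigr => a _ do under eq_bigr => b _ do
  rewrite (@twist_atE 1 _ [:: a] b x v (erefl _)) /= mulr_sumr.
under [RHS]eq_bigr => a _ do under eq_bigr => b _ do
  rewrite (@twist_atE 0 _ [::] x a (b :: v) (erefl _)) /= mulr_sumr.
under [LHS]eq_bigr => a _ do rewrite exchange_big.
under [LHS]eq_bigr => a _ do under eq_bigr => q _ do
  under eq_bigr => b _ do rewrite mulr_sumr.
under [LHS]eq_bigr => a _ do under eq_bigr => q _ do rewrite exchange_big.
under [LHS]eq_bigr => a _ do under eq_bigr => q _ do under eq_bigr => r _ do
  (under eq_bigr => b _ do rewrite mulrA; rewrite -mulr_suml cr mulr_suml).
under [RHS]eq_bigr => a _ do under eq_bigr => r _ do under eq_bigr => p _ do rewrite mulr_sumr.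
rewrite [RHS]exchange_big /=; under [RHS]eq_bigr => r _ do rewrite exchange_big /=.
under [RHS]eq_bigr => r _ do under eq_bigr => p _ do rewrite exchange_big /=.
rewrite [RHS]exchange_big /=; apply: eq_bigr => p _.
rewrite [RHS]exchange_big /=; apply: eq_bigr => q _.
by apply: eq_bigr => r _; apply: eq_bigr => k _; rewrite mulrA.
Qed.

End LegOperators.

Section Modulus.
Context (R : rcfType).
Implicit Types z w : R[i].
Local Notation nc := Normc.normc.

Lemma normc_ge0 z : 0 <= nc z.
Proof. by case: z => x y; rewrite /nc sqrtr_ge0. Qed.

Lemma norm_normc z : `|z| = ((nc z)%:C)%C.
Proof. by []. Qed.

Lemma normc_ler z : `|complex.Re z| <= nc z.
Proof.
case: z => x y /=; rewrite -[leLHS]sqrtr_sqr ler_wsqrtr // lerDl sqr_ge0 //.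
Qed.

Lemma normc_lei z : `|complex.Im z| <= nc z.
Proof.
case: z => x y /=; rewrite -[leLHS]sqrtr_sqr ler_wsqrtr // lerDr sqr_ge0 //.
Qed.

Lemma normc_real (x : R) : nc (x%:C)%C = `|x|.
Proof. by rewrite /nc /= expr0n addr0 sqrtr_sqr. Qed.

Lemma normc_i : nc ('i%C : R[i]) = 1.
Proof. by rewrite /nc /= expr0n add0r expr1n sqrtr1. Qed.

Lemma normc_le z : nc z <= `|complex.Re z| + `|complex.Im z|.
Proof.
have -> : z = ((complex.Re z)%:C + 'i * (complex.Im z)%:C)%C.
  by rewrite -complexE.
apply: le_trans (le_normcD _ _) _.
by rewrite Normc.normcM normc_i mul1r !normc_real -complexE.
Qed.

Lemma normcB z w : nc (z - w) = nc (w - z).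
Proof. by rewrite -normcN opprB. Qed.

End Modulus.

Section PathIntegral.
Context (R : realType).
Implicit Types (u : R -> R) (w : R -> R[i]).
Local Notation nc := Normc.normc.
Local Notation mu := (@lebesgue_measure R).

Definition continuous_path w : Prop :=
  continuous (fun x => complex.Re (w x) : R) /\ continuous (fun x => complex.Im (w x) : R).

Definition path_integral a b w : R[i] :=
  Complex (\int[mu]_(x in `[a, b]) complex.Re (w x)) (\int[mu]_(x in `[a, b]) complex.Im (w x)).

Lemma continuous_integrable u a b : continuous u -> mu.-integrable `[a, b] (EFin \o u).
Proof.
move=> uc; apply: continuous_compact_integrable; first exact: segment_compact.
by apply: continuous_subspaceT => x; exact: uc.
Qed.

Lemma Rintegral_cat u a b c : continuous u -> a <= b -> b <= c ->
  \int[mu]_(x in `[a, c]) u x =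
  \int[mu]_(x in `[a, b]) u x + \int[mu]_(x in `[b, c]) u x.
Proof.
move=> uc ab bc.
have := @Rintegral_itvB R u (BLeft a) (BRight c) b (continuous_integrable _ _ uc).
rewrite !bnd_simp => /(_ ab bc) e.
apply/eqP; rewrite addrC -subr_eq; apply/eqP; rewrite e.
apply: Rintegral_itv_obnd_cbnd.
by apply: integrableS (continuous_integrable b c uc) => //; exact: subset_itv_oc_cc.
Qed.

Lemma path_integral_cat w a b c : continuous_path w -> a <= b -> b <= c ->
  path_integral a c w = path_integral a b w + path_integral b c w.
Proof. by move=> [w1 w2] ab bc; rewrite /path_integral !(@Rintegral_cat _ a b c). Qed.

Lemma path_integralB w w' a b : continuous_path w -> continuous_path w' ->
  path_integral a b (fun x => w x - w' x) = path_integral a b w - path_integral a b w'.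
Proof.
move=> [w1 w2] [w1' w2']; rewrite /path_integral.
have -> : (fun x => complex.Re (w x - w' x)) = (fun x => complex.Re (w x) - complex.Re (w' x)).
  by apply/funext => x; case: (w x) (w' x) => ? ? [? ?].
have -> : (fun x => complex.Im (w x - w' x)) = (fun x => complex.Im (w x) - complex.Im (w' x)).
  by apply/funext => x; case: (w x) (w' x) => ? ? [? ?].
by rewrite !RintegralB //; exact: continuous_integrable.
Qed.

Lemma path_integral_cst z a b : a <= b -> path_integral a b (fun=> z) = ((b - a)%:C)%C * z.
Proof.
move=> ab; rewrite /path_integral !Rintegral_cst //= lebesgue_measure_itv /= lte_fin.
have -> : fine (if a < b then (b%:E - a%:E)%E else 0%E) = b - a.
  by case: ltP => //= ba; apply/esym/eqP; rewrite subr_eq0 eq_le ab ba.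
by case: z => x y /=; simpc; congr Complex; ring.
Qed.

Lemma Rintegral_le_bound u a b B : continuous u -> a <= b ->
  (forall x, a <= x <= b -> `|u x| <= B) -> `|\int[mu]_(x in `[a, b]) u x| <= (b - a) * B.
Proof.
move=> uc ab uB.
apply: le_trans; first by apply: le_normr_Rintegral => //; exact: continuous_integrable.
apply: (@le_trans _ _ (\int[mu]_(x in `[a, b]) B)).
  apply: le_Rintegral => //.
  - apply: continuous_integrable => x.
    by apply: (@continuous_comp _ _ _ u Num.norm); [exact: uc|exact: norm_continuous].
  - by apply: continuous_integrable => x; exact: cst_continuous.
rewrite Rintegral_cst //= lebesgue_measure_itv /= lte_fin.
by case: ltP => //= ba; rewrite mulrC // mul0r mulr_ge0 // ?subr_ge0 // (le_trans _ (uB a _)) // lexx ab.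
Qed.

Lemma path_integral_bound w a b B : continuous_path w -> a <= b ->
  (forall x, a <= x <= b -> nc (w x) <= B) -> nc (path_integral a b w) <= (b - a) * B *+ 2.
Proof.
move=> [w1 w2] ab wB; apply: le_trans (normc_le _) _; rewrite mulr2n.
apply: lerD; apply: Rintegral_le_bound => // x /wB; apply: le_trans.
  exact: normc_ler.
exact: normc_lei.
Qed.

End PathIntegral.

Lemma nested_intervals (R : realType) (a b : nat -> R) :
  (forall n, a n <= a n.+1) -> (forall n, b n.+1 <= b n) -> (forall n, a n <= b n) ->
  exists x, forall n, a n <= x <= b n.
Proof.
move=> a1 b1 ab.
have am m n : (m <= n)%N -> a m <= a n.
  by move/subnK <-; elim: (n - m)%N => // k IH; exact: le_trans (a1 _).
have bm m n : (m <= n)%N -> b n <= b m.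
  by move/subnK <-; elim: (n - m)%N => // k IH; exact: le_trans (b1 _) IH.
have abmn m n : a m <= b n.
  apply: (@le_trans _ _ (a (maxn m n))); first by apply: am; rewrite leq_maxl.
  by apply: le_trans (ab _) _; apply: bm; rewrite leq_maxr.
have hs : has_sup (range a).
  by split; [exists (a 0), 0%N|exists (b 0%N) => _ [m _ <-]].
exists (sup (range a)) => n; apply/andP; split.
  by apply: ub_le_sup; [case: hs|exists n].
by apply: ge_sup; [case: hs|move=> _ [m _ <-]].
Qed.

Section Goursat.
Context (R : realType).
Local Notation nc := Normc.normc.
Implicit Types f g : R[i] -> R[i].

Definition modulus_continuous f : Prop := forall z (e : R), 0 < e ->
  exists2 r : R, 0 < r & forall w, nc (w - z) < r -> nc (f w - f z) < e.

Definition complex_differentiable f z : Prop := exists l, forall e : R, 0 < e ->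
  exists2 r : R, 0 < r &
    forall w, nc (w - z) < r -> nc (f w - f z - l * (w - z)) <= e * nc (w - z).

Lemma epsilon_delta_continuous (u : R -> R) :
  (forall x (e : R), 0 < e -> exists2 r : R, 0 < r &
    forall y, `|y - x| < r -> `|u y - u x| < e) -> continuous u.
Proof.
move=> uc x; apply/cvgrPdist_lt => e e0; have [r r0 ur] := uc x e e0.
near=> y; rewrite distrC; apply: ur; rewrite distrC.
by near: y; apply: cvgr_dist_lt.
Unshelve. all: end_near. Qed.

Lemma continuous_path_comp f (p : R -> R[i]) : modulus_continuous f ->
  (forall x y, nc (p y - p x) <= `|y - x|) -> continuous_path (fun x => f (p x)).
Proof.
move=> fc pl; split; apply: epsilon_delta_continuous => x e e0;
  have [r r0 fr] := fc (p x) e e0; exists r => // y yx.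
  by apply: le_lt_trans (fr (p y) (le_lt_trans (pl _ _) yx));
    apply: le_trans (normc_ler _); rewrite raddfB.
by apply: le_lt_trans (fr (p y) (le_lt_trans (pl _ _) yx));
  apply: le_trans (normc_lei _); rewrite raddfB.
Qed.

Lemma complexB_Re (x x' y : R) : (x +i* y)%C - (x' +i* y)%C = ((x - x')%:C)%C.
Proof. by apply/eqP; rewrite eq_complex /= subrr !eqxx. Qed.

Lemma complexB_Im (x y y' : R) : (x +i* y)%C - (x +i* y')%C = 'i%C * ((y - y')%:C)%C.
Proof. by apply/eqP; rewrite eq_complex /=; apply/andP; split; apply/eqP; ring. Qed.

Lemma horizontal_path f y : modulus_continuous f ->
  continuous_path (fun x => f (x +i* y)%C).
Proof.
move=> fc; apply: (@continuous_path_comp f (fun x => (x +i* y)%C)) => // x x'.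
by rewrite complexB_Re normc_real.
Qed.

Lemma vertical_path f x : modulus_continuous f ->
  continuous_path (fun y => f (x +i* y)%C).
Proof.
move=> fc; apply: (@continuous_path_comp f (fun y => (x +i* y)%C)) => // y y'.
by rewrite complexB_Im Normc.normcM normc_i mul1r normc_real.
Qed.

Definition contour_integral f a b c d : R[i] :=
  path_integral a b (fun x => f (x +i* c)%C) - path_integral a b (fun x => f (x +i* d)%C)
  + 'i%C * (path_integral c d (fun y => f (b +i* y)%C)
            - path_integral c d (fun y => f (a +i* y)%C)).

Lemma contour_integral_split f a m b c n d : modulus_continuous f ->
  a <= m <= b -> c <= n <= d ->
  contour_integral f a b c d =
  contour_integral f a m c n + contour_integral f m b c n +
  (contour_integral f a m n d + contour_integral f m b n d).
Proof.
move=> fc /andP[am mb] /andP[cn nd]; rewrite /contour_integral.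
rewrite !(@path_integral_cat _ _ a m b) //; try exact: horizontal_path.
rewrite !(@path_integral_cat _ _ c n d) //; try exact: vertical_path.
ring.
Qed.

Lemma contour_integralB f g a b c d : modulus_continuous f -> modulus_continuous g ->
  contour_integral (fun z => f z - g z) a b c d =
  contour_integral f a b c d - contour_integral g a b c d.
Proof.
move=> fc gc; rewrite /contour_integral.
rewrite !(@path_integralB _ (fun x => f (x +i* _)%C)); try exact: horizontal_path.
rewrite !(@path_integralB _ (fun y => f (_ +i* y)%C)); try exact: vertical_path.
ring.
Qed.

Lemma affine_continuous (l m : R[i]) : modulus_continuous (fun z => l * z + m).
Proof.
move=> z e e0; have k0 : 0 < nc l + 1 by rewrite ltr_wpDl // normc_ge0.
exists (e / (nc l + 1)) => [|w wz]; first by rewrite divr_gt0.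
have -> : l * w + m - (l * z + m) = l * (w - z) by ring.
rewrite Normc.normcM; move: wz; rewrite ltr_pdivlMr //; apply: le_lt_trans.
by rewrite mulrC ler_wpM2l ?normc_ge0 // lerDl.
Qed.

Lemma contour_integral_affine l m a b c d : a <= b -> c <= d ->
  contour_integral (fun z => l * z + m) a b c d = 0.
Proof.
move=> ab cd; have h := affine_continuous l m; rewrite /contour_integral.
rewrite -!path_integralB;
  try exact: (@horizontal_path (fun z => l * z + m) _ h);
  try exact: (@vertical_path (fun z => l * z + m) _ h).
rewrite (_ : (fun x => _ - _) = fun=> l * ('i%C * ((c - d)%:C)%C)); last first.
  by apply/funext => x; rewrite opprD addrACA subrr addr0 -mulrBr complexB_Im.
rewrite [X in path_integral c d X](_ : _ = fun=> l * ((b - a)%:C)%C); last first.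
  by apply/funext => x; rewrite opprD addrACA subrr addr0 -mulrBr complexB_Re.
rewrite !path_integral_cst //.
rewrite !rmorphB; ring.
Qed.

Lemma contour_integral_bound f a b c d B : modulus_continuous f -> a <= b -> c <= d ->
  (forall x y, a <= x <= b -> c <= y <= d -> nc (f (x +i* y)%C) <= B) ->
  nc (contour_integral f a b c d) <= 4 * (b - a + (d - c)) * B.
Proof.
move=> fc ab cd fB; rewrite /contour_integral.
apply: le_trans (le_normcD _ _) _; rewrite Normc.normcM normc_i mul1r.
have hx y : c <= y <= d ->
    nc (path_integral a b (fun x => f (x +i* y)%C)) <= (b - a) * B *+ 2.
  by move=> cyd; apply: path_integral_bound => // [|x axb]; [exact: horizontal_path|exact: fB].
have hy x : a <= x <= b ->
    nc (path_integral c d (fun y => f (x +i* y)%C)) <= (d - c) * B *+ 2.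
  by move=> axb; apply: path_integral_bound => // [|y cyd]; [exact: vertical_path|exact: fB].
have h1 := hx c _; have h2 := hx d _; have h3 := hy a _; have h4 := hy b _.
have nB (z w : R[i]) : nc (z - w) <= nc z + nc w.
  by apply: le_trans (le_normcD _ _) _; rewrite normcN.
apply: le_trans (lerD (nB _ _) (nB _ _)) _.
apply: le_trans (lerD (lerD (h1 _) (h2 _)) (lerD (h4 _) (h3 _))) _; rewrite ?lexx ?ab ?cd //.
by rewrite le_eqVlt; apply/orP; left; apply/eqP; ring.
Qed.

Definition half (s : bool) (I : R * R) : R * R :=
  if s then (I.1, (I.1 + I.2) / 2) else ((I.1 + I.2) / 2, I.2).

Lemma half_le s I : I.1 <= I.2 ->
  [/\ I.1 <= (half s I).1, (half s I).2 <= I.2, (half s I).1 <= (half s I).2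
    & (half s I).2 - (half s I).1 = (I.2 - I.1) / 2].
Proof. by case: s => /= h; split; lra. Qed.

Local Notation Q_integral f Q := (contour_integral f Q.1.1 Q.1.2 Q.2.1 Q.2.2).

Lemma contour_integral_quarter f (Q : (R * R) * (R * R)) : modulus_continuous f ->
  exists s : bool * bool, Q.1.1 <= Q.1.2 -> Q.2.1 <= Q.2.2 ->
    nc (Q_integral f Q) <= 4 * nc (Q_integral f (half s.1 Q.1, half s.2 Q.2)).
Proof.
move=> fc; case: Q => [[a b] [c d]] /=.
have [ab|/ltW ab] := leP a b; last by exists (true, true).
have [cd|/ltW cd] := leP c d; last by exists (true, true).
apply: contrapT => /forallNP h.
have {}h s1 s2 : 4 * nc (Q_integral f (half s1 (a, b), half s2 (c, d))) <
    nc (contour_integral f a b c d).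
  by rewrite ltNge; apply/negP => k; apply: (h (s1, s2)) => _ _.
have := contour_integral_split (a := a) (b := b) (c := c) (d := d)
  (m := (a + b) / 2) (n := (c + d) / 2) fc.
move=> /(_ ltac:(lra) ltac:(lra)) e.
have := h true true; have := h true false; have := h false true; have := h false false.
rewrite e /=.
set z1 := contour_integral f a _ c _; set z2 := contour_integral f _ b c _.
set z3 := contour_integral f a _ _ d; set z4 := contour_integral f _ b _ d.
have t1 := le_normcD (z1 + z2) (z3 + z4).
have t2 := le_normcD z1 z2; have t3 := le_normcD z3 z4.
lra.
Qed.

Lemma goursat f a b c d : modulus_continuous f -> a <= b -> c <= d ->
  (forall x y, a <= x <= b -> c <= y <= d -> complex_differentiable f (x +i* y)%C) ->
  contour_integral f a b c d = 0.
Proof.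
move=> fc ab cd fd.
have [s sP] := choice (fun Q => contour_integral_quarter Q fc).
pose step Q := (half (s Q).1 Q.1, half (s Q).2 Q.2).
pose Q n := iter n step ((a, b), (c, d)).
have Qle n : (Q n).1.1 <= (Q n).1.2 /\ (Q n).2.1 <= (Q n).2.2.
  elim: n => [//|n [h1 h2]] /=.
  by have [_ _ ? _] := half_le (s (Q n)).1 h1; have [_ _ ? _] := half_le (s (Q n)).2 h2.
have Qw n : ((Q n).1.2 - (Q n).1.1) + ((Q n).2.2 - (Q n).2.1) = ((b - a) + (d - c)) / 2 ^+ n.
  elim: n => [|n IH]; first by rewrite expr0 divr1.
  have [h1 h2] := Qle n.
  have [_ _ _ e1] := half_le (s (Q n)).1 h1; have [_ _ _ e2] := half_le (s (Q n)).2 h2.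
  by rewrite [Q n.+1]/= e1 e2 -mulrDl IH exprSr invfM mulrA.
have Qi n : nc (contour_integral f a b c d) <= 4 ^+ n * nc (Q_integral f (Q n)).
  elim: n => [|n IH]; first by rewrite expr0 mul1r.
  have [h1 h2] := Qle n; apply: le_trans IH _.
  by rewrite exprSr -mulrA ler_wpM2l ?exprn_ge0 //; exact: sP.
have [x0 x0P] : exists x, forall n, (Q n).1.1 <= x <= (Q n).1.2.
  apply: nested_intervals => n; have [h1 _] := Qle n => //=.
  - by have [] := half_le (s (Q n)).1 h1.
  - by have [] := half_le (s (Q n)).1 h1.
have [y0 y0P] : exists y, forall n, (Q n).2.1 <= y <= (Q n).2.2.
  apply: nested_intervals => n; have [_ h1] := Qle n => //=.
  - by have [] := half_le (s (Q n)).2 h1.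
  - by have [] := half_le (s (Q n)).2 h1.
have [l lP] := fd x0 y0 (x0P 0%N) (y0P 0%N).
set z0 := (x0 +i* y0)%C in lP.
set p := (b - a) + (d - c) in Qw.
have p0 : 0 <= p by rewrite /p; lra.
have key (e : R) : 0 < e -> nc (contour_integral f a b c d) <= 4 * p * p * e.
  move=> e0; have [r r0 rP] := lP e e0.
  have [n pn] : exists n, p / 2 ^+ n < r.
    have [n nP] : exists n, p / r < n%:R.
      exists (Num.bound (p / r)); apply: le_lt_trans (archi_boundP _) => //.
      by rewrite divr_ge0 // ltW.
    exists n; rewrite ltr_pdivrMr ?exprn_gt0 // -ltr_pdivrMl // mulrC.
    by apply: lt_trans nP _; rewrite -natrX ltr_nat ltn_expl.
  have [h1 h2] := Qle n.
  apply: le_trans (Qi n) _.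
  have -> : Q_integral f (Q n) =
      Q_integral (fun z => f z - (l * z + (f z0 - l * z0))) (Q n).
    by rewrite contour_integralB ?contour_integral_affine ?subr0 //; exact: affine_continuous.
  have gc : modulus_continuous (fun z => f z - (l * z + (f z0 - l * z0))).
    move=> z e' e'0; have e20 : 0 < e' / 2 by lra.
    have [r1 r10 h3] := fc z _ e20.
    have [r2 r20 h4] := affine_continuous l (f z0 - l * z0) z e20.
    exists (Num.min r1 r2) => [|w]; first by rewrite lt_min r10.
    rewrite lt_min => /andP[/h3 k3 /h4 k4].
    have -> : f w - (l * w + (f z0 - l * z0)) - (f z - (l * z + (f z0 - l * z0))) =
      (f w - f z) - ((l * w + (f z0 - l * z0)) - (l * z + (f z0 - l * z0))) by ring.
    by apply: le_lt_trans (le_normcD _ _) _; rewrite normcN; lra.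
  have : nc (Q_integral (fun z => f z - (l * z + (f z0 - l * z0))) (Q n)) <=
      4 * (p / 2 ^+ n) * (e * (p / 2 ^+ n)).
    rewrite -Qw; apply: contour_integral_bound => // x y xP yP.
    have zz0 : nc ((x +i* y)%C - z0) <= (Q n).1.2 - (Q n).1.1 + ((Q n).2.2 - (Q n).2.1).
      apply: le_trans (normc_le _) _; rewrite /z0; simpc => /=.
      have := x0P n; have := y0P n => ? ?.
      by apply: lerD; rewrite ler_norml; lra.
    have -> : f (x +i* y)%C - (l * (x +i* y)%C + (f z0 - l * z0)) =
      f (x +i* y)%C - f z0 - l * ((x +i* y)%C - z0) by ring.
    apply: le_trans (rP _ _) _; first by apply: le_lt_trans zz0 _; rewrite Qw.
    by rewrite ler_wpM2l // ltW.
  move=> h; apply: le_trans (ler_wpM2l _ h) _; first by rewrite exprn_ge0.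
  rewrite le_eqVlt; apply/orP; left; apply/eqP.
  have -> : 4 = 2 ^+ 2 :> R by rewrite -natrX.
  rewrite -exprM mulnC exprM; field.
  by rewrite expf_neq0.
apply: Normc.eq0_normc; apply/eqP; rewrite eq_le normc_ge0 andbT.
apply/ler_addgt0Pl => e e0; rewrite addr0.
have k0 : 0 < 4 * p * p + 1 by nra.
apply: le_trans (key (e / (4 * p * p + 1)) _) _; first by rewrite divr_gt0.
by rewrite mulrCA ger_pMr // ler_pdivrMr // mul1r lerDl.
Qed.

End Goursat.

Lemma derivable_epsilon (K : numFieldType) (f : K^o -> K^o) (x : K^o) :
  derivable f x 1 -> exists l : K, forall e : K, 0 < e ->
  exists2 r : K, 0 < r & forall h, `|h| < r -> `|f (h + x) - f x - l * h| <= e * `|h|.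
Proof.
move=> /cvg_ex[/= l fl]; exists l => e e0.
have /cvgrPdist_lt/(_ e e0) := fl.
rewrite near_withinE => /nbhs_ballP[r /= r0 rP].
exists r => // h hr.
have [->|h0] := eqVneq h 0; first by rewrite add0r subrr mulr0 subrr !normr0 mulr0.
have : `|l - h^-1 *: (f (h *: (1:K^o) + x) - f x)| < e.
  by apply: (rP h) => //; rewrite /ball /= sub0r normrN.
rewrite -[h *: 1]/(h * 1) mulr1 -[_ *: (_ - _)]/(_ * _) => /ltW le.
have -> : f (h + x) - f x - l * h = - (l - h^-1 * (f (h + x) - f x)) * h.
  by rewrite mulNr mulrBl mulrAC mulVf // mul1r opprB.
by rewrite normrM normrN ler_wpM2r.
Qed.

Section Strip.
Context (R : realType).
Local Notation nc := Normc.normc.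
Implicit Types f : R[i] -> R[i].

Lemma near_segment f (y0 L e : R) : modulus_continuous f -> 0 < e ->
  exists2 r : R, 0 < r & forall x y, 0 <= x <= L -> `|y - y0| < r ->
    nc (f (x +i* y)%C - f (x +i* y0)%C) < e.
Proof.
move=> fc e0.
have := proj1 (compact_near_coveringP (`[0, L]%classic : set R)) (@segment_compact R 0 L).
move=> /(_ R (nbhs y0) (fun y x => nc (f (x +i* y)%C - f (x +i* y0)%C) < e) _) [].
  move=> x _; have e20 : 0 < e / 2 by lra.
  have [r r0 rP] := fc (x +i* y0)%C _ e20.
  have r20 : 0 < r / 2 by lra.
  exists (ball x (r / 2), ball y0 (r / 2)).
    by split; exact: nbhsx_ballx.
  move=> [x' y'] [/= xx' yy'].
  have h1 := rP (x' +i* y')%C; have h2 := rP (x' +i* y0)%C.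
  have -> : f (x' +i* y')%C - f (x' +i* y0)%C =
    (f (x' +i* y')%C - f (x +i* y0)%C) - (f (x' +i* y0)%C - f (x +i* y0)%C) by ring.
  apply: le_lt_trans (le_normcD _ _) _; rewrite normcN.
  have {}h1 : nc (f (x' +i* y')%C - f (x +i* y0)%C) < e / 2.
    apply: h1; apply: le_lt_trans (normc_le _) _ => /=.
    by move: xx' yy'; rewrite /ball /= (distrC x) (distrC y0); lra.
  have {}h2 : nc (f (x' +i* y0)%C - f (x +i* y0)%C) < e / 2.
    apply: h2; rewrite complexB_Re normc_real.
    by move: xx'; rewrite /ball /= (distrC x); lra.
  lra.
move=> r /= r0 rP; exists r => // x y xL yr.
apply: (rP y _ x); first by rewrite /ball /= distrC.
by rewrite /= in_itv.
Qed.

Lemma strip_boundary_constants f (h M : R) (g0 g1 : R[i]) : 0 < h ->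
  modulus_continuous f ->
  (forall x y, 0 < y < h -> complex_differentiable f (x +i* y)%C) ->
  (forall x y, 0 <= y <= h -> nc (f (x +i* y)%C) <= M) ->
  (forall x, f (x +i* 0)%C = g0) -> (forall x, f (x +i* h)%C = g1) -> g0 = g1.
Proof.
move=> h0 fc fd fM f0 f1.
have M0 : 0 <= M by apply: le_trans (fM 0 0 _); rewrite ?normc_ge0 // lexx ltW.
have key (L e : R) : 0 < L -> 0 < e -> L * nc (g0 - g1) <= 4 * h * M + 4 * L * e.
  move=> L0 e0.
  have [r0 r00 r0P] := near_segment 0 L fc e0.
  have [r1 r10 r1P] := near_segment h L fc e0.
  pose y := Num.min (Num.min (r0 / 2) (r1 / 2)) (h / 4).
  have [y0 yr0 yr1 yh] : [/\ 0 < y, y <= r0 / 2, y <= r1 / 2 & y <= h / 4].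
    by rewrite !ge_min !lt_min; split; rewrite ?lexx ?orbT //; lra.
  clearbody y.
  have G0 := horizontal_path y fc; have G1 := horizontal_path (h - y) fc.
  have := @goursat R f 0 L y (h - y) fc ltac:(lra) ltac:(lra)
    (fun x z _ (zh : y <= z <= h - y) => fd x z ltac:(lra)).
  rewrite /contour_integral => /eqP; rewrite addr_eq0 => /eqP cE.
  set c0 := path_integral 0 L (fun x => f (x +i* y)%C) in cE.
  set c1 := path_integral 0 L (fun x => f (x +i* (h - y))%C) in cE.
  have sides : nc (c0 - c1) <= 4 * h * M.
    rewrite cE normcN Normc.normcM normc_i mul1r.
    apply: le_trans (le_normcD _ _) _; rewrite normcN.
    have side x : nc (path_integral y (h - y) (fun y => f (x +i* y)%C)) <= (h - y - y) * M *+ 2.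
      apply: path_integral_bound; [exact: vertical_path|lra|].
      by move=> z zy; apply: fM; lra.
    have := side L; have := side 0; rewrite !mulr2n; nra.
  have bottom : nc (c0 - (L%:C)%C * g0) <= L * e *+ 2.
    have -> : (L%:C)%C * g0 = path_integral 0 L (fun x => g0).
      by rewrite path_integral_cst ?subr0 // ltW.
    have cc : continuous_path (fun _ : R => g0) by split=> x; exact: cst_continuous.
    rewrite -path_integralB // -[X in X * e]subr0.
    apply: path_integral_bound; [|exact: ltW|].
      have g : modulus_continuous (fun z => f z - g0).
        move=> z e' e'0; have [r r00' rP] := fc z e' e'0; exists r => // w /rP.
        by rewrite opprD addrACA subrr addr0.
      exact: (horizontal_path y g).
    by move=> x xL; rewrite -(f0 x) ltW // r0P //; rewrite subr0 ger0_norm; lra.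
  have top : nc (c1 - (L%:C)%C * g1) <= L * e *+ 2.
    have -> : (L%:C)%C * g1 = path_integral 0 L (fun x => g1).
      by rewrite path_integral_cst ?subr0 // ltW.
    have cc : continuous_path (fun _ : R => g1) by split=> x; exact: cst_continuous.
    rewrite -path_integralB // -[X in X * e]subr0.
    apply: path_integral_bound; [|exact: ltW|].
      have g : modulus_continuous (fun z => f z - g1).
        move=> z e' e'0; have [r r00' rP] := fc z e' e'0; exists r => // w /rP.
        by rewrite opprD addrACA subrr addr0.
      exact: (horizontal_path (h - y) g).
    move=> x xL; rewrite -(f1 x) ltW // r1P //.
    by rewrite addrAC subrr add0r normrN ger0_norm; lra.
  have -> : L * nc (g0 - g1) = nc ((L%:C)%C * (g0 - g1)).
    by rewrite Normc.normcM normc_real gtr0_norm.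
  have -> : (L%:C)%C * (g0 - g1) = (c0 - c1) - (c0 - (L%:C)%C * g0) + (c1 - (L%:C)%C * g1).
    ring.
  apply: le_trans (le_normcD _ _) _.
  have := le_normcD (c0 - c1) (- (c0 - (L%:C)%C * g0)); rewrite normcN.
  rewrite !mulr2n in bottom top *; lra.
apply/eqP; rewrite -subr_eq0; apply/eqP/Normc.eq0_normc/eqP.
rewrite eq_le normc_ge0 andbT; rewrite leNgt; apply/negP => p0.
set p := nc (g0 - g1) in p0 key.
have L0 : 0 < (8 * h * M + 1) / p by rewrite divr_gt0 //; nra.
have e0 : 0 < p / 8 by lra.
have := key _ _ L0 e0.
have -> : (8 * h * M + 1) / p * p = 8 * h * M + 1 by rewrite divfK // gt_eqF.
have -> : 4 * ((8 * h * M + 1) / p) * (p / 8) = (8 * h * M + 1) / 2 by field; rewrite gt_eqF.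
nra.
Qed.

Lemma derivable_complex_differentiable (f : R[i]^o -> R[i]^o) (z : R[i]) :
  derivable f z 1 -> complex_differentiable f z.
Proof.
move=> /derivable_epsilon[l lP]; exists l => e e0.
have [|r r0 rP] := lP (e%:C)%C; first by rewrite ltcR.
have rE : r = ((complex.Re r)%:C)%C by rewrite RRe_real // gtr0_real.
exists (complex.Re r) => [|w wz]; first by rewrite -ltcR -rE.
have := rP (w - z); rewrite subrK !norm_normc rE ltcR => /(_ wz).
by rewrite -rmorphM lecR.
Qed.

Lemma derive_epsilon (u : R -> R) (x l : R) : is_derive x 1 u l ->
  forall e, 0 < e -> exists2 r : R, 0 < r &
    forall h, `|h| < r -> `|u (h + x) - u x - l * h| <= e * `|h|.
Proof.
move=> [du ul] e e0; move: (du) => /cvg_ex[/= l' fl'].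
have ll' : l' = l.
  by rewrite -ul; apply/esym/cvg_lim.
subst l'; have /cvgrPdist_lt/(_ e e0) := fl'.
rewrite near_withinE => /nbhs_ballP[r /= r0 rP].
exists r => // h hr.
have [->|h0] := eqVneq h 0; first by rewrite add0r subrr mulr0 subrr !normr0 mulr0.
have : `|l - h^-1 *: (u (h *: (1:R) + x) - u x)| < e.
  by apply: (rP h) => //; rewrite /ball /= sub0r normrN.
rewrite -[h *: 1]/(h * 1) mulr1 -[_ *: (_ - _)]/(_ * _) => /ltW le.
have -> : u (h + x) - u x - l * h = - (l - h^-1 * (u (h + x) - u x)) * h.
  by rewrite mulNr mulrBl mulrAC mulVf // mul1r opprB.
by rewrite normrM normrN ler_wpM2r.
Qed.

Lemma modulus_continuous_of_differentiable f :
  (forall z, complex_differentiable f z) -> modulus_continuous f.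
Proof.
move=> fd z e e0; have [l lP] := fd z.
have [r r0 rP] := lP 1 ltr01.
have k0 : 0 < nc l + 1 by rewrite ltr_wpDl // normc_ge0.
exists (Num.min r (e / (nc l + 1))) => [|w]; first by rewrite lt_min r0 divr_gt0.
rewrite lt_min => /andP[/rP h1]; rewrite ltr_pdivlMr // => h2.
have -> : f w - f z = (f w - f z - l * (w - z)) + l * (w - z) by ring.
apply: le_lt_trans (le_normcD _ _) _; rewrite Normc.normcM.
lra.
Qed.

Lemma complex_differentiableM f g z : modulus_continuous g ->
  complex_differentiable f z -> complex_differentiable g z ->
  complex_differentiable (fun w => f w * g w) z.
Proof.
move=> gc [l lP] [m mP]; exists (l * g z + f z * m) => e e0.
pose k := nc (g z) + 1 + nc l + nc (f z).
have k0 : 0 < k by rewrite /k; have := normc_ge0 (g z); have := normc_ge0 l;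
  have := normc_ge0 (f z); lra.
have ek0 : 0 < e / k by rewrite divr_gt0.
have [r1 r10 h1] := lP _ ek0.
have [r2 r20 h2] := mP _ ek0.
have ek1 : 0 < Num.min 1 (e / k) by rewrite lt_min ltr01.
have [r3 r30 h3] := gc z _ ek1.
exists (Num.min (Num.min r1 r2) r3) => [|w]; first by rewrite !lt_min r10 r20 r30.
rewrite !lt_min => /andP[/andP[/h1 {}h1 /h2 {}h2] /h3]; rewrite lt_min => /andP[h4 h5].
have -> : f w * g w - f z * g z - (l * g z + f z * m) * (w - z) =
  (f w - f z - l * (w - z)) * g w + l * (w - z) * (g w - g z)
  + f z * (g w - g z - m * (w - z)) by ring.
apply: le_trans (le_normcD _ _) _; apply: le_trans (lerD (le_normcD _ _) (lexx _)) _.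
rewrite !Normc.normcM.
have gw : nc (g w) <= nc (g z) + 1.
  have -> : g w = g z + (g w - g z) by ring.
  by apply: le_trans (le_normcD _ _) _; rewrite lerD2l ltW.
have n0 := normc_ge0 (w - z).
have t1 : nc (f w - f z - l * (w - z)) * nc (g w) <= e / k * nc (w - z) * (nc (g z) + 1).
  by apply: ler_pM => //; exact: normc_ge0.
have t2 : nc l * nc (w - z) * nc (g w - g z) <= nc l * nc (w - z) * (e / k).
  by apply: ler_wpM2l; [rewrite mulr_ge0 ?normc_ge0|exact: ltW].
have t3 : nc (f z) * nc (g w - g z - m * (w - z)) <= nc (f z) * (e / k * nc (w - z)).
  by apply: ler_wpM2l => //; exact: normc_ge0.
apply: le_trans (lerD (lerD t1 t2) t3) _.
have -> : e / k * nc (w - z) * (nc (g z) + 1) + nc l * nc (w - z) * (e / k) +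
   nc (f z) * (e / k * nc (w - z)) =
   e / k * (nc (g z) + 1 + nc l + nc (f z)) * nc (w - z) by ring.
by rewrite -/k divfK // gt_eqF.
Qed.

Definition phase (a t : R) : R[i] := (cos (a * t) +i* sin (a * t))%C.

(* the function exp(- i a z) *)
Definition plane_wave (a : R) (z : R[i]) : R[i] :=
  ((expR (a * complex.Im z))%:C)%C * phase a (- complex.Re z).

Lemma phaseD a s t : phase a (s + t) = phase a s * phase a t.
Proof.
rewrite /phase mulrDr cosD sinD.
by apply/eqP; rewrite eq_complex /=; apply/andP; split; apply/eqP; ring.
Qed.

Lemma phase0 a : phase a 0 = 1.
Proof. by rewrite /phase mulr0 cos0 sin0. Qed.

Lemma normc_phase a t : nc (phase a t) = 1.
Proof. by rewrite /Normc.normc /= cos2Dsin2 sqrtr1. Qed.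

Lemma plane_waveD a z w : plane_wave a (z + w) = plane_wave a z * plane_wave a w.
Proof.
case: z w => [x y] [x' y']; rewrite /plane_wave.
rewrite [(x +i* y)%C + _](_ : _ = ((x + x') +i* (y + y'))%C) //=.
by rewrite opprD phaseD mulrDr expRD rmorphM /=; ring.
Qed.

Lemma plane_wave_differentiable a z : complex_differentiable (plane_wave a) z.
Proof.
exists (- 'i%C * (a%:C)%C * plane_wave a z) => e e0.
have N0 : 0 < nc (plane_wave a z) + 1 by rewrite ltr_wpDl // normc_ge0.
pose e' := Num.min 1 (e / (nc (plane_wave a z) + 1) / 10).
have e'0 : 0 < e' by rewrite lt_min ltr01 !divr_gt0.
have ede : is_derive (0 : R) (1 : R) (fun y : R => expR (a * y) : R) a.
  by apply: is_derive_eq; rewrite mulr0 expR0 mul1r /GRing.scale /= mulr1.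
have edc : is_derive (0 : R) (1 : R) (fun x : R => cos (a * x) : R) 0.
  by apply: is_derive_eq; rewrite mulr0 sin0 oppr0 mul0r.
have eds : is_derive (0 : R) (1 : R) (fun x : R => sin (a * x) : R) a.
  by apply: is_derive_eq; rewrite mulr0 cos0 mul1r /GRing.scale /= mulr1.
have [r1 r10 h1] := derive_epsilon ede e'0.
have [r2 r20 h2] := derive_epsilon edc e'0.
have [r3 r30 h3] := derive_epsilon eds e'0.
pose A := `|a| + 1; have A0 : 1 <= A by rewrite lerDr normr_ge0.
pose r4 := e' / (A * A).
have r40 : 0 < r4 by rewrite divr_gt0 // mulr_gt0 //; lra.
exists (Num.min (Num.min r1 r2) (Num.min r3 r4)) => [|w].
  by rewrite !lt_min r10 r20 r30.
rewrite !lt_min => /andP[/andP[w1 w2] /andP[w3 w4]].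
set k := w - z in w1 w2 w3 w4 *.
have -> : plane_wave a w - plane_wave a z - - 'i%C * (a%:C)%C * plane_wave a z * k =
    plane_wave a z * (plane_wave a k - 1 + 'i%C * (a%:C)%C * k).
  have -> : w = z + k by rewrite /k addrC subrK.
  rewrite plane_waveD; ring.
rewrite Normc.normcM.
suff kP : nc (plane_wave a k - 1 + 'i%C * (a%:C)%C * k) <= 5 * e' * nc k.
  apply: le_trans (ler_wpM2l (normc_ge0 _) kP) _.
  have e'e : e' <= e / (nc (plane_wave a z) + 1) / 10.
    by rewrite /e' ge_min lexx orbT.
  rewrite mulrA; apply: ler_wpM2r; first exact: normc_ge0.
  apply: le_trans (_ : (nc (plane_wave a z) + 1) * (5 * e') <= _).
    by apply: ler_wpM2r; [rewrite mulr_ge0 // ltW|rewrite lerDl].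
  apply: le_trans (_ : (nc (plane_wave a z) + 1) * (5 * (e / (nc (plane_wave a z) + 1) / 10)) <= _).
    by rewrite ler_pM2l // ler_pM2l.
  have -> : (nc (plane_wave a z) + 1) * (5 * (e / (nc (plane_wave a z) + 1) / 10)) = e / 2.
    by field; rewrite gt_eqF.
  lra.
have e'1 : e' <= 1 by rewrite ge_min lexx.
clearbody e'; move: k w1 w2 w3 w4 => [x y] w1 w2 w3 w4.
have xk : `|x| <= nc (x +i* y)%C := normc_ler (x +i* y)%C.
have yk : `|y| <= nc (x +i* y)%C := normc_lei (x +i* y)%C.
have := h1 y (le_lt_trans yk w1); have := h2 x (le_lt_trans xk w2).
have := h3 x (le_lt_trans xk w3).
rewrite !addr0 !mulr0 expR0 cos0 sin0 !subr0 mul0r subr0.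
have -> : plane_wave a (x +i* y)%C - 1 + 'i%C * (a%:C)%C * (x +i* y)%C =
  ((expR (a * y) * cos (a * x) - 1 - a * y) +i* (a * x - expR (a * y) * sin (a * x)))%C.
  rewrite /plane_wave /phase /= mulrN cosN sinN.
  apply/eqP; rewrite eq_complex /=; apply/andP; split; apply/eqP; ring.
set E := expR _; set C := cos _; set S := sin _ => S1 C1 E1.
apply: le_trans (normc_le _) _ => /=.
have x0 := normr_ge0 x; have y0 := normr_ge0 y.
have yA : A * A * `|y| <= e'.
  have := le_lt_trans yk w4; rewrite /r4 ltr_pdivlMr; last by rewrite mulr_gt0 //; lra.
  by rewrite mulrC => /ltW.
have AyA : A * `|y| <= A * A * `|y| by rewrite -mulrA ler_peMl // mulr_ge0 //; lra.
have dE : `|E - 1| <= A * `|y|.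
  have -> : E - 1 = (E - 1 - a * y) + a * y by ring.
  apply: le_trans (ler_normD _ _) _; rewrite normrM /A mulrDl mul1r addrC lerD2l.
  by apply: le_trans E1 _; rewrite ler_piMl.
have dS : `|S| <= A * `|x|.
  have -> : S = (S - a * x) + a * x by ring.
  apply: le_trans (ler_normD _ _) _; rewrite normrM /A mulrDl mul1r addrC lerD2l.
  by apply: le_trans S1 _; rewrite ler_piMl.
have E2 : `|E| <= 2.
  have -> : E = (E - 1) + 1 by ring.
  by apply: le_trans (ler_normD _ _) _; rewrite normr1; lra.
have re : `|E * C - 1 - a * y| <= e' * `|y| + 2 * (e' * `|x|).
  have -> : E * C - 1 - a * y = (E - 1 - a * y) + E * (C - 1) by ring.
  apply: le_trans (ler_normD _ _) _; rewrite normrM; apply: lerD => //.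
  by apply: ler_pM.
have im : `|a * x - E * S| <= e' * `|x| + e' * `|x|.
  have -> : a * x - E * S = - (S - a * x) - (E - 1) * S by ring.
  apply: le_trans (ler_normB _ _) _; rewrite normrN normrM; apply: lerD => //.
  apply: le_trans (ler_pM _ _ dE dS) _ => //.
  have -> : A * `|y| * (A * `|x|) = A * A * `|y| * `|x| by ring.
  exact: ler_wpM2r.
have e'0' := ltW e'0.
have := ler_wpM2l e'0' xk; have := ler_wpM2l e'0' yk.
lra.
Qed.

Lemma clamp_bounds (x : R) : 0 <= Num.min (Num.max x 0) 2^-1 <= 2^-1.
Proof. by rewrite le_min le_max lexx orbT ge_min lexx orbT /= andbT invr_ge0. Qed.

Lemma clamp_lipschitz (x y : R) :
  `|Num.min (Num.max y 0) 2^-1 - Num.min (Num.max x 0) 2^-1| <= `|y - x|.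
Proof.
have h : 0 < 2^-1 :> R by rewrite invr_gt0.
have cP (u : R) : [\/ u < 0 /\ Num.min (Num.max u 0) 2^-1 = 0,
    0 <= u <= 2^-1 /\ Num.min (Num.max u 0) 2^-1 = u
    | 2^-1 < u /\ Num.min (Num.max u 0) 2^-1 = 2^-1].
  have [u0|u0] := ltP u 0.
    by apply: Or31; split=> //; rewrite min_l // ltW.
  have [uh|uh] := leP u 2^-1; first exact: Or32.
  exact: Or33.
have n1 := ler_norm (y - x); have n2 := ler_norm (x - y); rewrite distrC in n2.
rewrite ler_norml; set n := `|_| in n1 n2 *.
by case: (cP x) => -[x1 ->]; case: (cP y) => -[y1 ->]; lra.
Qed.

Lemma strip_phase_boundary (F : R[i]^o -> R[i]^o) (a : R) (g0 g1 : R[i]) :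
  let strip := [set z : R[i]^o | 0 <= complex.Im z <= 2^-1] in
  (exists M : R[i], forall z, strip z -> `|F z| <= M) ->
  {within strip, continuous F} ->
  (forall z : R[i]^o, 0 < complex.Im z < 2^-1 -> derivable F z 1) ->
  (forall t : R, F (t%:C)%C = g0 * phase a t) ->
  (forall t : R, F (t +i* 2^-1)%C = g1 * phase a t) ->
  g0 = g1 * ((expR (a / 2))%:C)%C.
Proof.
move=> strip [M FM] Fc Fd F0 F1.
pose cl (z : R[i]) : R[i] := (complex.Re z +i* Num.min (Num.max (complex.Im z) 0) 2^-1)%C.
have clS z : strip (cl z) by exact: clamp_bounds.
have cl_id z : strip z -> cl z = z.
  case: z => x y /= /andP[y0 y1]; rewrite /cl /=; congr Complex.
  by rewrite max_l // min_l.
have cl_lip z w : nc (cl w - cl z) <= nc (w - z).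
  case: z w => x y [x' y']; rewrite /cl /=.
  have -> : (x' +i* y')%C - (x +i* y)%C = ((x' - x) +i* (y' - y))%C by simpc.
  rewrite (_ : _ - _ = ((x' - x) +i* (Num.min (Num.max y' 0) 2^-1 - Num.min (Num.max y 0) 2^-1))%C);
    last by simpc.
  rewrite /Normc.normc ler_wsqrtr // lerD2l -[leLHS]real_normK ?num_real //.
  rewrite -[leRHS]real_normK ?num_real // ler_sqr ?nnegrE //; exact: clamp_lipschitz.
have Fcl : modulus_continuous (fun z => F (cl z)).
  move=> z e e0; have := Fc; rewrite subspace_continuousP => /(_ _ (clS z)).
  move=> /cvgrPdist_lt/(_ (e%:C)%C); rewrite ltcR => /(_ e0).
  rewrite near_withinE => /nbhs_ballP[r /= r0 rP].
  have rE : r = ((complex.Re r)%:C)%C by rewrite RRe_real // gtr0_real.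
  exists (complex.Re r) => [|w wz]; first by rewrite -ltcR -rE.
  have := rP (cl w) _ (clS w); rewrite norm_normc ltcR normcB; apply.
  rewrite /ball /= norm_normc rE ltcR normcB.
  exact: le_lt_trans (cl_lip _ _) wz.
have pd z := plane_wave_differentiable a z.
have pc := modulus_continuous_of_differentiable pd.
have bound (w : R[i]) : strip w -> nc (F w) <= complex.Re M.
  move=> /FM; rewrite norm_normc => h.
  have : (0 : R[i]) <= M by apply: le_trans h; rewrite ler0c normc_ge0.
  by move=> /ger0_real/RRe_real ME; rewrite -lecR ME.
have := @strip_boundary_constants (fun z => F (cl z) * plane_wave a z) 2^-1
  (complex.Re M * expR `|a|) g0 (g1 * ((expR (a / 2))%:C)%C).
apply.
- by rewrite invr_gt0.
- move=> z e e0.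
  have k0 : 0 < nc (F (cl z)) + nc (plane_wave a z) + 1.
    by have := normc_ge0 (F (cl z)); have := normc_ge0 (plane_wave a z); lra.
  have m0 : 0 < Num.min 1 (e / (nc (F (cl z)) + nc (plane_wave a z) + 1) / 2).
    by rewrite lt_min ltr01 !divr_gt0.
  have [r1 r10 h1] := Fcl z _ m0; have [r2 r20 h2] := pc z _ m0.
  exists (Num.min r1 r2) => [|w]; first by rewrite lt_min r10.
  rewrite lt_min => /andP[/h1 {}h1 /h2 {}h2].
  move: h1 h2; rewrite !lt_min => /andP[h1 h1'] /andP[_ h2].
  have -> : F (cl w) * plane_wave a w - F (cl z) * plane_wave a z =
    (F (cl w) - F (cl z)) * (plane_wave a w - plane_wave a z) +
    (F (cl w) - F (cl z)) * plane_wave a z + F (cl z) * (plane_wave a w - plane_wave a z).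
    by ring.
  apply: le_lt_trans (le_normcD _ _) _.
  apply: le_lt_trans (lerD (le_normcD _ _) (lexx _)) _.
  rewrite !(Normc.normcM (F (cl w) - F (cl z))) (Normc.normcM (F (cl z))).
  set k := nc (F (cl z)) + nc (plane_wave a z) + 1 in k0 h1' h2 *.
  set d := e / k / 2 in h1' h2 *.
  have d0 : 0 < d by rewrite !divr_gt0.
  have t1 := ler_pM (normc_ge0 _) (normc_ge0 _) (ltW h1) (ltW h2).
  have t2 := ler_wpM2r (normc_ge0 (plane_wave a z)) (ltW h1').
  have t3 := ler_wpM2l (normc_ge0 (F (cl z))) (ltW h2).
  apply: le_lt_trans (lerD (lerD t1 t2) t3) _.
  rewrite (_ : _ + _ = d * k); last by rewrite /k; ring.
  by rewrite /d mulrAC divfK ?gt_eqF //; lra.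
- move=> x y xy; apply: complex_differentiableM => //.
  have [l lP] := derivable_complex_differentiable (Fd (x +i* y)%C xy).
  exists l => e e0; have [r r0 rP] := lP e e0.
  exists (Num.min r (Num.min y (2^-1 - y))) => [|w].
    by rewrite !lt_min r0 subr_gt0.
  rewrite !lt_min => /andP[wr /andP[w1 w2]].
  rewrite !cl_id ?rP //; first by rewrite /strip /=; lra.
  have := normc_lei (w - (x +i* y)%C); rewrite raddfB /= ler_norml.
  by rewrite /strip /=; lra.
- move=> x y xy; rewrite Normc.normcM; apply: ler_pM; rewrite ?normc_ge0 //.
    exact: bound.
  rewrite /plane_wave Normc.normcM normc_real normc_phase mulr1 ger0_norm ?expR_ge0 //=.
  rewrite ler_expR; have := ler_norm a; have := normr_ge0 a; nra.
- move=> x; rewrite cl_id; last by rewrite /strip /=; lra.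
  rewrite -/(_%:C)%C F0 /plane_wave /= mulr0 expR0 mul1r -mulrA -phaseD subrr phase0.
  by rewrite mulr1.
- move=> x; rewrite cl_id; last by rewrite /strip /=; lra.
  by rewrite F1 /plane_wave /= mulrCA -mulrA -phaseD subrr phase0 mulr1 mulrC.
Qed.

End Strip.

Section InnerProduct.
Context (R : realType) (V : vectType R[i]) (dot : {dot V for Num.conj}).
Local Notation ip := (ip dot).

Lemma conjcE (z : R[i]) : Num.conj z = (z^*)%C.
Proof. by []. Qed.

Lemma ipDr x y z : ip x (y + z) = ip x y + ip x z.
Proof. by rewrite /ip linearDl. Qed.

Lemma ipZr a x y : ip x (a *: y) = a * ip x y.
Proof. by rewrite /ip linearZl_LR. Qed.

Lemma ip_conj x y : ip y x = ((ip x y)^*)%C.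
Proof. by rewrite /ip hermC expr0 mul1r. Qed.

Lemma ipDl x y z : ip (x + y) z = ip x z + ip y z.
Proof. by rewrite ip_conj ipDr rmorphD /= -!ip_conj. Qed.

Lemma ipZl a x y : ip (a *: x) y = ((a^*)%C) * ip x y.
Proof. by rewrite ip_conj ipZr rmorphM /= -ip_conj. Qed.

Lemma ip0r x : ip x 0 = 0.
Proof. by rewrite -(scale0r 0) ipZr mul0r. Qed.

Lemma ip0l x : ip 0 x = 0.
Proof. by rewrite ip_conj ip0r rmorph0. Qed.

Lemma ip_sumr x I (r : seq I) (P : pred I) (F : I -> V) :
  ip x (\sum_(i <- r | P i) F i) = \sum_(i <- r | P i) ip x (F i).
Proof. by elim/big_rec2 : _ => [|i y z _ <-]; rewrite ?ip0r ?ipDr. Qed.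

Lemma ip_suml x I (r : seq I) (P : pred I) (F : I -> V) :
  ip (\sum_(i <- r | P i) F i) x = \sum_(i <- r | P i) ip (F i) x.
Proof. by elim/big_rec2 : _ => [|i y z _ <-]; rewrite ?ip0l ?ipDl. Qed.

Lemma ip_ge0 x : 0 <= ip x x.
Proof. exact: dnorm_ge0. Qed.

Lemma ip_eq0 x : (ip x x == 0) = (x == 0).
Proof. exact: dnorm_eq0. Qed.

Lemma ip_inj x y : (forall z, ip z x = ip z y) -> x = y.
Proof.
by move=> h; apply/eqP; rewrite -subr_eq0 -ip_eq0 {1}/ip linearBl subr_eq0; apply/eqP/h.
Qed.

Context (d : nat) (b : 'I_d -> V) (hb : orthonormal_basis dot b).

Lemma basis_expansion (x : V) : x = \sum_i ip (b i) x *: b i.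
Proof.
have [bb bo] := hb.
have /andP[/eqP bs _] := bb.
have := memvf x; rewrite -bs => /coord_span xE.
have tE (i : 'I_#|'I_d|) : {j : 'I_d | (codom b)`_i = b j}.
  by apply: cid; apply/codomP/mem_nth; rewrite size_codom.
suff [c cE] : exists c : 'I_d -> R[i], x = \sum_j c j *: b j.
  rewrite [LHS]cE; apply: eq_bigr => i _; rewrite cE ip_sumr (bigD1 i) //= ipZr bo eqxx mulr1.
  by rewrite big1 ?addr0 // => j ji; rewrite ipZr bo eq_sym (negbTE ji) mulr0.
exists (fun j => \sum_(i < #|'I_d| | sval (tE i) == j) coord (codom_tuple b) i x).
rewrite [LHS]xE; under [RHS]eq_bigr do rewrite scaler_suml.
rewrite (exchange_big_dep xpredT) //=; apply: eq_bigr => i _.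
rewrite (big_pred1 (sval (tE i))) => [|j]; last by rewrite eq_sym.
by congr (_ *: _); exact: (svalP (tE i)).
Qed.

Lemma ip_expansion x y : ip x y = \sum_i ip x (b i) * ip (b i) y.
Proof.
rewrite {1}(basis_expansion y) ip_sumr; apply: eq_bigr => i _.
by rewrite ipZr mulrC.
Qed.

End InnerProduct.

Section PositiveOperator.
Context (R : realType) (V : vectType R[i]) (dot : {dot V for Num.conj}).
Local Notation ip := (ip dot).
Context (d : nat) (b : 'I_d -> V) (hb : orthonormal_basis dot b).
Context (Delta : 'End(V)) (hD : positive_op dot Delta).

Lemma positive_selfadjoint x y : ip x (Delta y) = ip (Delta x) y.
Proof.
have real z : ip z (Delta z) = ip (Delta z) z.
  by rewrite [RHS]ip_conj; apply/esym/CrealP; exact: ger0_real (hD z).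
have e1 := real (x + y); have e2 := real (x + ('i : R[i])%C *: y).
move: e1 e2; rewrite !linearD !linearZ /= !(ipDl, ipDr, ipZl, ipZr) (real x) (real y).
have -> : (('i : R[i])^*)%C = - 'i%C by apply/eqP; rewrite eq_complex /= oppr0 !eqxx.
have ii : 'i%C * 'i%C = -1 :> R[i] by rewrite -expr2 sqr_i.
set A := ip x (Delta y); set B := ip y (Delta x).
set C := ip (Delta x) y; set D := ip (Delta y) x => h1 h2.
have k1 : A + B - C - D = 0.
  by move/eqP: h1; rewrite -subr_eq0 => /eqP <-; ring.
have k2 : 'i%C * (A - B - C + D) = 0.
  by move/eqP: h2; rewrite -subr_eq0 => /eqP <-; ring.
have i0 : ('i%C : R[i]) != 0 by rewrite eq_complex /= oner_eq0 andbF.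
move/eqP: k2; rewrite mulf_eq0 (negbTE i0) /= => /eqP k2.
apply/eqP; rewrite -subr_eq0 -(mulrI_eq0 _ (mulfI (x := 2%:R) _)) ?pnatr_eq0 //.
have -> : 2%:R * (A - C) = (A + B - C - D) + (A - B - C + D) by ring.
by rewrite k1 k2 addr0.
Qed.

Lemma eigenbasis : exists v : 'I_d -> V, exists l : 'I_d -> R,
  [/\ forall j k, ip (v j) (v k) = (j == k)%:R,
    forall x, x = \sum_k ip (v k) x *: v k,
    forall k, Delta (v k) = ((l k)%:C)%C *: v k
    & forall k, 0 <= l k].
Proof.
pose M : 'M[R[i]]_d := \matrix_(j, i) ip (b i) (Delta (b j)).
have Mh : M \is hermsymmx.
  apply/is_hermitianmxP; rewrite expr0 scale1r; apply/matrixP => i j; rewrite !mxE.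
  by rewrite positive_selfadjoint ip_conj.
have /orthomx_spectralP ME := hermitian_normalmx Mh.
have spr := hermitian_spectral_diag_real Mh.
set P := spectralmx M in ME; set sp := spectral_diag M in ME spr.
have Pu : P \is unitarymx by exact: spectral_unitarymx.
have PM : P *m M = diag_mx sp *m P by rewrite ME !mulmxA mulmxV ?mul1mx // spectral_unit.
pose v k := \sum_j P k j *: b j.
pose l k := complex.Re (sp 0 k).
have [bb bo] := hb.
have vo i j : ip (v i) (v j) = (i == j)%:R.
  have /unitarymxP/matrixP/(_ j i) := Pu.
  rewrite !mxE => e; rewrite eq_sym -e /v ip_suml; apply: eq_bigr => k _.
  rewrite ipZl ip_sumr (bigD1 k) //= ipZr bo eqxx mulr1 big1 ?addr0.
    by rewrite !mxE mulrC.
  by move=> m mk; rewrite ipZr bo eq_sym (negbTE mk) mulr0.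
have lE k : ((l k)%:C)%C = sp 0 k.
  by rewrite RRe_real //; have /mxOverP := spr; exact.
have vD k : Delta (v k) = ((l k)%:C)%C *: v k.
  rewrite /v linear_sum scaler_sumr.
  under eq_bigr => j _ do rewrite linearZ /= (basis_expansion hb (Delta (b j))) scaler_sumr.
  rewrite exchange_big /=; apply: eq_bigr => i _.
  under eq_bigr => j _ do rewrite scalerA.
  rewrite -scaler_suml scalerA; congr (_ *: _).
  have /matrixP/(_ k i) := PM; rewrite mul_diag_mx !mxE lE => <-.
  by apply: eq_bigr => j _; rewrite mxE.
exists v, l; split => //; last first.
  move=> k; have := hD (v k); rewrite vD ipZr vo eqxx mulr1.
  by rewrite ler0c.
move=> x; apply: (@ip_inj _ _ dot) => y; rewrite (ip_expansion hb) ip_sumr.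
under [RHS]eq_bigr => k _ do rewrite ipZr {1}/v ip_suml /v ip_sumr mulr_suml.
rewrite [RHS]exchange_big /=; apply: eq_bigr => j _.
under [RHS]eq_bigr => k _ do rewrite mulr_sumr.
rewrite [RHS]exchange_big /= (bigD1 j) //= [X in _ + X]big1 ?addr0; last first.
  move=> i ij; have /mulmx1C/matrixP/(_ j i) := unitarymxP Pu.
  rewrite !mxE eq_sym (negbTE ij) => e.
  rewrite (eq_bigr (fun k => ((map_mx Num.conj P^T j k * P k i) * ip y (b i)) * ip (b j) x)); last first.
    by move=> k _; rewrite !mxE ipZl ipZr; ring.
  by rewrite -!mulr_suml e !mul0r.
have /mulmx1C/matrixP/(_ j j) := unitarymxP Pu; rewrite !mxE eqxx => e.
rewrite (eq_bigr (fun k => ((map_mx Num.conj P^T j k * P k j) * ip y (b j)) * ip (b j) x)); last first.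
  by move=> k _; rewrite !mxE ipZl ipZr; ring.
by rewrite -!mulr_suml e mul1r.
Qed.

End PositiveOperator.

Section DiagonalOperator.
Context (R : realType) (V : vectType R[i]) (dot : {dot V for Num.conj}).
Context (d : nat) (v : 'I_d -> V) (c : 'I_d -> R[i]).
Local Notation ip := (ip dot).

Definition diagonal_op (x : V) : V := \sum_k (c k * ip (v k) x) *: v k.

Lemma diagonal_op_linear : linear diagonal_op.
Proof.
move=> a x y; rewrite /diagonal_op scaler_sumr -big_split; apply: eq_bigr => k _ /=.
by rewrite ipDr ipZr mulrDr scalerDl scalerA mulrCA.
Qed.

HB.instance Definition _ := GRing.isLinear.Build R[i] V V *:%R diagonal_op diagonal_op_linear.

Definition diagonal_end : 'End(V) := linfun diagonal_op.

Lemma diagonal_endE x : diagonal_end x = diagonal_op x.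
Proof. by rewrite lfunE. Qed.

End DiagonalOperator.

Lemma conjc_realM (R : rcfType) (a : R) (z : R[i]) :
  ((((a%:C)%C * z)^*)%C = (a%:C)%C * (z^*)%C)%R.
Proof. by rewrite rmorphM; congr (_ * _); exact: conjc_real. Qed.

Section Modular.
Context (R : realType) (V : vectType R[i]) (dot : {dot V for Num.conj}).
Local Notation ip := (ip dot).
Context (d : nat) (Delta : 'End(V)) (v : 'I_d -> V) (l : 'I_d -> R).
Hypothesis v_orth : forall j k, ip (v j) (v k) = (j == k)%:R.
Hypothesis v_exp : forall x, x = \sum_k ip (v k) x *: v k.
Hypothesis v_eigen : forall k, Delta (v k) = ((l k)%:C)%C *: v k.

Lemma ip_v_sum k (c : 'I_d -> R[i]) : ip (v k) (\sum_j c j *: v j) = c k.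
Proof.
rewrite ip_sumr (bigD1 k) //= ipZr v_orth eqxx mulr1 big1 ?addr0 // => j jk.
by rewrite ipZr v_orth eq_sym (negbTE jk) mulr0.
Qed.

Lemma Delta_expansion x : Delta x = \sum_k (((l k)%:C)%C * ip (v k) x) *: v k.
Proof.
rewrite {1}(v_exp x) linear_sum; apply: eq_bigr => k _.
by rewrite linearZ /= v_eigen scalerA mulrC.
Qed.

Lemma ip_v_Delta k x : ip (v k) (Delta x) = ((l k)%:C)%C * ip (v k) x.
Proof. by rewrite Delta_expansion ip_v_sum. Qed.

Lemma fcalcE f x : fcalc f Delta x = \sum_k (f (l k) * ip (v k) x) *: v k.
Proof.
have ex : [set B : 'End(V) | forall (m : R) y, Delta y = (m%:C)%C *: y -> B y = f m *: y]
    (diagonal_end dot v (fun k => f (l k))).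
  move=> m y yE; rewrite diagonal_endE [in RHS](v_exp y) /diagonal_op scaler_sumr.
  apply: eq_bigr => k _; rewrite scalerA.
  have := ip_v_Delta k y; rewrite yE ipZr => /eqP; rewrite -subr_eq0 -mulrBl mulf_eq0.
  move=> /orP[|/eqP->]; last by rewrite !mulr0.
  by rewrite subr_eq0 => /eqP/complexI ->.
have P : forall (m : R) y, Delta y = (m%:C)%C *: y -> fcalc f Delta y = f m *: y.
  exact: (@xgetPex _ 0 _ (ex_intro _ _ ex)).
rewrite {1}(v_exp x) linear_sum; apply: eq_bigr => k _.
by rewrite linearZ /= (P (l k)) // scalerA mulrC.
Qed.

(* [ip w] of f(Delta) for an eigenvector w *)
Lemma ip_eigen_fcalc f m w x : Delta w = (m%:C)%C *: w ->
  ip w (fcalc f Delta x) = f m * ip w x.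
Proof.
move=> wE; rewrite fcalcE ip_sumr [in RHS](v_exp x) ip_sumr mulr_sumr.
apply: eq_bigr => k _; rewrite !ipZr.
have := ip_v_Delta k w; rewrite wE ipZr => /eqP; rewrite -subr_eq0 -mulrBl mulf_eq0.
move=> /orP[|/eqP kw]; last by rewrite [ip w (v k)]ip_conj kw rmorph0 !mulr0.
by rewrite subr_eq0 => /eqP/complexI ->; rewrite mulrA.
Qed.

Lemma fcalc_eigen f m w : Delta w = (m%:C)%C *: w -> fcalc f Delta w = f m *: w.
Proof.
move=> wE; apply: (@ip_inj _ _ dot) => z; rewrite (v_exp z) !ip_suml; apply: eq_bigr => k _.
rewrite !ipZl; congr (_ * _); rewrite (ip_eigen_fcalc _ _ (v_eigen k)) ipZr.
have := ip_v_Delta k w; rewrite wE ipZr => /eqP; rewrite -subr_eq0 -mulrBl mulf_eq0.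
move=> /orP[|/eqP->]; last by rewrite !mulr0.
by rewrite subr_eq0 => /eqP/complexI ->.
Qed.

Hypothesis l_ge0 : forall k, 0 <= l k.
Context (H : set V) (hH : standard_subspace dot H) (J : V -> V).
Hypothesis hJ : antiunitary dot J.
Hypothesis hS : forall x, tomita H x = J (fcalc (fun m => ((Num.sqrt m)%:C)%C) Delta x).
Local Notation S := (tomita H).
Local Notation Q := (fcalc (fun m => ((Num.sqrt m)%:C)%C) Delta).

Lemma tomita_antilinear a x y : S (a *: x + y) = (a^*)%C *: S x + S y.
Proof. by have [Jl _ _] := hJ; rewrite !hS linearD linearZ /= Jl. Qed.

Lemma tomitaD x y : S (x + y) = S x + S y.
Proof. by have := tomita_antilinear 1 x y; rewrite rmorph1 !scale1r. Qed.

Lemma tomita0 : S 0 = 0.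
Proof. by apply: (addIr (S 0)); rewrite -tomitaD !add0r. Qed.

Lemma tomitaZ a x : S (a *: x) = (a^*)%C *: S x.
Proof. by rewrite -[a *: x]addr0 tomita_antilinear tomita0 addr0. Qed.

Lemma tomita_sum I (r : seq I) (P : pred I) (F : I -> V) :
  S (\sum_(i <- r | P i) F i) = \sum_(i <- r | P i) S (F i).
Proof. by elim/big_rec2 : _ => [|i y z _ <-]; rewrite ?tomita0 ?tomitaD. Qed.

Lemma ip_tomita x y : ip (S x) (S y) = ip y (Delta x).
Proof.
have [_ Jip _] := hJ; rewrite !hS Jip !fcalcE Delta_expansion ip_suml [in RHS](v_exp y) ip_suml.
apply: eq_bigr => k _; rewrite !ipZl !ip_v_sum conjc_realM mulrACA -rmorphM /= -expr2 sqr_sqrtr //.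
by rewrite mulrCA.
Qed.

Lemma real_subspaceD x y : H x -> H y -> H (x + y).
Proof.
have [[_ Hl] _ _ _] := hH => Hx Hy.
by have := Hl 1 x y Hx Hy; rewrite rmorph1 scale1r.
Qed.

Lemma real_subspaceN x : H x -> H (- x).
Proof.
have [[H0 Hl] _ _ _] := hH => Hx.
by have := Hl (-1) x 0 Hx H0; rewrite rmorphN1 scaleN1r addr0.
Qed.

Lemma tomitaE h h' : H h -> H h' -> S (h + 'i%C *: h') = h - 'i%C *: h'.
Proof.
move=> Hh Hh'; have [_ _ Hi _] := hH.
have : [set y | exists h1 h1', [/\ H h1, H h1', h + 'i%C *: h' = h1 + 'i%C *: h1'
   & y = h1 - 'i%C *: h1']] (S (h + 'i%C *: h')).
  by apply: (@xgetPex _ 0); exists (h - 'i%C *: h'), h, h'.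
move=> [k [k' [Hk Hk' e ->]]].
have kh : h - k = 'i%C *: (k' - h').
  by apply/eqP; rewrite scalerBr subr_eq addrAC eq_sym subr_eq addrC e.
have hk0 := Hi _ _ (real_subspaceD Hh (real_subspaceN Hk)) (real_subspaceD Hk' (real_subspaceN Hh')) kh.
move/eqP: (hk0); rewrite subr_eq0 => /eqP <-.
move/eqP: kh; rewrite hk0 eq_sym scaler_eq0 eq_complex /= oner_eq0 andbF /= subr_eq0.
by move=> /eqP ->.
Qed.

Lemma standard_total x : exists h h', [/\ H h, H h' & x = h + 'i%C *: h'].
Proof.
have [[H0 Hl] Hc Hi Hd] := hH.
pose U x := exists h h', [/\ H h, H h' & x = h + 'i%C *: h'].
have Sout z : ~ U z -> S z = 0.
  move=> Uz; rewrite /tomita xgetPN // => y [h [h' [Hh Hh' zE _]]].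
  by apply: Uz; exists h, h'.
have Sin z : U z -> S (S z) = z.
  move=> [h [h' [Hh Hh' ->]]]; rewrite tomitaE // -scalerN tomitaE //.
    by rewrite scalerN opprK.
  exact: real_subspaceN.
have UD y z : U y -> U z -> U (z - y).
  move=> [h [h' [Hh Hh' ->]]] [k [k' [Hk Hk' ->]]]; exists (k - h), (k' - h'); split.
  - exact/real_subspaceD/real_subspaceN.
  - exact/real_subspaceD/real_subspaceN.
  - by rewrite scalerBr opprD addrACA.
apply: contrapT => Ux.
have U0 y : U y -> y = 0.
  move=> Uy; rewrite -(Sin y Uy).
  have : S (y + x) = 0.
    by apply: Sout => Uxy; apply: Ux; have := UD _ _ Uy Uxy; rewrite addrAC subrr add0r.
  by rewrite tomitaD (Sout x Ux) addr0 => ->; rewrite tomita0.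
have x0 : x = 0.
  have [//|xn0] := eqVneq x 0; have x_gt0 : 0 < ip x x by rewrite lt_def ip_eq0 xn0 ip_ge0.
  have xE : ip x x = ((complex.Re (ip x x))%:C)%C by rewrite RRe_real // gtr0_real.
  have r0 : 0 < complex.Re (ip x x) by rewrite -ltcR -xE.
  have n0 : 0 < hnorm dot x by rewrite /hnorm sqrtr_gt0.
  have [h [h' [Hh Hh']]] := Hd x _ n0.
  by rewrite (U0 (h + 'i%C *: h')) ?subr0 ?ltxx //; exists h, h'.
by apply: Ux; exists 0, 0; split=> //; rewrite scaler0 addr0.
Qed.

Lemma tomitaK x : S (S x) = x.
Proof.
have [h [h' [Hh Hh' ->]]] := standard_total x.
rewrite tomitaE // -scalerN tomitaE ?scalerN ?opprK //.
exact: real_subspaceN.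
Qed.

Lemma l_gt0 k : 0 < l k.
Proof.
rewrite lt_def l_ge0 andbT; apply/eqP => lk0.
have Sv : S (v k) = 0.
  apply/eqP; rewrite -(ip_eq0 dot) ip_tomita v_eigen lk0 scale0r ip0r //.
have := v_orth k k; rewrite -(tomitaK (v k)) Sv tomita0 ip0r eqxx => /eqP.
by rewrite eq_sym oner_eq0.
Qed.

Lemma Delta_selfadjoint x y : ip x (Delta y) = ip (Delta x) y.
Proof.
rewrite Delta_expansion ip_sumr [X in ip X y]Delta_expansion ip_suml.
apply: eq_bigr => k _; by rewrite ipZr ipZl conjc_realM [ip x (v k)]ip_conj mulrAC.
Qed.

Lemma tomita_eigen k : Delta (S (v k)) = (((l k)^-1)%:C)%C *: S (v k).
Proof.
apply: (@ip_inj _ _ dot) => y.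
have e1 : ip y (Delta (S (v k))) = ip (v k) (S y) by rewrite -ip_tomita tomitaK.
have e2 : ip y (S (v k)) = ((l k)%:C)%C * ip (v k) (S y).
  by rewrite -{1}(tomitaK y) ip_tomita ip_v_Delta.
rewrite e1 ipZr e2 mulrA -rmorphM /= mulVf ?mul1r // gt_eqF // l_gt0 //.
Qed.

Lemma J_eigen k : S (v k) = ((Num.sqrt (l k))%:C)%C *: J (v k).
Proof.
have [Jl _ _] := hJ; rewrite hS (fcalc_eigen _ (v_eigen k)).
rewrite -[X in J X]addr0 Jl conjc_real.
have -> : J 0 = 0.
  have := Jl 1 0 0; rewrite rmorph1 !scale1r add0r => /eqP.
  by rewrite addrC -subr_eq subrr eq_sym => /eqP.
by rewrite addr0.
Qed.

End Modular.

Section TwoBodyForm.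
Context (R : realType) (V : vectType R[i]) (dot : {dot V for Num.conj}).
Local Notation ip := (ip dot).
Context (d : nat) (b : 'I_d -> V) (hb : orthonormal_basis dot b).
Context (T : 'M[R[i]]_(d * d)).
Local Notation vec := (vec_coord dot b).
Local Notation tens2 := (tens2 dot b).

Lemma vec_coord_sum I (r : seq I) (c : I -> R[i]) (F : I -> V) i :
  vec (\sum_(k <- r) c k *: F k) i 0 = \sum_(k <- r) c k * vec (F k) i 0.
Proof. by rewrite mxE ip_sumr; apply: eq_bigr => k _; rewrite ipZr mxE. Qed.

Lemma op_coord_vec (A : 'End(V)) x : op_coord dot b A *m vec x = vec (A x).
Proof.
apply/matrixP => i j; rewrite !mxE {2}(basis_expansion hb x) linear_sum ip_sumr.
by apply: eq_bigr => k _; rewrite !mxE linearZ /= ipZr mulrC.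
Qed.

Lemma tens_vecE (x y : 'cV[R[i]]_d) i j :
  (x *t y) (mxtens_index (i, j)) 0 = x i 0 * y j 0.
Proof. by rewrite -[RHS]tensmxE; congr (_ _ _); apply/val_inj. Qed.

Lemma tens2E x y i j : tens2 x y (mxtens_index (i, j)) 0 = vec x i 0 * vec y j 0.
Proof. exact: tens_vecE. Qed.

Lemma ip2E (u w : 'cV[R[i]]_(d * d)) : ip2 u w = \sum_p (u p 0)^*%C * w p 0.
Proof. by rewrite /ip2 mxE; apply: eq_bigr => p _; rewrite !mxE. Qed.

Definition two_body (x y z w : V) : R[i] := ip2 (tens2 x y) (T *m tens2 z w).

Lemma two_bodyE x y z w : two_body x y z w =
  \sum_p \sum_q (tens2 x y p 0)^*%C * T p q * tens2 z w q 0.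
Proof.
rewrite /two_body ip2E; apply: eq_bigr => p _; rewrite [(T *m _) p 0]mxE mulr_sumr.
by apply: eq_bigr => q _; rewrite mulrA.
Qed.

Lemma tens2_suml y I (r : seq I) (c : I -> R[i]) (F : I -> V) p :
  tens2 (\sum_(k <- r) c k *: F k) y p 0 = \sum_(k <- r) c k * tens2 (F k) y p 0.
Proof.
case: (mxtens_indexP p) => i j; rewrite tens2E vec_coord_sum mulr_suml.
by apply: eq_bigr => k _; rewrite tens2E mulrA.
Qed.

Lemma tens2_sumr x I (r : seq I) (c : I -> R[i]) (F : I -> V) p :
  tens2 x (\sum_(k <- r) c k *: F k) p 0 = \sum_(k <- r) c k * tens2 x (F k) p 0.
Proof.
case: (mxtens_indexP p) => i j; rewrite tens2E vec_coord_sum mulr_sumr.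
by apply: eq_bigr => k _; rewrite tens2E mulrCA.
Qed.

Lemma two_body_sum I (r : seq I) (c : I -> R[i]) (u u' : 'cV[R[i]]_(d * d))
  (F : I -> 'cV[R[i]]_(d * d)) :
  (forall p, u p 0 = \sum_(k <- r) c k * F k p 0) ->
  ip2 u' (T *m u) = \sum_(k <- r) c k * ip2 u' (T *m F k) /\
  ip2 u (T *m u') = \sum_(k <- r) (c k)^*%C * ip2 (F k) (T *m u').
Proof.
move=> uE; split.
  under [RHS]eq_bigr do rewrite ip2E mulr_sumr.
  rewrite ip2E exchange_big; apply: eq_bigr => p _ /=.
  rewrite !mxE.
  under [RHS]eq_bigr do rewrite mulrCA mxE mulr_sumr.
  rewrite -mulr_sumr; congr (_ * _).
  rewrite exchange_big; apply: eq_bigr => q _ /=.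
  by rewrite uE mulr_sumr; apply: eq_bigr => k _; rewrite mulrCA.
under [RHS]eq_bigr do rewrite ip2E mulr_sumr.
rewrite ip2E exchange_big; apply: eq_bigr => p _ /=.
rewrite uE rmorph_sum mulr_suml; apply: eq_bigr => k _.
by rewrite rmorphM mulrA.
Qed.

Lemma two_body_sum1 y z w I (r : seq I) (c : I -> R[i]) (F : I -> V) :
  two_body (\sum_(k <- r) c k *: F k) y z w = \sum_(k <- r) (c k)^*%C * two_body (F k) y z w.
Proof. by rewrite /two_body; have [_ ->] := two_body_sum (tens2 z w) (tens2_suml y r c F). Qed.

Lemma two_body_sum2 x z w I (r : seq I) (c : I -> R[i]) (F : I -> V) :
  two_body x (\sum_(k <- r) c k *: F k) z w = \sum_(k <- r) (c k)^*%C * two_body x (F k) z w.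
Proof. by rewrite /two_body; have [_ ->] := two_body_sum (tens2 z w) (tens2_sumr x r c F). Qed.

Lemma two_body_sum3 x y w I (r : seq I) (c : I -> R[i]) (F : I -> V) :
  two_body x y (\sum_(k <- r) c k *: F k) w = \sum_(k <- r) c k * two_body x y (F k) w.
Proof. by rewrite /two_body; have [-> _] := two_body_sum (tens2 x y) (tens2_suml w r c F). Qed.

Lemma two_body_sum4 x y z I (r : seq I) (c : I -> R[i]) (F : I -> V) :
  two_body x y z (\sum_(k <- r) c k *: F k) = \sum_(k <- r) c k * two_body x y z (F k).
Proof. by rewrite /two_body; have [-> _] := two_body_sum (tens2 x y) (tens2_sumr z r c F). Qed.

Lemma two_bodyZ2 a x y z w : two_body x (a *: y) z w = (a^*)%C * two_body x y z w.
Proof. by have := two_body_sum2 x z w [:: tt] (fun=> a) (fun=> y); rewrite !big_seq1. Qed.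

Lemma two_bodyZ3 a x y z w : two_body x y (a *: z) w = a * two_body x y z w.
Proof. by have := two_body_sum3 x y w [:: tt] (fun=> a) (fun=> z); rewrite !big_seq1. Qed.

Lemma two_bodyZ4 a x y z w : two_body x y z (a *: w) = a * two_body x y z w.
Proof. by have := two_body_sum4 x y z [:: tt] (fun=> a) (fun=> w); rewrite !big_seq1. Qed.

Lemma vec_coord_basis i j : vec (b i) j 0 = (j == i)%:R.
Proof. by rewrite mxE; have [_ ->] := hb. Qed.

Lemma two_body_basis i j k l : two_body (b i) (b j) (b k) (b l) =
  T (mxtens_index (i, j)) (mxtens_index (k, l)).
Proof.
rewrite two_bodyE (bigD1 (mxtens_index (i, j))) //= (bigD1 (mxtens_index (k, l))) //=.
rewrite !tens2E !vec_coord_basis !eqxx !mulr1 rmorph1 mul1r !big1 ?addr0 //.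
  move=> p; case: (mxtens_indexP p) => i' j' h; apply: big1 => q _.
  rewrite tens2E !vec_coord_basis -natrM mulnb.
  suff -> : (i' == i) && (j' == j) = false by rewrite rmorph0 !mul0r.
  by apply: contraNF h => /andP[/eqP -> /eqP ->].
move=> q; case: (mxtens_indexP q) => i' j' h.
rewrite tens2E !vec_coord_basis -natrM mulnb.
suff -> : (i' == k) && (j' == l) = false by rewrite mulr0.
by apply: contraNF h => /andP[/eqP -> /eqP ->].
Qed.

Lemma tens_op_right (A : 'End(V)) z w :
  (1%:M *t op_coord dot b A) *m tens2 z w = tens2 z (A w).
Proof.
by have := tensmx_mul 1%:M (op_coord dot b A) (vec z) (vec w); rewrite mul1mx op_coord_vec.
Qed.

Lemma tens_op_left (A : 'End(V)) z w :
  (op_coord dot b A *t 1%:M) *m tens2 z w = tens2 (A z) w.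
Proof.
by have := tensmx_mul (op_coord dot b A) 1%:M (vec z) (vec w); rewrite mul1mx op_coord_vec.
Qed.

Lemma ip2_adjoint (M : 'M[R[i]]_(d * d)) (u w : 'cV[R[i]]_(d * d)) :
  ip2 u (M *m w) = ip2 (map_mx Num.conj M^T *m u) w.
Proof.
rewrite !ip2E; under eq_bigr do rewrite [(M *m _) _ _]mxE mulr_sumr.
rewrite exchange_big; apply: eq_bigr => q _ /=; rewrite [(_ *m u) _ _]mxE.
rewrite rmorph_sum mulr_suml; apply: eq_bigr => p _.
by rewrite rmorphM !mxE /= conjcK mulrA; congr (_ * _); rewrite mulrC.
Qed.

Lemma ip2Zl a (u w : 'cV[R[i]]_(d * d)) : ip2 (a *: u) w = (a^*)%C * ip2 u w.
Proof. by rewrite !ip2E mulr_sumr; apply: eq_bigr => p _; rewrite mxE rmorphM mulrA. Qed.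

Lemma op_coord_adjoint_eigen (A : 'End(V)) x m : (forall z, ip x (A z) = m * ip x z) ->
  map_mx Num.conj (op_coord dot b A)^T *m vec x = (m^*)%C *: vec x.
Proof.
move=> xA; apply/matrixP => i j; rewrite ord1 !mxE.
transitivity (ip (A (b i)) x).
  rewrite (ip_expansion hb); apply: eq_bigr => k _.
  by rewrite !mxE [ip (A _) _]ip_conj.
by rewrite ip_conj xA rmorphM /= -ip_conj.
Qed.

Lemma ip2_op_left (A : 'End(V)) x y (N : 'cV[R[i]]_(d * d)) m : (forall z, ip x (A z) = m * ip x z) ->
  ip2 (tens2 x y) ((op_coord dot b A *t 1%:M) *m N) = m * ip2 (tens2 x y) N.
Proof.
move=> xA; rewrite ip2_adjoint trmx_tens map_mxT.
have -> : map_mx Num.conj (op_coord dot b A)^T *t map_mx Num.conj (1%:M)^T *m tens2 x y =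
    (m^*)%C *: tens2 x y.
  have xE := op_coord_adjoint_eigen xA.
  have := tensmx_mul (map_mx Num.conj (op_coord dot b A)^T) 1%:M (vec x) (vec y).
  rewrite mul1mx xE trmx1 map_mx1 => ->.
  apply/matrixP => p j; rewrite ord1; case: (mxtens_indexP p) => k l.
  by rewrite tens_vecE [RHS]mxE tens2E [(_ *: vec x) _ _]mxE mulrA.
by rewrite ip2Zl conjcK.
Qed.

Lemma ip2_op_right (A : 'End(V)) x y (N : 'cV[R[i]]_(d * d)) m :
  (forall z, ip y (A z) = m * ip y z) ->
  ip2 (tens2 x y) ((1%:M *t op_coord dot b A) *m N) = m * ip2 (tens2 x y) N.
Proof.
move=> yA; rewrite ip2_adjoint trmx_tens map_mxT.
have -> : map_mx Num.conj (1%:M)^T *t map_mx Num.conj (op_coord dot b A)^T *m tens2 x y =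
    (m^*)%C *: tens2 x y.
  have yE : map_mx Num.conj (op_coord dot b A)^T *m vec y = (m^*)%C *: vec y.
    exact: op_coord_adjoint_eigen.
  have := tensmx_mul 1%:M (map_mx Num.conj (op_coord dot b A)^T) (vec x) (vec y).
  rewrite mul1mx yE trmx1 map_mx1 => ->.
  apply/matrixP => p j; rewrite ord1; case: (mxtens_indexP p) => k l.
  by rewrite tens_vecE [RHS]mxE tens2E [(_ *: vec y) _ _]mxE mulrCA.
by rewrite ip2Zl conjcK.
Qed.

End TwoBodyForm.

Section Crossing.
Context (R : realType) (V : vectType R[i]) (dot : {dot V for Num.conj}).
Local Notation ip := (ip dot).
Context (d : nat) (b : 'I_d -> V) (hb : orthonormal_basis dot b).
Context (T : 'M[R[i]]_(d * d)).
Context (H : set V) (hH : standard_subspace dot H) (J : V -> V) (Delta : 'End(V)).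
Hypothesis hJD : polar_decomposition dot (tomita H) J Delta.
Hypothesis hTcross : crossing_symmetric dot b J Delta T.
Local Notation S := (tomita H).
Local Notation B := (two_body dot b T).

Definition tomita_cap (a c : 'I_d) : R[i] := ip (S (b a)) (b c).

Lemma crossing_on_eigenvectors (v : 'I_d -> V) (l : 'I_d -> R) m n x z :
  (forall j k, ip (v j) (v k) = (j == k)%:R) ->
  (forall x, x = \sum_k ip (v k) x *: v k) ->
  (forall k, Delta (v k) = ((l k)%:C)%C *: v k) ->
  (forall k, 0 <= l k) ->
  ((l n)%:C)%C * B (v m) x z (v n) = B x (S (v n)) (S (v m)) z.
Proof.
move=> vo vx ve l0; have [hD hJ hS] := hJD.
have lp := l_gt0 vo vx ve l0 hH hJ hS.
have Sv := tomita_eigen vo vx ve l0 hH hJ hS.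
have SJ k := J_eigen vo vx ve hJ hS k.
have s0 k : ((Num.sqrt (l k))%:C)%C != 0 :> R[i].
  by rewrite eq_complex /= eqxx andbT gt_eqF // sqrtr_gt0.
have JE k : J (v k) = (((Num.sqrt (l k))^-1)%:C)%C *: S (v k).
  by rewrite SJ scalerA -rmorphM /= mulVf ?scale1r // gt_eqF // sqrtr_gt0.
have Jv k : Delta (J (v k)) = (((l k)^-1)%:C)%C *: J (v k).
  by rewrite JE linearZ /= Sv !scalerA mulrC.
have fE t k : (cos (t * ln k) +i* sin (t * ln k))%C = phase (ln k) t :> R[i].
  by rewrite /phase mulrC.
have [F [FM Fc Fd F0 F1]] := hTcross x (v m) z (v n).
have phN a t : phase a (- t) = phase (- a) t :> R[i] by rewrite /phase mulrN mulNr.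
have phA a a' t : phase a t * phase a' t = phase (a + a') t :> R[i].
  by rewrite /phase !(mulrC _ t) -!/(phase t _) -phaseD.
have bottom t : F (t%:C)%C = B (v m) x z (v n) * phase (ln (l m) - ln (l n)) t.
  rewrite F0 -!mulmxA tens_op_right //.
  rewrite (ip2_op_left hb _ _ (m := phase (ln (l m)) t)) //; last first.
    by move=> y; rewrite (ip_eigen_fcalc vo vx ve _ _ (ve m)) fE.
  rewrite (fcalc_eigen vo vx ve _ (ve n)) fE -/(two_body _ _ _ _ _ _ _) two_bodyZ4.
  by rewrite mulrA phN phA mulrC.
have top t : F (t +i* 2^-1)%C = B x (J (v n)) (J (v m)) z * phase (ln (l m) - ln (l n)) t.
  rewrite F1 -!mulmxA tens_op_left //.
  rewrite (ip2_op_right hb _ _ (m := phase (ln (l n)^-1) t)) //; last first.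
    by move=> y; rewrite (ip_eigen_fcalc vo vx ve _ _ (Jv n)) fE.
  rewrite (fcalc_eigen vo vx ve _ (Jv m)) fE -/(two_body _ _ _ _ _ _ _) two_bodyZ3.
  rewrite mulrA phN phA mulrC !lnV ?posrE //; congr (_ * phase _ _).
  by rewrite opprK addrC.
have := strip_phase_boundary FM Fc Fd bottom top.
rewrite JE two_bodyZ2 JE two_bodyZ3 conjc_real => ->.
have -> : expR ((ln (l m) - ln (l n)) / 2) = Num.sqrt (l m) / Num.sqrt (l n).
  have sqrtE k : expR (ln (l k) / 2) = Num.sqrt (l k).
    rewrite -[in RHS](lnK (lp k)) -[in RHS](divfK (_ : 2 != 0) (ln (l k))) ?pnatr_eq0 //.
    by rewrite mulr_natr mulr2n expRD -expr2 sqrtr_sqr ger0_norm ?expR_ge0.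
  by rewrite mulrBl expRD expRN !sqrtE.
rewrite [RHS](_ : _ = (l n * ((Num.sqrt (l n))^-1 * (Num.sqrt (l m))^-1 *
  (Num.sqrt (l m) / Num.sqrt (l n))))%:C%C * B x (S (v n)) (S (v m)) z).
  by rewrite !rmorphM /=; ring.
have sn : Num.sqrt (l n) != 0 by rewrite gt_eqF // sqrtr_gt0.
have sm : Num.sqrt (l m) != 0 by rewrite gt_eqF // sqrtr_gt0.
have -> : l n * ((Num.sqrt (l n))^-1 * (Num.sqrt (l m))^-1 * (Num.sqrt (l m) / Num.sqrt (l n))) = 1.
  rewrite -{1}(sqr_sqrtr (l0 n)); move: (Num.sqrt (l n)) (Num.sqrt (l m)) sn sm => s t s1 t1.
  by field; rewrite s1 t1.
by rewrite rmorph1 mul1r.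
Qed.

Lemma tomita_cap_crossing : cap_crossing T tomita_cap.
Proof.
have [hD hJ hS] := hJD.
have [v [l [vo vx ve l0]]] := eigenbasis hb hD.
have lp := l_gt0 vo vx ve l0 hH hJ hS.
have key x y z w : B x y z (Delta w) = B y (S w) (S x) z.
  rewrite (vx w) linear_sum.
  under eq_bigr => n _ do rewrite linearZ /=.
  rewrite two_body_sum4 (tomita_sum hJ hS).
  under [in RHS]eq_bigr => n _ do rewrite (tomitaZ hJ hS).
  rewrite two_body_sum2; apply: eq_bigr => n _; rewrite conjcK; congr (_ * _).
  rewrite (vx x) two_body_sum1 (tomita_sum hJ hS).
  under [in RHS]eq_bigr => m _ do rewrite (tomitaZ hJ hS).
  rewrite two_body_sum3; apply: eq_bigr => m _; congr (_ * _).
  by rewrite ve two_bodyZ4 crossing_on_eigenvectors.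
move=> p q r x.
pose w := \sum_k (((l k)^-1)%:C%C * ip (v k) (b r)) *: v k.
have Dw : Delta w = b r.
  rewrite (Delta_expansion vx ve) [RHS](vx (b r)); apply: eq_bigr => k _.
  rewrite (ip_v_sum vo) mulrA -rmorphM /= mulfV ?mul1r //.
  by rewrite gt_eqF.
have := key (S (b p)) (b x) (b q) w.
rewrite Dw (tomitaK hH hJ hS) (basis_expansion hb (S (b p))) two_body_sum1.
rewrite (basis_expansion hb (S w)) two_body_sum2.
under eq_bigr => k _ do rewrite two_body_basis // -ip_conj.
under [X in _ = X]eq_bigr => k _ do rewrite two_body_basis // -ip_conj.
move=> ->; apply: eq_bigr => k _; congr (_ * _).
rewrite /tomita_cap -Dw (Delta_selfadjoint vx ve).
rewrite [RHS]ip_conj -(ip_tomita vo vx ve l0 hJ hS) (tomitaK hH hJ hS) -ip_conj //.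
Qed.

End Crossing.

Section SemiInner.
Context (R : realType) (d : nat).
Local Notation tensor := (tensor R d).
Local Notation nc := Normc.normc.
Implicit Types (Phi Psi : tensor) (a : R[i]).

Record semi_inner (D : set tensor) (h : tensor -> tensor -> R[i]) : Prop := SemiInner {
  semi_inner_closed : forall a Phi Psi, D Phi -> D Psi -> D (fun w => a * Phi w + Psi w);
  semi_inner_linear : forall a Chi Phi Psi, D Chi -> D Phi -> D Psi ->
    h Chi (fun w => a * Phi w + Psi w) = a * h Chi Phi + h Chi Psi;
  semi_inner_herm : forall Phi Psi, D Phi -> D Psi -> h Psi Phi = (h Phi Psi)^*%C;
  semi_inner_ge0 : forall Phi, D Phi -> 0 <= h Phi Phi }.

Context (D : set tensor) (h : tensor -> tensor -> R[i]) (hh : semi_inner D h).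

Definition semi_norm Phi : R := Num.sqrt (complex.Re (h Phi Phi)).

Lemma semi_norm_ge0 Phi : 0 <= semi_norm Phi.
Proof. exact: sqrtr_ge0. Qed.

Lemma semi_norm_sqr Phi : D Phi -> h Phi Phi = ((semi_norm Phi ^+ 2)%:C)%C.
Proof.
move=> DPhi; have h0 := semi_inner_ge0 hh DPhi.
have hE := RRe_real (ger0_real h0).
by rewrite /semi_norm sqr_sqrtr // -ler0c hE.
Qed.

Lemma normc_sqr (z : R[i]) : (z^*)%C * z = ((nc z ^+ 2)%:C)%C.
Proof.
case: z => x y; rewrite /nc sqr_sqrtr ?addr_ge0 ?sqr_ge0 //.
by apply/eqP; rewrite eq_complex /=; apply/andP; split; apply/eqP; ring.
Qed.

Lemma semi_norm_expand a Phi Psi : D Phi -> D Psi ->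
  h (fun w => a * Phi w + Psi w) (fun w => a * Phi w + Psi w) =
  ((nc a ^+ 2 * semi_norm Phi ^+ 2 + semi_norm Psi ^+ 2)%:C)%C
    + ((a^*)%C * h Phi Psi + ((a^*)%C * h Phi Psi)^*%C).
Proof.
move=> D1 D2; have D3 := semi_inner_closed hh a D1 D2.
rewrite (semi_inner_linear hh) //.
rewrite (semi_inner_herm hh D1 D3) (semi_inner_herm hh D2 D3) !(semi_inner_linear hh) //.
have cD (y z : R[i]) : ((y + z)^*)%C = (y^*)%C + (z^*)%C by rewrite rmorphD.
have cM (y z : R[i]) : ((y * z)^*)%C = (y^*)%C * (z^*)%C by rewrite rmorphM.
rewrite !cD !cM !conjcK -(semi_inner_herm hh D1 D1) -(semi_inner_herm hh D2 D2).
rewrite (semi_inner_herm hh D1 D2) conjcK.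
have -> : ((nc a ^+ 2 * semi_norm Phi ^+ 2 + semi_norm Psi ^+ 2)%:C)%C =
    (a^*)%C * a * h Phi Phi + h Psi Psi.
  by rewrite normc_sqr !semi_norm_sqr // rmorphD rmorphM.
ring.
Qed.

Lemma cauchy_schwarz Phi Psi : D Phi -> D Psi ->
  nc (h Phi Psi) <= semi_norm Phi * semi_norm Psi.
Proof.
move=> D1 D2; set B := h Phi Psi.
have key (s : R) : 0 <= s ^+ 2 * nc B ^+ 2 * semi_norm Phi ^+ 2 + semi_norm Psi ^+ 2
    - 2 * s * nc B ^+ 2.
  have := semi_inner_ge0 hh (semi_inner_closed hh ((- s)%:C%C * B) D1 D2).
  have rc (r : R) : ((r%:C)^*)%C = r%:C%C by exact: conjc_real.
  have cM (y z : R[i]) : ((y * z)^*)%C = (y^*)%C * (z^*)%C by rewrite rmorphM.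
  have rM (r r' : R) : r%:C%C * r'%:C%C = ((r * r')%:C)%C by rewrite rmorphM.
  rewrite semi_norm_expand // -/B !cM !rc !conjcK -!mulrA [B * _]mulrC normc_sqr rM.
  rewrite -!rmorphD /= ler0c Normc.normcM normc_real normrN.
  have -> : `|s| * nc B * (`|s| * nc B * semi_norm Phi ^+ 2) =
      s ^+ 2 * (nc B ^+ 2 * semi_norm Phi ^+ 2).
    by rewrite -[in RHS](real_normK (num_real s)); ring.
  lra.
have p0 := semi_norm_ge0 Phi; have s0 := semi_norm_ge0 Psi; have b0 := normc_ge0 B.
rewrite -(@ler_pXn2r _ 2) ?nnegrE ?mulr_ge0 // exprMn.
have [p1|p1] := eqVneq (semi_norm Phi) 0.
  rewrite p1 expr0n mul0r.
  rewrite leNgt; apply/negP => Bp.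
  have := key ((semi_norm Psi ^+ 2 + 1) / nc B ^+ 2).
  rewrite p1 expr0n mulr0 add0r -mulrA divfK ?gt_eqF //.
  by have := sqr_ge0 (semi_norm Psi); lra.
have p2 : 0 < semi_norm Phi ^+ 2 by rewrite exprn_gt0 // lt_def p1.
have := key ((semi_norm Phi ^+ 2)^-1).
set x := semi_norm Phi ^+ 2 in p2 *; set y := semi_norm Psi ^+ 2; set z := nc B ^+ 2.
have -> : x^-1 ^+ 2 * z * x + y - 2 * x^-1 * z = y - z / x by field; rewrite gt_eqF.
by rewrite subr_ge0 ler_pdivrMr // mulrC.
Qed.

Lemma semi_norm_triangle a Phi Psi : D Phi -> D Psi ->
  semi_norm (fun w => a * Phi w + Psi w) <= nc a * semi_norm Phi + semi_norm Psi.
Proof.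
move=> D1 D2; have D3 := semi_inner_closed hh a D1 D2.
have p0 := semi_norm_ge0 Phi; have s0 := semi_norm_ge0 Psi; have a0 := normc_ge0 a.
rewrite -(@ler_pXn2r _ 2) ?nnegrE ?semi_norm_ge0 ?addr_ge0 ?mulr_ge0 //.
rewrite -lecR -semi_norm_sqr // semi_norm_expand // addcJ.
have cs := cauchy_schwarz D1 D2.
have re : complex.Re ((a^*)%C * h Phi Psi) <= nc a * (semi_norm Phi * semi_norm Psi).
  apply: le_trans (ler_norm _) _; apply: le_trans (normc_ler _) _.
  rewrite Normc.normcM.
  have -> : nc (a^*)%C = nc a by case: (a) => x y; rewrite /nc /= sqrrN.
  exact: ler_wpM2l.
rewrite -[2%:R](rmorph_nat (real_complex R)) -rmorphM -rmorphD lecR /= sqrrD exprMn.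
rewrite !mulr2n; lra.
Qed.

End SemiInner.

Section TensorNorm.
Context (R : realType) (d : nat).
Local Notation tensor := (tensor R d).
Local Notation nc := Normc.normc.
Implicit Types (Phi Psi : tensor) (a : R[i]).

Lemma sum_tuple_cons (V : nmodType) n (F : seq 'I_d -> V) :
  \sum_(w : n.+1.-tuple 'I_d) F w = \sum_(a < d) \sum_(w : n.-tuple 'I_d) F (a :: w).
Proof.
rewrite pair_bigA (reindex (fun p : 'I_d * n.-tuple 'I_d => cons_tuple p.1 p.2)) //=.
exists (fun w => (thead w, [tuple of behead w])) => [[a w] _|w _] /=.
  by congr (_, _); apply/val_inj.
by rewrite [in RHS](tuple_eta w).
Qed.

Lemma sum_tuple_nil (V : nmodType) (F : seq 'I_d -> V) :
  \sum_(w : 0.-tuple 'I_d) F w = F [::].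
Proof.
rewrite (big_pred1 [tuple]) // => w.
by rewrite [w]tuple0; apply/esym/eqP.
Qed.

Lemma tensor_ip_cons n Phi Psi : tensor_ip n.+1 Phi Psi =
  \sum_(a < d) tensor_ip n (fun w => Phi (a :: w)) (fun w => Psi (a :: w)).
Proof. exact: (sum_tuple_cons n (fun w => (Phi w)^*%C * Psi w)). Qed.

Lemma tensor_ip_local n Phi Phi' Psi Psi' :
  (forall w, size w = n -> Phi w = Phi' w) -> (forall w, size w = n -> Psi w = Psi' w) ->
  tensor_ip n Phi Psi = tensor_ip n Phi' Psi'.
Proof.
by move=> e e'; apply: eq_bigr => w _; rewrite e ?e' // size_tuple.
Qed.

Lemma semi_inner_tensor n : semi_inner setT (@tensor_ip R d n).
Proof.
split => //.
- move=> a Chi Phi Psi _ _ _; rewrite /tensor_ip mulr_sumr -big_split.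
  by apply: eq_bigr => w _ /=; rewrite mulrDr mulrCA.
- move=> Phi Psi _ _; rewrite /tensor_ip rmorph_sum; apply: eq_bigr => w _.
  by rewrite rmorphM /= conjcK mulrC.
- move=> Phi _; apply: sumr_ge0 => w _; rewrite normc_sqr ler0c.
  exact: sqr_ge0.
Qed.

Definition tensor_norm n Phi : R := semi_norm (@tensor_ip R d n) Phi.
Definition tensor_norm2 n Phi : R := \sum_(w : n.-tuple 'I_d) nc (Phi w) ^+ 2.

Lemma tensor_norm2E n Phi : tensor_norm n Phi ^+ 2 = tensor_norm2 n Phi.
Proof.
apply/complexI; rewrite -(semi_norm_sqr (semi_inner_tensor n)) // /tensor_ip rmorph_sum.
by apply: eq_bigr => w _; rewrite normc_sqr.
Qed.

Lemma tensor_norm_ge0 n Phi : 0 <= tensor_norm n Phi.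
Proof. exact: semi_norm_ge0. Qed.

Lemma tensor_norm2_cons n Phi :
  tensor_norm2 n.+1 Phi = \sum_(a < d) tensor_norm2 n (fun w => Phi (a :: w)).
Proof. exact: (sum_tuple_cons n (fun w => nc (Phi w) ^+ 2)). Qed.

Lemma tensor_norm2_ge0 n Phi : 0 <= tensor_norm2 n Phi.
Proof. by apply: sumr_ge0 => w _; exact: sqr_ge0. Qed.

Lemma tensor_norm2_le n Phi w : size w = n -> nc (Phi w) ^+ 2 <= tensor_norm2 n Phi.
Proof.
move=> wn; rewrite /tensor_norm2 (bigD1 (tcast wn (in_tuple w))) //=.
rewrite val_tcast /= lerDl; apply: sumr_ge0 => u _; exact: sqr_ge0.
Qed.

Lemma tensor_norm2_eq0 n Phi : tensor_norm2 n Phi = 0 -> forall w, size w = n -> Phi w = 0.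
Proof.
move=> P0 w wn; apply: Normc.eq0_normc; apply/eqP; rewrite -sqrf_eq0 eq_le sqr_ge0 andbT.
by rewrite -P0 tensor_norm2_le.
Qed.

Lemma tensor_norm_local n Phi Psi :
  (forall w, size w = n -> Phi w = Psi w) -> tensor_norm n Phi = tensor_norm n Psi.
Proof. by move=> e; rewrite /tensor_norm /semi_norm (tensor_ip_local e e). Qed.

Lemma tensor_norm_triangle n Phi Psi :
  tensor_norm n (fun w => Phi w + Psi w) <= tensor_norm n Phi + tensor_norm n Psi.
Proof.
have := semi_norm_triangle (semi_inner_tensor n) 1 (Phi := Phi) (Psi := Psi) I I.
rewrite Normc.normc1 mul1r; congr (_ <= _).
by apply: tensor_norm_local => w _; rewrite mul1r.
Qed.

Lemma tensor_normN n Phi : tensor_norm n (fun w => - Phi w) = tensor_norm n Phi.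
Proof.
rewrite /tensor_norm /semi_norm; congr (Num.sqrt (complex.Re _)).
by apply: eq_bigr => w _; rewrite rmorphN mulrNN.
Qed.

Lemma tensor_norm0 n : tensor_norm n (fun=> 0 : R[i]) = 0.
Proof.
rewrite /tensor_norm /semi_norm (_ : tensor_ip _ _ _ = 0) ?sqrtr0 //.
by apply: big1 => w _; rewrite mulr0.
Qed.

Definition op_bound n m (A : tensor -> tensor) (k : R) : Prop :=
  0 <= k /\ forall Phi, tensor_norm m (A Phi) <= k * tensor_norm n Phi.

Lemma op_bound_comp n m p A B k k' : op_bound n m A k -> op_bound m p B k' ->
  op_bound n p (fun Phi => B (A Phi)) (k' * k).
Proof.
move=> [k0 Ak] [k'0 Bk]; split => [|Phi]; first exact: mulr_ge0.
by apply: le_trans (Bk _) _; rewrite -mulrA ler_wpM2l.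
Qed.

Lemma op_bound_id n : op_bound n n id 1.
Proof. by split => // Phi; rewrite mul1r. Qed.

Lemma op_bound_le n m A k k' : op_bound n m A k -> k <= k' -> op_bound n m A k'.
Proof.
move=> [k0 Ak] kk'; split => [|Phi]; first exact: le_trans kk'.
by apply: le_trans (Ak _) _; rewrite ler_wpM2r ?tensor_norm_ge0.
Qed.

Lemma op_bound_sum n m (r : seq nat) (A : nat -> tensor_end R d) (k : nat -> R) :
  (forall i, i \in r -> op_bound n m (A i) (k i)) ->
  op_bound n m (\sum_(i <- r) A i) (\sum_(i <- r) k i).
Proof.
elim: r => [|i r IH] h.
  rewrite !big_nil; split => // Phi.
  by rewrite -[X in tensor_norm m X]/(fun _ : seq 'I_d => 0 : R[i]) tensor_norm0 mul0r.
have [k0 Ak] := h i (mem_head _ _).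
have [s0 As] := IH (fun j jr => h j (@mem_behead _ (i :: r) j jr)).
rewrite !big_cons; split => [|Phi]; first exact: addr_ge0.
rewrite mulrDl; apply: le_trans (lerD (Ak Phi) (As Phi)).
exact: tensor_norm_triangle.
Qed.

Lemma op_bound_sqr n m A k : 0 <= k ->
  (forall Phi, tensor_norm2 m (A Phi) <= k ^+ 2 * tensor_norm2 n Phi) -> op_bound n m A k.
Proof.
move=> k0 h; split => // Phi.
rewrite -(@ler_pXn2r _ 2) ?nnegrE ?mulr_ge0 ?tensor_norm_ge0 //.
by rewrite exprMn !tensor_norm2E.
Qed.

Lemma op_bound_norm2 n m A k : op_bound n m A k ->
  forall Phi, tensor_norm2 m (A Phi) <= k ^+ 2 * tensor_norm2 n Phi.
Proof.
move=> [k0 h] Phi; rewrite -!tensor_norm2E -exprMn.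
by rewrite ler_pXn2r ?nnegrE ?mulr_ge0 ?tensor_norm_ge0.
Qed.

(* An operation at legs to the right of the first one inherits the bound of its slice. *)
Lemma op_bound_cons n m (A B : tensor -> tensor) k :
  (forall Phi x w, A Phi (x :: w) = B (fun v => Phi (x :: v)) w) ->
  op_bound n m B k -> op_bound n.+1 m.+1 A k.
Proof.
move=> AB [k0 Bk]; apply: op_bound_sqr => // Phi.
rewrite !tensor_norm2_cons mulr_sumr; apply: ler_sum => x _.
have -> : (fun w => A Phi (x :: w)) = B (fun v => Phi (x :: v)).
  by apply/funext => w; exact: AB.
exact: (op_bound_norm2 (conj k0 Bk)).
Qed.

Context (T : 'M[R[i]]_(d * d)) (c : 'I_d -> 'I_d -> R[i]).

Definition cap_bound : R := Num.sqrt (\sum_(a < d) \sum_(b < d) nc (c a b) ^+ 2).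

Lemma sum_tuple2 (V : nmodType) (F : seq 'I_d -> V) :
  \sum_(w : 2.-tuple 'I_d) F w = \sum_(a < d) \sum_(b < d) F [:: a; b].
Proof.
rewrite sum_tuple_cons; apply: eq_bigr => a _.
rewrite (sum_tuple_cons 0 (fun w => F (a :: w))); apply: eq_bigr => b _.
exact: (sum_tuple_nil (fun w => F [:: a, b & w])).
Qed.

Lemma modulus_conj (z : R[i]) : nc (z^*)%C = nc z.
Proof. by case: z => x y; rewrite /nc /= sqrrN. Qed.

Lemma tensor_norm2_cons2 n Phi : tensor_norm2 n.+2 Phi =
  \sum_(w : n.-tuple 'I_d) tensor_norm2 2 (fun u => Phi (u ++ w)).
Proof.
rewrite tensor_norm2_cons.
under eq_bigr do rewrite tensor_norm2_cons.
under [RHS]eq_bigr => w _ do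
  rewrite /tensor_norm2 (sum_tuple2 (fun u => nc (Phi (u ++ w)) ^+ 2)) /=.
by rewrite [RHS]exchange_big /=; apply: eq_bigr => a _; rewrite [RHS]exchange_big.
Qed.

Lemma cap_op_bound n k : (k <= n)%N -> op_bound n.+2 n (cap_end c k) cap_bound.
Proof.
have cb0 : 0 <= cap_bound by exact: sqrtr_ge0.
elim: k n => [|k IH] n kn; last first.
  case: n kn => // n kn.
  by apply: (op_bound_cons (B := cap_end c k)) (IH n kn) => Phi x w /=; rewrite cap_cons.
apply: op_bound_sqr => // Phi; rewrite tensor_norm2_cons2 mulr_sumr.
apply: ler_sum => w _ /=; rewrite (@capE _ _ c 0 Phi [::]) //=.
pose cc : tensor := fun u => if u is [:: a; b] then ((c a b)^*)%C else 0.
have -> : \sum_(a < d) \sum_(b < d) c a b * Phi [:: a, b & w] =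
    tensor_ip 2 cc (fun u => Phi (u ++ w)).
  rewrite /tensor_ip (sum_tuple2 (fun u => (cc u)^*%C * Phi (u ++ w))).
  by apply: eq_bigr => a _; apply: eq_bigr => b _; rewrite /= conjcK.
have -> : cap_bound ^+ 2 = tensor_norm 2 cc ^+ 2.
  rewrite tensor_norm2E /tensor_norm2 (sum_tuple2 (fun u => nc (cc u) ^+ 2)) /cap_bound sqr_sqrtr.
    by apply: eq_bigr => a _; apply: eq_bigr => b _; rewrite /= modulus_conj.
  by apply: sumr_ge0 => a _; apply: sumr_ge0 => b _; exact: sqr_ge0.
rewrite -tensor_norm2E -exprMn ler_pXn2r ?nnegrE ?mulr_ge0 ?tensor_norm_ge0 ?normc_ge0 //.
exact: (cauchy_schwarz (semi_inner_tensor 2)).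
Qed.

Definition vec_of_tensor Phi : 'cV[R[i]]_(d * d) :=
  \col_p Phi [:: (mxtens_unindex p).1; (mxtens_unindex p).2].

Lemma sum_mxtens (V : nmodType) (F : 'I_(d * d) -> V) :
  \sum_p F p = \sum_(a < d) \sum_(b < d) F (mxtens_index (a, b)).
Proof.
rewrite pair_bigA (reindex (@mxtens_index d d)) /=; first by apply: eq_bigr => -[].
exists (@mxtens_unindex d d) => p _; [exact: mxtens_indexK|exact: mxtens_unindexK].
Qed.

Lemma norm2_vec_of_tensor Phi : norm2 (vec_of_tensor Phi) = tensor_norm 2 Phi.
Proof.
rewrite /norm2 /tensor_norm /semi_norm; congr (Num.sqrt (complex.Re _)).
rewrite /tensor_ip (sum_tuple2 (fun u => (Phi u)^*%C * Phi u)) /ip2 mxE sum_mxtens.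
by apply: eq_bigr => a _; apply: eq_bigr => b _; rewrite !mxE mxtens_indexK.
Qed.

Lemma mulmx_vec_of_tensor Phi :
  T *m vec_of_tensor Phi = vec_of_tensor (twist_end T 0 Phi).
Proof.
apply/matrixP => p j; rewrite ord1 !mxE sum_mxtens.
case: (mxtens_indexP p) => x y; rewrite mxtens_indexK /= (@twist_atE _ _ T 0 _ [::]) //.
by apply: eq_bigr => a _; apply: eq_bigr => b _; rewrite mxE mxtens_indexK.
Qed.

Lemma vec_of_tensor_surj (u : 'cV[R[i]]_(d * d)) : exists Phi, u = vec_of_tensor Phi.
Proof.
exists (fun s => if s is [:: a; b] then u (mxtens_index (a, b)) 0 else 0).
by apply/matrixP => p j; rewrite ord1 mxE -surjective_pairing mxtens_unindexK.
Qed.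

End TensorNorm.

Lemma geometric_sum_le (R : realType) (r : R) n : 0 <= r -> r < 1 ->
  \sum_(0 <= k < n) r ^+ k <= (1 - r)^-1.
Proof.
move=> r0 r1; have p : 0 < 1 - r by rewrite subr_gt0.
rewrite -[(1 - r)^-1]mul1r ler_pdivlMr // mulrC.
have -> : (1 - r) * (\sum_(0 <= k < n) r ^+ k) = 1 - r ^+ n.
  elim: n => [|n IH]; first by rewrite big_geq // expr0 mulr0 subrr.
  by rewrite big_nat_recr //= mulrDr IH exprS; ring.
by rewrite gerDl oppr_le0 exprn_ge0.
Qed.

Section TwistBound.
Context (R : realType) (d : nat) (T : 'M[R[i]]_(d * d)).
Local Notation tensor := (tensor R d).
Local Notation nc := Normc.normc.
Implicit Types (Phi Psi : tensor) (a : R[i]).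
Local Notation t := (twist_end T).

Lemma tensor_normZ n a Phi : tensor_norm n (fun w => a * Phi w) = nc a * tensor_norm n Phi.
Proof.
apply/eqP; rewrite -(@eqrXn2 _ 2) ?mulr_ge0 ?tensor_norm_ge0 ?normc_ge0 //.
rewrite exprMn !tensor_norm2E /tensor_norm2 mulr_sumr; apply/eqP.
by apply: eq_bigr => w _; rewrite Normc.normcM exprMn.
Qed.

Lemma twist_bounded : exists k, op_bound 2 2 (t 0) k.
Proof.
pose row (x y a c : 'I_d) := T (mxtens_index (x, y)) (mxtens_index (a, c)).
pose K := \sum_(x < d) \sum_(y < d) cap_bound (row x y) ^+ 2.
have K0 : 0 <= K by apply: sumr_ge0 => x _; apply: sumr_ge0 => y _; exact: sqr_ge0.
exists (Num.sqrt K); apply: op_bound_sqr; first exact: sqrtr_ge0.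
move=> Phi; rewrite sqr_sqrtr // [leLHS]/tensor_norm2.
rewrite (sum_tuple2 (fun w => nc (t 0 Phi w) ^+ 2)) /K mulr_suml.
apply: ler_sum => x _; rewrite mulr_suml; apply: ler_sum => y _.
have := op_bound_norm2 (cap_op_bound (row x y) (leqnn 0)) Phi.
rewrite [X in X <= _]/tensor_norm2 (sum_tuple_nil (fun w => nc (cap_end (row x y) 0 Phi w) ^+ 2)).
by rewrite /= (@twist_atE _ _ T 0 _ [::]) // (@capE _ _ _ 0 _ [::] [::]).
Qed.

Lemma opnorm_unit_ball Psi : tensor_norm 2 Psi <= 1 -> tensor_norm 2 (t 0 Psi) <= opnorm T.
Proof.
have [k [k0 tk]] := twist_bounded => P1; apply: ub_le_sup.
  exists k => _ [u1 /= + <-]; have [Chi ->] := vec_of_tensor_surj u1.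
  rewrite mulmx_vec_of_tensor !norm2_vec_of_tensor => C1.
  by apply: le_trans (tk _) _; rewrite ler_piMr.
exists (vec_of_tensor Psi); first by rewrite /= norm2_vec_of_tensor.
by rewrite mulmx_vec_of_tensor norm2_vec_of_tensor.
Qed.

Lemma opnorm_ge0 : 0 <= opnorm T.
Proof.
have := @opnorm_unit_ball (fun=> 0); rewrite tensor_end_zero tensor_norm0.
by move=> /(_ ler01).
Qed.

Lemma opnorm_op_bound : op_bound 2 2 (t 0) (opnorm T).
Proof.
split => [|Phi]; first exact: opnorm_ge0.
have [k [k0 tk]] := twist_bounded.
have [P0|P0] := eqVneq (tensor_norm 2 Phi) 0.
  by rewrite P0 mulr0; apply: le_trans (tk _) _; rewrite P0 mulr0.
have Pp : 0 < tensor_norm 2 Phi by rewrite lt_def P0 tensor_norm_ge0.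
pose s := (((tensor_norm 2 Phi)^-1)%:C)%C : R[i].
have sE : nc s = (tensor_norm 2 Phi)^-1 by rewrite normc_real ger0_norm // invr_ge0 ltW.
have := @opnorm_unit_ball (fun w => s * Phi w).
rewrite tensor_end_scale !tensor_normZ sE mulVf // => /(_ (lexx _)).
by rewrite ler_pdivrMl // mulrC.
Qed.

Context (q : R) (q1 : q < 1) (tq : op_bound 2 2 (t 0) q).

Let q0 : 0 <= q. Proof. by case: tq. Qed.

Lemma twist_op_bound n k : (k.+1 < n)%N -> op_bound n n (t k) q.
Proof.
elim: k n => [|k IH] [//|n] kn; last first.
  by apply: (op_bound_cons (B := t k)) (IH n kn) => Phi x w /=; rewrite twist_at_cons.
case: n kn => // n _; apply: op_bound_sqr => // Phi.
rewrite !tensor_norm2_cons2 mulr_sumr; apply: ler_sum => w _.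
apply: le_trans (op_bound_norm2 tq (fun u => Phi (u ++ w))).
rewrite le_eqVlt; apply/orP; left; apply/eqP; apply: eq_bigr => u _.
by rewrite /= (@twist_at_catr _ _ T 0) // size_tuple.
Qed.

Local Notation TT := (braid_product t).

Lemma braid_op_bound n i j : (j < n)%N -> op_bound n n (TT i j) (q ^+ (j - i)).
Proof.
move=> jn; case: (leqP j i) => [ji|/ltnW ij].
  have -> : (j - i = 0)%N by lia.
  rewrite expr0 (_ : TT i j = 1) ?braid_product_nil //; exact: op_bound_id.
rewrite -{1}(subnK ij); have : (i + (j - i) < n)%N by lia.
elim: (j - i)%N => [|m IH] h.
  rewrite expr0 (_ : TT i _ = 1) ?braid_product_nil //; exact: op_bound_id.
rewrite addSn braid_productS; last by lia.
rewrite exprSr; apply: (op_bound_comp (A := t (m + i)) (B := TT i (m + i))).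
  by apply: twist_op_bound; lia.
by apply: IH; lia.
Qed.

Lemma creation_sum_op_bound n N : (n <= N)%N ->
  op_bound N N (creation_sum t n) (1 - q)^-1.
Proof.
move=> nN; apply: op_bound_le (geometric_sum_le n _ q1); last by have [] := tq.
apply: op_bound_sum => k; rewrite mem_index_iota => kn.
by have := @braid_op_bound N 0 k; rewrite subn0; apply; lia.
Qed.

(* A is bounded below by k on degree n *)
Definition op_lower n (A : tensor -> tensor) (k : R) : Prop :=
  forall Phi, k * tensor_norm n Phi <= tensor_norm n (A Phi).

Definition degree_local n (A : tensor -> tensor) : Prop :=
  forall Phi Psi, (forall w, size w = n -> Phi w = Psi w) ->
    forall w, size w = n -> A Phi w = A Psi w.

End TwistBound.

Section FiniteDegree.
Context (R : realType) (d n : nat).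
Local Notation tensor := (tensor R d).

Definition tensor_of_ffun (phi : {ffun n.-tuple 'I_d -> (R[i])^o}) : tensor :=
  fun w => if insub w is Some u then phi u else 0.

Lemma tensor_of_ffunE phi (u : n.-tuple 'I_d) : tensor_of_ffun phi u = phi u.
Proof. by rewrite /tensor_of_ffun valK. Qed.

Context (A : tensor_end R d).

Definition degree_map (phi : {ffun n.-tuple 'I_d -> (R[i])^o}) : {ffun n.-tuple 'I_d -> (R[i])^o} :=
  [ffun u : n.-tuple 'I_d => A (tensor_of_ffun phi) u].

Lemma degree_map_linear : linear degree_map.
Proof.
move=> a phi psi; apply/ffunP => u; rewrite !ffunE.
have -> : tensor_of_ffun (a *: phi + psi) =
    fun w => a * tensor_of_ffun phi w + tensor_of_ffun psi w.
  apply/funext => w; rewrite /tensor_of_ffun; case: insubP => [v _ _|_].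
    by rewrite !ffunE.
  by rewrite mulr0 addr0.
by rewrite tensor_end_linear.
Qed.

HB.instance Definition _ := GRing.isLinear.Build R[i] _ _ *:%R degree_map degree_map_linear.

Lemma injective_surjective : 
  (forall Phi Psi : tensor, (forall w, size w = n -> Phi w = Psi w) ->
    forall w, size w = n -> A Phi w = A Psi w) ->
  (forall Phi, (forall w, size w = n -> A Phi w = 0) -> forall w, size w = n -> Phi w = 0) ->
  forall Psi : tensor, exists Phi, homogeneous n Phi /\ forall w, size w = n -> A Phi w = Psi w.
Proof.
move=> Aloc Ainj Psi; pose g : 'End({ffun n.-tuple 'I_d -> (R[i])^o}) := linfun degree_map.
have g0 : lker g == 0%VS.
  apply/lker0P => phi psi e; apply/eqP; rewrite -subr_eq0.
  have : g (phi - psi) = 0 by rewrite linearB /= e subrr.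
  move: (phi - psi) => chi {phi psi e}; rewrite lfunE /= => e.
  apply/eqP/ffunP => u; rewrite -[LHS]tensor_of_ffunE ffunE.
  apply: Ainj (size_tuple u) => w wn.
  have /ffunP/(_ (tcast wn (in_tuple w))) := e.
  by rewrite !ffunE val_tcast.
have := memvf [ffun u : n.-tuple 'I_d => Psi u : (R[i])^o].
rewrite -(lker0_limgf g0) => /memv_imgP[phi _ e].
exists (tensor_of_ffun phi); split => [w wn|w wn].
  by rewrite /tensor_of_ffun insubN.
move/ffunP/(_ (tcast wn (in_tuple w))): e.
by rewrite lfunE !ffunE /= val_tcast => ->.
Qed.

End FiniteDegree.

Section SymmetrizerBounds.
Context (R : realType) (d : nat) (T : 'M[R[i]]_(d * d)).
Local Notation tensor := (tensor R d).
Local Notation nc := Normc.normc.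
Implicit Types (Phi Psi : tensor) (a : R[i]).
Local Notation t := (twist_end T).
Local Notation TT := (braid_product t).

Lemma op_bound_local n m (A : tensor_end R d) k : op_bound n m A k ->
  forall Phi Psi, (forall w, size w = n -> Phi w = Psi w) ->
    forall w, size w = m -> A Phi w = A Psi w.
Proof.
move=> Ak Phi Psi e w wm; apply/eqP; rewrite -subr_eq0; apply/eqP.
have := op_bound_norm2 Ak (fun w => -1 * Psi w + Phi w).
have -> : tensor_norm2 n (fun w => -1 * Psi w + Phi w) = 0.
  apply: big1 => u _; rewrite e ?size_tuple // mulN1r addNr.
  by rewrite Normc.normc0 expr0n.
rewrite mulr0 => h.
have /tensor_norm2_eq0/(_ w wm) : tensor_norm2 m (A (fun w => -1 * Psi w + Phi w)) = 0.
  by apply/eqP; rewrite eq_le h tensor_norm2_ge0.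
by rewrite tensor_end_linear mulN1r addrC.
Qed.

Lemma id_tensor_linear (A : tensor_end R d) : tensor_linear (id_tensor A).
Proof.
move=> a Phi Psi; apply/funext => -[|x w] /=; first by rewrite mulr0 addr0.
by rewrite tensor_end_linear.
Qed.

Definition id_end (A : tensor_end R d) := TensorEnd (id_tensor_linear A).

Fixpoint twist_P_end n : tensor_end R d :=
  if n is m.+1 then id_end (twist_P_end m) * creation_sum t m.+1 else 1.

Lemma twist_prodE i j Phi : (0 < i)%N ->
  twist_prod T i j Phi = TT i.-1 j.-1 Phi.
Proof.
case: i => // i _; rewrite /twist_prod /= /index_iota.
case: j => [|j] /=; first by rewrite braid_product_nil.
rewrite subSS; case: (leqP j i) => [ji|/ltnW ij].
  by rewrite (_ : (j - i = 0)%N) ?braid_product_nil //; lia.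
rewrite -{2}(subnK ij) addnC; move: (j - i)%N => m {ij}; elim: m i => [|m IH] i /=.
  by rewrite addn0 braid_product_nil.
by rewrite IH [in RHS]braid_product_recl ?addSnnS //; lia.
Qed.

Lemma twist_RE n Phi : twist_R T n Phi = creation_sum t n Phi.
Proof.
apply/funext => w; rewrite /twist_R /creation_sum big_add1 /= tensor_end_sumE.
by apply: eq_bigr => k _; rewrite twist_prodE.
Qed.

Lemma twist_PE n : twist_P T n = twist_P_end n.
Proof.
apply/funext; elim: n => [//|n IH] Phi; rewrite [twist_P _ _ _]/=.
by rewrite twist_RE (_ : twist_P T n = twist_P_end n) //; apply/funext.
Qed.

Context (q : R) (q1 : q < 1) (tq : op_bound 2 2 (t 0) q) (br : braided T).
Let q0 : 0 <= q. Proof. by case: tq. Qed.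

Lemma id_end_op_bound n (A : tensor_end R d) k : op_bound n n A k -> op_bound n.+1 n.+1 (id_end A) k.
Proof. by move=> Ak; apply: op_bound_cons Ak. Qed.

Lemma id_end_op_lower n (A : tensor_end R d) k : 0 <= k -> op_lower n A k ->
  op_lower n.+1 (id_end A) k.
Proof.
move=> k0 Ak Phi; rewrite -(@ler_pXn2r _ 2) ?nnegrE ?mulr_ge0 ?tensor_norm_ge0 //.
rewrite exprMn !tensor_norm2E !tensor_norm2_cons mulr_sumr; apply: ler_sum => x _.
rewrite -!tensor_norm2E -exprMn ler_pXn2r ?nnegrE ?mulr_ge0 ?tensor_norm_ge0 //.
Qed.

Lemma twist_P_op_bound n : op_bound n n (twist_P_end n) ((1 - q)^-1 ^+ n).
Proof.
elim: n => [|n IH]; first by rewrite expr0; exact: op_bound_id.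
rewrite exprSr; apply: (op_bound_comp (A := creation_sum t n.+1)).
  exact: creation_sum_op_bound.
exact: id_end_op_bound.
Qed.

(* For u of norm at most r < 1, 1 - u is invertible on the degree and has norm at most 1 + r *)
Lemma one_minus_surjective N (u : tensor_end R d) r : r < 1 -> op_bound N N u r ->
  forall Psi, exists2 Phi, (forall w, size w = N -> (1 - u) Phi w = Psi w) &
    (1 - r) * tensor_norm N Phi <= tensor_norm N Psi <= (1 + r) * tensor_norm N Phi.
Proof.
move=> r1 ur; have [r0 uP] := ur.
have ub : op_bound N N (1 - u : tensor_end R d) (1 + r).
  split => [|Phi]; first by rewrite addr_ge0.
  rewrite mulrDl mul1r; apply: le_trans (tensor_norm_triangle _ _ _) _.
  by rewrite lerD2l tensor_normN.
have ul Phi : (1 - r) * tensor_norm N Phi <= tensor_norm N ((1 - u : tensor_end R d) Phi).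
  have := tensor_norm_triangle N ((1 - u : tensor_end R d) Phi) (u Phi).
  have -> : (fun w => (1 - u : tensor_end R d) Phi w + u Phi w) = Phi.
    by apply/funext => w; rewrite tensor_end_addE tensor_end_oppE subrK.
  by have := uP Phi; lra.
move=> Psi; have [|Phi [_ PhiP]] := injective_surjective (op_bound_local ub) _ Psi.
  move=> Phi h; apply: tensor_norm2_eq0; apply/eqP.
  rewrite -tensor_norm2E sqrf_eq0 eq_le tensor_norm_ge0 andbT.
  have := ul Phi; rewrite (_ : tensor_norm N ((1 - u : tensor_end R d) Phi) = 0).
    by rewrite pmulr_rle0 // subr_gt0.
  by rewrite (@tensor_norm_local _ _ _ _ (fun=> 0)) ?tensor_norm0.
exists Phi => //.
rewrite -(tensor_norm_local PhiP); apply/andP; split; first exact: ul.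
by case: ub.
Qed.

Definition creation_lower : R := expR (- (2 / (1 - q) ^+ 2)).

Lemma creation_lower_gt0 : 0 < creation_lower.
Proof. exact: expR_gt0. Qed.

Lemma one_minus_lower (x : R) : 0 <= x <= q -> expR (- (x / (1 - q))) <= 1 - x.
Proof.
move=> /andP[x0 xq].
have p' : 0 < 1 - q by rewrite subr_gt0.
have p : 0 < 1 - x by lra.
rewrite expRN -[leRHS]invrK lef_pV2 ?posrE ?invr_gt0 ?expR_gt0 //.
apply: le_trans (_ : 1 + x / (1 - q) <= _); last exact: expR_ge1Dx.
have -> : (1 - x)^-1 = 1 + x / (1 - x) by field; rewrite gt_eqF.
by rewrite lerD2l ler_wpM2l // lef_pV2 ?posrE //; lra.
Qed.

Lemma creation_sum_op_lower n N : (n < N)%N ->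
  op_lower N (creation_sum t n.+1) creation_lower.
Proof.
move=> nN.
suff h : op_lower N (creation_sum t n.+1)
    (expR (- (2 / (1 - q) * \sum_(1 <= k < n.+1) q ^+ k))).
  move=> Phi; apply: le_trans (h Phi); apply: ler_wpM2r; first exact: tensor_norm_ge0.
  have p : 0 < 1 - q by rewrite subr_gt0.
  rewrite ler_expR lerN2 expr2 invfM mulrA; apply: ler_wpM2l.
    by rewrite divr_ge0 // ltW.
  apply: le_trans (geometric_sum_le n.+1 (proj1 tq) q1).
  by rewrite [leRHS]big_ltn // lerDr expr0.
elim: n nN => [|n IH] nN.
  rewrite big_geq // mulr0 oppr0 expR0 => Phi; rewrite mul1r.
  by rewrite /creation_sum big_nat1 braid_product_nil.
set u := TT 0 n.+1.
have qn : 0 <= q ^+ n.+1 <= q.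
  by rewrite exprn_ge0 //= exprS ler_piMr // exprn_ile1 // ltW.
have uq : op_bound N N u (q ^+ n.+1).
  by have := @braid_op_bound _ _ _ _ q1 tq N 0 n.+1 nN; rewrite subn0.
have tuq : op_bound N N (t 0 * u : tensor_end R d) (q * q ^+ n.+1).
  by apply: (op_bound_comp uq (B := t 0)); apply: (twist_op_bound tq); lia.
move=> Psi; have [|Phi PhiP /andP[_ PhiB]] := one_minus_surjective _ uq Psi; first by case/andP: qn => _ /le_lt_trans; apply.
have tel := creation_sum_telescope (@twist_end_far _ _ T) (twist_end_braid br) n.+1.
rewrite -/u in tel.
have cl := op_bound_local (creation_sum_op_bound q1 tq nN).
have -> : tensor_norm N (creation_sum t n.+2 Psi) =
    tensor_norm N ((1 - t 0 * u : tensor_end R d) (creation_sum t n.+1 Phi)).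
  have e := congr1 (fun A : tensor_end R d => A Phi) tel; move: e; rewrite !tensor_end_mulE => <-.
  by apply: tensor_norm_local; apply: cl => w wN; rewrite PhiP.
set c := expR (- (2 / (1 - q) * _)).
set c' := expR (- (2 / (1 - q) * \sum_(1 <= k < n.+1) q ^+ k)) in IH.
have cE : c = c' * expR (- (q ^+ n.+1 / (1 - q))) ^+ 2.
  rewrite /c /c' big_nat_recr //= -expRM_natl -expRD; congr expR.
  by rewrite mulrDr opprD; congr (_ + _); ring.
have IHn := IH (ltnW nN) Phi.
have low := one_minus_lower qn.
set x := q ^+ n.+1 in low qn PhiB uq tuq cE *.
have lowt : (1 - x) * tensor_norm N (creation_sum t n.+1 Phi) <=
    tensor_norm N ((1 - t 0 * u : tensor_end R d) (creation_sum t n.+1 Phi)).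
  have := tensor_norm_triangle N ((1 - t 0 * u : tensor_end R d) (creation_sum t n.+1 Phi))
    ((t 0 * u : tensor_end R d) (creation_sum t n.+1 Phi)).
  have -> : (fun w => (1 - t 0 * u : tensor_end R d) (creation_sum t n.+1 Phi) w +
      (t 0 * u : tensor_end R d) (creation_sum t n.+1 Phi) w) = creation_sum t n.+1 Phi.
    by apply/funext => w; rewrite tensor_end_addE tensor_end_oppE subrK.
  have := proj2 tuq (creation_sum t n.+1 Phi).
  have n0 := tensor_norm_ge0 N (creation_sum t n.+1 Phi).
  have : q * x * tensor_norm N (creation_sum t n.+1 Phi) <= x * tensor_norm N (creation_sum t n.+1 Phi).
    by rewrite ler_wpM2r // ler_piMl //; [lra|exact: ltW].
  lra.
apply: le_trans lowt.
have n0 := tensor_norm_ge0 N Phi.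
have E0 := expR_ge0 (- (x / (1 - q))).
have c0 : 0 <= c' := expR_ge0 _.
apply: le_trans (_ : c * ((1 + x) * tensor_norm N Phi) <= _).
  by rewrite ler_wpM2l // expR_ge0.
apply: le_trans (_ : (1 - x) * (c' * tensor_norm N Phi) <= _); last first.
  by rewrite ler_wpM2l //; lra.
rewrite cE; set E := expR _ in low E0 *.
have h : E ^+ 2 * (1 + x) <= 1 - x.
  apply: le_trans (_ : (1 - x) ^+ 2 * (1 + x) <= _).
    by rewrite ler_wpM2r ?ler_pXn2r ?nnegrE //; lra.
  have -> : (1 - x) ^+ 2 * (1 + x) = (1 - x) * (1 - x ^+ 2) by ring.
  by rewrite ler_piMr ?gerDl ?oppr_le0 ?sqr_ge0 //; lra.
have -> : c' * E ^+ 2 * ((1 + x) * tensor_norm N Phi) = E ^+ 2 * (1 + x) * (c' * tensor_norm N Phi).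
  by ring.
by rewrite ler_wpM2r // mulr_ge0.
Qed.

Lemma twist_P_op_lower n : op_lower n (twist_P_end n) (creation_lower ^+ n).
Proof.
have c0 := ltW creation_lower_gt0.
elim: n => [|n IH] Phi; first by rewrite expr0 mul1r.
rewrite exprSr /= -mulrA.
have := id_end_op_lower _ IH (creation_sum t n.+1 Phi); rewrite exprn_ge0 // => /(_ isT).
apply: le_trans; rewrite ler_wpM2l ?exprn_ge0 //.
exact: (creation_sum_op_lower (ltnSn n)).
Qed.

End SymmetrizerBounds.

Lemma power_growth_le (R : realType) (x y A B : R) : 0 < y -> 0 < A ->
  (forall j, x ^+ (2 ^ j) * A <= B * y ^+ (2 ^ j)) -> x <= y.
Proof.
move=> y0 A0 h; rewrite leNgt; apply/negP => xy.
have r1 : 0 < x / y - 1 by rewrite subr_gt0 ltr_pdivlMr // mul1r.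
have grow j : j%:R * (x / y - 1) <= (x / y) ^+ (2 ^ j).
  apply: le_trans (_ : (x / y) ^+ j <= _).
    elim: j => [|j IH]; first by rewrite mul0r expr0.
    rewrite exprS; have : 1 <= (x / y) ^+ j by rewrite exprn_ege1 //; lra.
    rewrite -natr1 mulrDl mul1r => h1.
    have : (x / y) ^+ j + (x / y - 1) <= x / y * (x / y) ^+ j by nra.
    lra.
  by apply: ler_weXn2l; [lra|exact/ltnW/ltn_expl].
have bnd j : j%:R * (x / y - 1) <= B / A.
  apply: le_trans (grow j) _; rewrite expr_div_n ler_pdivrMr ?exprn_gt0 //.
  by rewrite mulrAC ler_pdivlMr.
have B0 : 0 <= B / A by have := bnd 0%N; rewrite mul0r.
have := bnd (Num.bound (B / A / (x / y - 1))).
rewrite -ler_pdivlMr // leNgt => /negP; apply.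
by apply: archi_boundP; rewrite divr_ge0 // ltW.
Qed.

Section TwistedInner.
Context (R : realType) (d : nat) (T : 'M[R[i]]_(d * d)).
Local Notation tensor := (tensor R d).
Local Notation nc := Normc.normc.
Implicit Types (Phi Psi : tensor) (a : R[i]).
Local Notation t := (twist_end T).
Context (q : R) (q1 : q < 1) (tq : op_bound 2 2 (t 0) q) (br : braided T).
Hypothesis Tpos : forall (n : nat) (Phi : tensor), homogeneous n Phi ->
        Phi <> (fun _ => 0) -> 0 < tensor_ip n Phi (twist_P T n Phi).
Let q0 : 0 <= q. Proof. by case: tq. Qed.
Local Notation P := (twist_P_end T).

Lemma twisted_ipE n Phi Psi : twisted_ip T n Phi Psi = tensor_ip n Phi (P n Psi).
Proof. by rewrite /twisted_ip twist_PE. Qed.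

Lemma twist_P_local n Phi Psi : (forall w, size w = n -> Phi w = Psi w) ->
  forall w, size w = n -> P n Phi w = P n Psi w.
Proof. exact: (op_bound_local (twist_P_op_bound q1 tq n)). Qed.

Lemma twisted_ip_local n Phi Phi' Psi Psi' :
  (forall w, size w = n -> Phi w = Phi' w) -> (forall w, size w = n -> Psi w = Psi' w) ->
  twisted_ip T n Phi Psi = twisted_ip T n Phi' Psi'.
Proof.
move=> e e'; rewrite !twisted_ipE; apply: tensor_ip_local => // w wn.
exact: twist_P_local.
Qed.

Definition degree_part n Phi : tensor := fun w => if size w == n then Phi w else 0.

Lemma degree_part_homogeneous n Phi : homogeneous n (degree_part n Phi).
Proof. by move=> w wn; rewrite /degree_part (negbTE wn). Qed.

Lemma degree_partE n Phi w : size w = n -> degree_part n Phi w = Phi w.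
Proof. by move=> wn; rewrite /degree_part wn eqxx. Qed.

Lemma twisted_ip_linear n a Chi Phi Psi :
  twisted_ip T n Chi (fun w => a * Phi w + Psi w) =
  a * twisted_ip T n Chi Phi + twisted_ip T n Chi Psi.
Proof.
by rewrite !twisted_ipE tensor_end_linear (semi_inner_linear (semi_inner_tensor R d n)).
Qed.

Lemma twisted_ip_antilinear n a Chi Phi Psi :
  twisted_ip T n (fun w => a * Phi w + Psi w) Chi =
  (a^*)%C * twisted_ip T n Phi Chi + twisted_ip T n Psi Chi.
Proof.
rewrite !twisted_ipE /tensor_ip mulr_sumr -big_split; apply: eq_bigr => w _ /=.
by rewrite rmorphD rmorphM mulrDl mulrA.
Qed.

Lemma twisted_ip_ge0 n Phi : 0 <= twisted_ip T n Phi Phi.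
Proof.
rewrite (@twisted_ip_local n _ (degree_part n Phi) _ (degree_part n Phi)); try by
  move=> w wn; rewrite degree_partE.
have [->|/eqP P0] := eqVneq (degree_part n Phi) (fun=> 0).
  by rewrite /twisted_ip /tensor_ip big1 // => w _; rewrite conjc0 mul0r.
exact/ltW/Tpos/P0/degree_part_homogeneous.
Qed.

Lemma twisted_ip_eq0 n Phi : twisted_ip T n Phi Phi = 0 ->
  forall w, size w = n -> Phi w = 0.
Proof.
rewrite (@twisted_ip_local n _ (degree_part n Phi) _ (degree_part n Phi)); try by
  move=> w wn; rewrite degree_partE.
have [e _ w wn|/eqP P0 e] := eqVneq (degree_part n Phi) (fun=> 0).
  by rewrite -(@degree_partE n) // e.
by have := Tpos (@degree_part_homogeneous n Phi) P0; rewrite -[X in 0 < X]/(twisted_ip _ _ _ _) e ltxx.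
Qed.

Lemma twisted_ip_herm n Phi Psi : twisted_ip T n Psi Phi = (twisted_ip T n Phi Psi)^*%C.
Proof.
have imz a : complex.Im (twisted_ip T n (fun w => a * Phi w + Psi w)
    (fun w => a * Phi w + Psi w)) = 0 by apply: ger0_Im; exact: twisted_ip_ge0.
have := imz 1; have := imz 'i%C.
rewrite !twisted_ip_linear !twisted_ip_antilinear.
have := ger0_Im (twisted_ip_ge0 n Phi); have := ger0_Im (twisted_ip_ge0 n Psi).
move: (twisted_ip T n Phi Phi) (twisted_ip T n Psi Psi) => [x x'] [y y'] /= -> ->.
move: (twisted_ip T n Phi Psi) (twisted_ip T n Psi Phi) => [z z'] [u u'] /=.
by move=> h1 h2; apply/eqP; rewrite eq_complex /=; apply/andP; split; apply/eqP; lra.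
Qed.

Lemma semi_inner_twisted n : semi_inner setT (twisted_ip T n).
Proof.
split => //.
- by move=> a Chi Phi Psi _ _ _; exact: twisted_ip_linear.
- by move=> Phi Psi _ _; exact: twisted_ip_herm.
- by move=> Phi _; exact: twisted_ip_ge0.
Qed.

(* The form of 1 (x) P_n on degree n + 1 *)
Definition slice_ip n Phi Psi : R[i] :=
  \sum_(x < d) twisted_ip T n (fun w => Phi (x :: w)) (fun w => Psi (x :: w)).

Lemma slice_ipE n Phi Psi : slice_ip n Phi Psi = tensor_ip n.+1 Phi (id_end (P n) Psi).
Proof. by rewrite tensor_ip_cons; apply: eq_bigr => x _; rewrite twisted_ipE. Qed.

Lemma semi_inner_slice n : semi_inner setT (slice_ip n).
Proof.
split => //.
- move=> a Chi Phi Psi _ _ _; rewrite /slice_ip mulr_sumr -big_split.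
  by apply: eq_bigr => x _; rewrite twisted_ip_linear.
- move=> Phi Psi _ _; rewrite /slice_ip rmorph_sum; apply: eq_bigr => x _.
  exact: twisted_ip_herm.
- by move=> Phi _; apply: sumr_ge0 => x _; exact: twisted_ip_ge0.
Qed.

Lemma twisted_slice n Phi Psi : twisted_ip T n.+1 Phi Psi = slice_ip n Phi (creation_sum t n.+1 Psi).
Proof. by rewrite twisted_ipE slice_ipE. Qed.

Lemma slice_symmetric n Phi Psi :
  slice_ip n Phi (creation_sum t n.+1 Psi) = slice_ip n (creation_sum t n.+1 Phi) Psi.
Proof.
rewrite -twisted_slice twisted_ip_herm twisted_slice.
by rewrite -(semi_inner_herm (semi_inner_slice n)).
Qed.

(* The operator R is symmetric for the slice form, so its numerical range is controlled
   by the growth of its powers, that is by its operator norm. *)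
Lemma twisted_le_slice n Phi :
  complex.Re (twisted_ip T n.+1 Phi Phi) <= (1 - q)^-1 * complex.Re (slice_ip n Phi Phi).
Proof.
have hs := semi_inner_slice n.
set Rn := creation_sum t n.+1.
pose a j := complex.Re (slice_ip n Phi ((Rn ^+ j) Phi)).
have aR j k : slice_ip n ((Rn ^+ j) Phi) ((Rn ^+ k) Phi) = slice_ip n Phi ((Rn ^+ (j + k)) Phi).
  elim: j k => [//|j IH] k; rewrite addSnnS -IH [in LHS]exprS [in RHS]exprS.
  by rewrite !tensor_end_mulE slice_symmetric.
have a0 : 0 <= a 0%N by have := semi_inner_ge0 hs (I : setT Phi); rewrite lecE => /andP[].
have cs j : a j ^+ 2 <= a 0%N * a (j + j)%N.
  have := cauchy_schwarz hs (I : setT Phi) (I : setT ((Rn ^+ j) Phi)).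
  move=> /(le_trans (normc_ler _)); rewrite -(@ler_pXn2r _ 2) ?nnegrE ?mulr_ge0 ?semi_norm_ge0 //.
  rewrite real_normK ?num_real // => /le_trans; apply.
  rewrite exprMn !sqr_sqrtr; first by rewrite aR.
    by have := semi_inner_ge0 hs (I : setT ((Rn ^+ j) Phi)); rewrite lecE => /andP[].
  exact: a0.
have -> : complex.Re (twisted_ip T n.+1 Phi Phi) = a 1%N by rewrite twisted_slice.
have -> : complex.Re (slice_ip n Phi Phi) = a 0%N by [].
have p : 0 < (1 - q)^-1 by rewrite invr_gt0 subr_gt0.
have [a00|a00] := eqVneq (a 0%N) 0.
  have := cs 1%N; rewrite a00 mul0r mulr0 => h.
  by rewrite real_leNgt ?num_real //; apply/negP => h1; have := exprn_gt0 2 h1; lra.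
have a0p : 0 < a 0%N by rewrite lt_def a00.
rewrite -ler_pdivrMr //.
pose B := tensor_norm n.+1 Phi * ((1 - q)^-1 ^+ n * tensor_norm n.+1 Phi).
apply: (@power_growth_le _ _ _ (a 0%N) B) => // j.
apply: le_trans (_ : a (2 ^ j)%N <= _).
  have [a1|a1] := leP 0 (a 1%N).
    elim: j => [|j IH]; first by rewrite !expr1 divfK.
    have := cs (2 ^ j)%N; rewrite addnn -mul2n -expnS => h.
    have -> : (a 1%N / a 0%N) ^+ (2 ^ j.+1) = ((a 1%N / a 0%N) ^+ (2 ^ j)) ^+ 2.
      by rewrite -exprM mulnC -expnS.
    set z := (a 1%N / a 0%N) ^+ (2 ^ j) in IH *.
    have z0 : 0 <= z by rewrite exprn_ge0 // divr_ge0.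
    have : (z * a 0%N) ^+ 2 <= a 0%N * a (2 ^ j.+1)%N.
      by apply: le_trans h; rewrite ler_pXn2r ?nnegrE ?mulr_ge0 //; apply: le_trans IH; rewrite mulr_ge0.
    by rewrite exprMn [a 0%N ^+ 2]expr2 mulrCA ler_pM2l.
  case: j => [|j]; first by rewrite !expr1 divfK.
  elim: j => [|j IH].
    have := cs 1%N; rewrite expn1 expr_div_n => h.
    by rewrite [a 0%N ^+ 2]expr2 invfM mulrA divfK // ler_pdivrMr // mulrC.
  have := cs (2 ^ j.+1)%N; rewrite addnn -mul2n -expnS => h.
  have -> : (a 1%N / a 0%N) ^+ (2 ^ j.+2) = ((a 1%N / a 0%N) ^+ (2 ^ j.+1)) ^+ 2.
    by rewrite -exprM mulnC -expnS.
  set z := (a 1%N / a 0%N) ^+ (2 ^ j.+1) in IH *.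
  have z0 : 0 <= z by rewrite /z expnS exprM exprn_ge0 // sqr_ge0.
  have : (z * a 0%N) ^+ 2 <= a 0%N * a (2 ^ j.+2)%N.
    by apply: le_trans h; rewrite ler_pXn2r ?nnegrE ?mulr_ge0 //; apply: le_trans IH; rewrite mulr_ge0.
  by rewrite exprMn [a 0%N ^+ 2]expr2 mulrCA ler_pM2l.
have Rb k : op_bound n.+1 n.+1 (Rn ^+ k : tensor_end R d) ((1 - q)^-1 ^+ k).
  elim: k => [|k IH]; first by rewrite expr0; exact: op_bound_id.
  rewrite !exprSr; apply: (op_bound_comp (A := Rn) _ IH).
  exact: creation_sum_op_bound.
rewrite /a slice_ipE; apply: le_trans (ler_norm _) _; apply: le_trans (normc_ler _) _.
apply: le_trans (cauchy_schwarz (semi_inner_tensor R d n.+1) (I : setT Phi) (I : setT _)) _.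
rewrite /B -mulrA; apply: ler_wpM2l; first exact: semi_norm_ge0.
have [_ idP] := id_end_op_bound (twist_P_op_bound q1 tq n).
apply: le_trans (idP _) _; rewrite -mulrA; apply: ler_wpM2l; first by rewrite exprn_ge0 // ltW.
have [_ RP] := Rb (2 ^ j)%N.
by apply: le_trans (RP _) _; rewrite mulrC.
Qed.

End TwistedInner.

Section ComplexLimits.
Context (R : realType).
Local Notation nc := Normc.normc.

Lemma cvg_complexP (u : nat -> (R[i])^o) (l : (R[i])^o) :
  (forall e : R, 0 < e -> \forall n \near \oo, nc (u n - l) < e) -> u @ \oo --> l.
Proof.
move=> h; apply/cvgrPdist_lt => e e0.
have eE : e = ((complex.Re e)%:C)%C by rewrite RRe_real // gtr0_real.
have e0' : 0 < complex.Re e by rewrite -ltcR -eE.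
apply: filterS (h _ e0') => n; rewrite normcB => hn.
by rewrite norm_normc eE ltcR.
Qed.

Lemma cvg_complex_dist (u : nat -> (R[i])^o) (l : (R[i])^o) : u @ \oo --> l ->
  forall e : R, 0 < e -> \forall n \near \oo, nc (u n - l) < e.
Proof.
move=> /cvgrPdist_lt h e e0.
have e0' : 0 < (e%:C)%C :> R[i] by rewrite ltcR.
by apply: filterS (h _ e0') => n; rewrite norm_normc ltcR normcB.
Qed.

Lemma cvg_complex (u : nat -> R[i]) (x y : R) :
  (fun n => complex.Re (u n)) @ \oo --> x -> (fun n => complex.Im (u n)) @ \oo --> y ->
  (u : nat -> (R[i])^o) @ \oo --> ((x +i* y)%C : (R[i])^o).
Proof.
move=> /cvgrPdist_lt hx /cvgrPdist_lt hy; apply: cvg_complexP => e e0.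
have e20 : 0 < e / 2 by lra.
near=> n.
apply: le_lt_trans (normc_le _) _; rewrite !raddfB /=.
have -> : e = e / 2 + e / 2 by field.
by rewrite !(distrC _ x) !(distrC _ y); apply: ltrD; near: n; [exact: hx|exact: hy].
Unshelve. all: end_near. Qed.

Lemma cvg_Re (u : nat -> (R[i])^o) (l : (R[i])^o) : u @ \oo --> l ->
  (fun n => complex.Re (u n)) @ \oo --> complex.Re l.
Proof.
move=> /cvg_complex_dist h; apply/cvgrPdist_lt => e /h; apply: filterS => n.
apply: le_lt_trans; rewrite distrC -raddfB; exact: normc_ler.
Qed.

Lemma cvg_conj (u : nat -> (R[i])^o) (l : (R[i])^o) : u @ \oo --> l ->
  (fun n => (u n)^*%C : (R[i])^o) @ \oo --> ((l^*)%C : (R[i])^o).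
Proof.
move=> /cvg_complex_dist h; apply: cvg_complexP => e /h; apply: filterS => n.
by rewrite -rmorphB modulus_conj.
Qed.

Lemma complex_cvg_unique (u : nat -> (R[i])^o) (l l' : R[i]) :
  u @ \oo --> (l : (R[i])^o) -> u @ \oo --> (l' : (R[i])^o) -> l = l'.
Proof. by move=> h h'; exact: (cvg_unique _ h h'). Qed.

End ComplexLimits.

Section Fock.
Context (R : realType) (d : nat) (T : 'M[R[i]]_(d * d)).
Local Notation tensor := (tensor R d).
Local Notation nc := Normc.normc.
Implicit Types (Phi Psi : tensor) (a : R[i]).
Local Notation t := (twist_end T).
Context (q : R) (q1 : q < 1) (tq : op_bound 2 2 (t 0) q) (br : braided T).
Hypothesis Tpos : forall (n : nat) (Phi : tensor), homogeneous n Phi ->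
        Phi <> (fun _ => 0) -> 0 < tensor_ip n Phi (twist_P T n Phi).

Definition twisted_sqr n Phi : R := complex.Re (twisted_ip T n Phi Phi).

Let hs n := semi_inner_twisted q1 tq Tpos n.

Lemma twisted_sqr_ge0 n Phi : 0 <= twisted_sqr n Phi.
Proof. by have := twisted_ip_ge0 q1 tq Tpos n Phi; rewrite lecE => /andP[]. Qed.

Lemma twisted_sqrE n Phi : twisted_sqr n Phi = semi_norm (twisted_ip T n) Phi ^+ 2.
Proof. by rewrite /semi_norm sqr_sqrtr // twisted_sqr_ge0. Qed.

Lemma twisted_sqr_ip n Phi : twisted_ip T n Phi Phi = ((twisted_sqr n Phi)%:C)%C.
Proof. by rewrite twisted_sqrE -(semi_norm_sqr (hs n)). Qed.

Lemma twisted_ip_bound n Phi Psi :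
  nc (twisted_ip T n Phi Psi) <= (twisted_sqr n Phi + twisted_sqr n Psi) / 2.
Proof.
apply: le_trans (cauchy_schwarz (hs n) (I : setT Phi) (I : setT Psi)) _.
rewrite !twisted_sqrE.
move: (semi_norm _ Phi) (semi_norm _ Psi) => x y.
have := sqr_ge0 (x - y); rewrite sqrrB; lra.
Qed.

Lemma twisted_sqr_add n a Phi Psi :
  twisted_sqr n (fun w => a * Phi w + Psi w) <=
  2 * nc a ^+ 2 * twisted_sqr n Phi + 2 * twisted_sqr n Psi.
Proof.
rewrite !twisted_sqrE.
have := semi_norm_triangle (hs n) a (I : setT Phi) (I : setT Psi).
have := semi_norm_ge0 (twisted_ip T n) (fun w => a * Phi w + Psi w).
have := semi_norm_ge0 (twisted_ip T n) Phi; have := semi_norm_ge0 (twisted_ip T n) Psi.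
have := normc_ge0 a.
set z := semi_norm (twisted_ip T n) (fun w => a * Phi w + Psi w).
set y := semi_norm (twisted_ip T n) Phi; set x := semi_norm (twisted_ip T n) Psi.
set k := nc a => k0 x0 y0 z0 zk.
have := sqr_ge0 (k * y - x); rewrite sqrrB exprMn => h.
apply: le_trans (_ : (k * y + x) ^+ 2 <= _).
  by rewrite ler_pXn2r ?nnegrE // addr_ge0 ?mulr_ge0.
by rewrite sqrrD exprMn; lra.
Qed.

Lemma series_ge0_cvg (u : nat -> R) M : (forall n, 0 <= u n) ->
  (forall N, \sum_(0 <= n < N) u n <= M) -> cvgn (series u) /\ limn (series u) <= M.
Proof.
move=> u0 uM.
have c : cvgn (series u).
  apply: nondecreasing_is_cvgn.
    by apply/nondecreasing_seqP => n; rewrite /series /= big_nat_recr //= lerDl.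
  by exists M => _ [n _ <-]; exact: uM.
by split => //; apply: limr_le => //; apply: nearW => n; exact: uM.
Qed.

Lemma fock_bounded Phi M : (forall N, \sum_(0 <= n < N) twisted_sqr n Phi <= M) -> fock T Phi.
Proof. by move=> h; have [] := series_ge0_cvg (fun n => twisted_sqr_ge0 n Phi) h. Qed.

Lemma fock_lin a Phi Psi : fock T Phi -> fock T Psi -> fock T (fun w => a * Phi w + Psi w).
Proof.
move=> h1 h2.
pose M Phi := limn (series (fun n => twisted_sqr n Phi)).
have le Chi (h : fock T Chi) N : \sum_(0 <= n < N) twisted_sqr n Chi <= M Chi.
  apply: (@nondecreasing_cvgn_le _ (series (fun n => twisted_sqr n Chi))) => //.
  by apply/nondecreasing_seqP => n; rewrite /series /= big_nat_recr //= lerDl twisted_sqr_ge0.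
apply: (@fock_bounded _ (2 * nc a ^+ 2 * M Phi + 2 * M Psi)) => N.
apply: le_trans (_ : \sum_(0 <= n < N) (2 * nc a ^+ 2 * twisted_sqr n Phi + 2 * twisted_sqr n Psi) <= _).
  by apply: ler_sum => n _; exact: twisted_sqr_add.
rewrite big_split -!mulr_sumr /=; apply: lerD; apply: ler_wpM2l => //; try exact: le.
by rewrite mulr_ge0 // sqr_ge0.
Qed.

Lemma fock_ip_cvg Phi Psi : fock T Phi -> fock T Psi ->
  (series (fun n => twisted_ip T n Phi Psi : (R[i])^o)) @ \oo --> (fock_ip T Phi Psi : (R[i])^o).
Proof.
move=> h1 h2.
have dom (v : nat -> R) : (forall n, `|v n| <= nc (twisted_ip T n Phi Psi)) -> cvgn (series v).
  move=> vb; apply: normed_cvg.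
  apply: (@series_le_cvg _ _ (fun n => 2^-1 * twisted_sqr n Phi + 2^-1 * twisted_sqr n Psi)).
  - by move=> n; exact: normr_ge0.
  - by move=> n; rewrite addr_ge0 // mulr_ge0 ?invr_ge0 ?twisted_sqr_ge0.
  - move=> n; apply: le_trans (vb n) _; apply: le_trans (twisted_ip_bound n Phi Psi) _.
    by rewrite mulrDl mulrC [X in _ + X]mulrC.
  - apply: is_cvg_seriesD; apply: is_cvg_seriesZ => //.
have cRe := dom (fun n => complex.Re (twisted_ip T n Phi Psi)) (fun n => normc_ler _).
have cIm := dom (fun n => complex.Im (twisted_ip T n Phi Psi)) (fun n => normc_lei _).
suff h : cvgn (series (fun n => twisted_ip T n Phi Psi : (R[i])^o)) by exact: h.
apply/cvg_ex; eexists; apply: cvg_complex.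
- have -> : (fun n => complex.Re (series (fun n => twisted_ip T n Phi Psi : (R[i])^o) n)) =
      series (fun n => complex.Re (twisted_ip T n Phi Psi)).
    by apply/funext => n; rewrite /series /= raddf_sum.
  exact: cRe.
- have -> : (fun n => complex.Im (series (fun n => twisted_ip T n Phi Psi : (R[i])^o) n)) =
      series (fun n => complex.Im (twisted_ip T n Phi Psi)).
    by apply/funext => n; rewrite /series /= raddf_sum.
  exact: cIm.
Qed.

Lemma fock_ip_diag Phi : fock T Phi ->
  fock_ip T Phi Phi = ((limn (series (fun n => twisted_sqr n Phi)))%:C)%C.
Proof.
move=> h; apply: (complex_cvg_unique (fock_ip_cvg h h)).
apply: cvg_complex.
  have -> : (fun n => complex.Re (series (fun n => twisted_ip T n Phi Phi : (R[i])^o) n)) =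
      series (fun n => twisted_sqr n Phi).
    by apply/funext => n; rewrite /series /= raddf_sum.
  exact: h.
have -> : (fun n => complex.Im (series (fun n => twisted_ip T n Phi Phi : (R[i])^o) n)) =
    fun=> 0.
  apply/funext => n; rewrite /series /= raddf_sum big1 // => m _.
  exact: ger0_Im (twisted_ip_ge0 q1 tq Tpos m Phi).
exact: cvg_cst.
Qed.

Lemma series_twisted_sqr_nondecreasing Phi :
  nondecreasing_seq (series (fun n => twisted_sqr n Phi)).
Proof.
by apply/nondecreasing_seqP => n; rewrite /series /= big_nat_recr //= lerDl twisted_sqr_ge0.
Qed.

Lemma semi_inner_fock : semi_inner (fock T) (fock_ip T).
Proof.
split.
- by move=> a Phi Psi; exact: fock_lin.
- move=> a Chi Phi Psi h0 h1 h2.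
  apply: (complex_cvg_unique (fock_ip_cvg h0 (@fock_lin a _ _ h1 h2))).
  have -> : series (fun n => twisted_ip T n Chi (fun w => a * Phi w + Psi w) : (R[i])^o) =
     (fun N => a *: series (fun n => twisted_ip T n Chi Phi : (R[i])^o) N
          + series (fun n => twisted_ip T n Chi Psi : (R[i])^o) N).
    apply/funext => N; rewrite /series /= scaler_sumr -big_split; apply: eq_bigr => n _ /=.
    exact: twisted_ip_linear.
  have e1 := fock_ip_cvg h0 h1; have e2 := fock_ip_cvg h0 h2.
  have e3 := cvgD (cvgZl_tmp (k := a) e1) e2.
  exact: (e3 _ _).
- move=> Phi Psi h1 h2; apply: (complex_cvg_unique (fock_ip_cvg h2 h1)).
  have -> : series (fun n => twisted_ip T n Psi Phi : (R[i])^o) =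
      fun N => ((series (fun n => twisted_ip T n Phi Psi : (R[i])^o) N)^*)%C.
    apply/funext => N; rewrite /series /= rmorph_sum; apply: eq_bigr => n _.
    by rewrite (twisted_ip_herm q1 tq Tpos).
  exact: (cvg_conj (fock_ip_cvg h1 h2)).
- move=> Phi h1; rewrite fock_ip_diag // ler0c.
  apply: limr_ge => //; apply: nearW => n; apply: sumr_ge0 => m _.
  exact: twisted_sqr_ge0.
Qed.

Lemma fock_norm_ge0 Phi : 0 <= fock_norm T Phi.
Proof. exact: sqrtr_ge0. Qed.

Lemma fock_norm_sqr Phi : fock T Phi ->
  fock_norm T Phi ^+ 2 = limn (series (fun n => twisted_sqr n Phi)).
Proof.
move=> h; rewrite /fock_norm sqr_sqrtr fock_ip_diag //=.
apply: limr_ge => //; apply: nearW => n; apply: sumr_ge0 => m _.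
exact: twisted_sqr_ge0.
Qed.

Lemma fock_partial Phi N : fock T Phi ->
  \sum_(0 <= n < N) twisted_sqr n Phi <= fock_norm T Phi ^+ 2.
Proof.
move=> h; rewrite fock_norm_sqr //.
exact: (nondecreasing_cvgn_le (@series_twisted_sqr_nondecreasing Phi) h N).
Qed.

Lemma fock_norm_bounded Phi M : (forall N, \sum_(0 <= n < N) twisted_sqr n Phi <= M) ->
  fock T Phi /\ fock_norm T Phi ^+ 2 <= M.
Proof.
move=> h; have f := fock_bounded h; split => //.
by rewrite fock_norm_sqr //; have [] := series_ge0_cvg (fun n => twisted_sqr_ge0 n Phi) h.
Qed.

Lemma fock_nondegenerate Phi : fock T Phi -> fock_norm T Phi = 0 -> Phi = fun=> 0.
Proof.
move=> h n0; apply/funext => w; apply: (twisted_ip_eq0 q1 tq Tpos (n := size w)) => //.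
rewrite twisted_sqr_ip; have : twisted_sqr (size w) Phi <= 0.
  have := fock_partial (size w).+1 h; rewrite n0 expr0n big_nat_recr //=.
  by apply: le_trans; rewrite lerDr; apply: sumr_ge0 => m _; exact: twisted_sqr_ge0.
by move=> le0; congr (_%:C%C); apply/eqP; rewrite eq_le le0 twisted_sqr_ge0.
Qed.

Lemma fock0 : fock T (fun=> 0).
Proof.
apply: (@fock_bounded _ 0) => N; rewrite big1 // => n _.
rewrite /twisted_sqr /twisted_ip /tensor_ip big1 // => w _.
by rewrite conjc0 mul0r.
Qed.

Lemma fock_finite Phi N : (forall w, (N <= size w)%N -> Phi w = 0) -> fock T Phi.
Proof.
move=> h; apply: (@fock_bounded _ (\sum_(0 <= n < N) twisted_sqr n Phi)) => M.
have z n : (N <= n)%N -> twisted_sqr n Phi = 0.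
  move=> Nn; rewrite /twisted_sqr /twisted_ip /tensor_ip big1 // => w _.
  by rewrite h ?size_tuple // conjc0 mul0r.
have [NM|MN] := leqP N M.
  rewrite (@big_cat_nat _ _ _ N) //= [X in _ + X]big_nat_cond [X in _ + X]big1 ?addr0 //.
  by move=> n /andP[/andP[Nn _] _]; exact: z.
rewrite (@big_cat_nat _ _ _ M 0 N) //=; last exact: ltnW.
rewrite lerDl; apply: sumr_ge0 => n _.
exact: twisted_sqr_ge0.
Qed.

Lemma fock_truncation Phi (e : R) : fock T Phi -> 0 < e ->
  exists N0, forall N, (N0 <= N)%N -> fock_norm T (fun w => Phi w - (if (size w < N)%N then Phi w else 0)) < e.
Proof.
move=> h e0; have e20 : 0 < e ^+ 2 by rewrite exprn_gt0.
have := h; rewrite /fock -/(twisted_sqr _ _) => hc.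
have /cvgrPdist_lt/(_ _ e20) : series (fun n => twisted_sqr n Phi) @ \oo --> fock_norm T Phi ^+ 2.
  by rewrite fock_norm_sqr.
move=> [N0 _ NP]; exists N0 => N N0N; have := NP N N0N; rewrite /series /= => lt.
set Psi := fun w => _.
have sm n : (n < N)%N -> twisted_sqr n Psi = 0.
  move=> nN; rewrite /twisted_sqr (twisted_ip_local q1 tq (Phi' := fun=> 0) (Psi' := fun=> 0)).
  - by rewrite /twisted_ip /tensor_ip big1 // => w _; rewrite conjc0 mul0r.
  - by move=> w wn; rewrite /Psi wn nN subrr.
  - by move=> w wn; rewrite /Psi wn nN subrr.
have bg n : (N <= n)%N -> twisted_sqr n Psi = twisted_sqr n Phi.
  move=> Nn; rewrite /twisted_sqr; congr complex.Re.
  by apply: (twisted_ip_local q1 tq) => w wn; rewrite /Psi wn ltnNge Nn /= subr0.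
have [] := @fock_norm_bounded Psi (fock_norm T Phi ^+ 2 - \sum_(0 <= n < N) twisted_sqr n Phi).
  move=> M; have [NM|MN] := leqP N M.
    rewrite (@big_cat_nat _ _ _ N) //= [X in X + _]big_nat_cond [X in X + _]big1 ?add0r; last first.
      by move=> n /andP[/andP[_ nN] _]; exact: sm.
    rewrite (eq_big_nat _ _ (F2 := fun n => twisted_sqr n Phi)).
      by rewrite lerBrDl -(@big_cat_nat _ _ _ N) //; exact: fock_partial.
    by move=> n /andP[Nn _]; exact: bg.
  rewrite big_nat_cond big1 ?subr_ge0 ?fock_partial // => n /andP[/andP[_ nM] _].
  by apply: sm; exact: ltn_trans MN.
move=> _ le; rewrite -(@ltr_pXn2r _ 2) ?nnegrE ?fock_norm_ge0 ?ltW //.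
by apply: le_lt_trans le _; apply: le_lt_trans lt; exact: ler_norm.
Qed.

End Fock.

Section FieldOperators.
Context (R : realType) (V : vectType R[i]) (dot : {dot V for Num.conj}).
Local Notation ip := (ip dot).
Context (d : nat) (b : 'I_d -> V) (T : 'M[R[i]]_(d * d)).
Local Notation tensor := (tensor R d).
Local Notation tensor_op := (tensor_op R d).
Local Notation nc := Normc.normc.
Implicit Types (Phi Psi : tensor) (a : R[i]) (h : V).
Local Notation t := (twist_end T).
Context (q : R) (q1 : q < 1) (tq : op_bound 2 2 (t 0) q) (br : braided T).
Hypothesis Tpos : forall (n : nat) (Phi : tensor), homogeneous n Phi ->
        Phi <> (fun _ => 0) -> 0 < tensor_ip n Phi (twist_P T n Phi).
Local Notation sqr := (twisted_sqr T).
Local Notation create := (creation dot b).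

Definition annihilate h : tensor_op := fun Phi w =>
  \sum_(x < d) (ip (b x) h)^*%C * creation_sum t (size w).+1 Phi (x :: w).

Lemma twisted_ip_sumr n Phi I (r : seq I) (c : I -> R[i]) (F : I -> tensor) :
  twisted_ip T n Phi (fun w => \sum_(i <- r) c i * F i w) =
  \sum_(i <- r) c i * twisted_ip T n Phi (F i).
Proof.
rewrite twisted_ipE (tensor_end_sum (twist_P_end T n) r xpredT) /tensor_ip.
under eq_bigr do rewrite mulr_sumr.
rewrite exchange_big; apply: eq_bigr => i _; rewrite twisted_ipE /tensor_ip mulr_sumr.
by apply: eq_bigr => w _; rewrite mulrCA.
Qed.

Lemma twisted_ipZl n a Phi Psi :
  twisted_ip T n (fun w => a * Phi w) Psi = (a^*)%C * twisted_ip T n Phi Psi.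
Proof.
rewrite /twisted_ip /tensor_ip mulr_sumr; apply: eq_bigr => w _.
by rewrite rmorphM mulrA.
Qed.

Lemma twisted_ipZr n a Phi Psi :
  twisted_ip T n Phi (fun w => a * Psi w) = a * twisted_ip T n Phi Psi.
Proof.
rewrite !twisted_ipE tensor_end_scale /tensor_ip mulr_sumr; apply: eq_bigr => w _.
by rewrite mulrCA.
Qed.

Lemma twisted_ip_creation n h Phi Psi :
  twisted_ip T n.+1 (create h Phi) Psi = twisted_ip T n Phi (annihilate h Psi).
Proof.
rewrite twisted_slice /slice_ip /=.
transitivity (twisted_ip T n Phi
    (fun w => \sum_(x < d) (ip (b x) h)^*%C * creation_sum t n.+1 Psi (x :: w))).
  rewrite (twisted_ip_sumr n Phi _ _ (fun x w => creation_sum t n.+1 Psi (x :: w))).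
  by apply: eq_bigr => x _; rewrite -twisted_ipZl.
by apply: (twisted_ip_local q1 tq) => // w wn; rewrite /annihilate wn.
Qed.

Definition creation_bound h : R := (1 - q)^-1 * \sum_(x < d) nc (ip (b x) h) ^+ 2.

Lemma creation_bound_ge0 h : 0 <= creation_bound h.
Proof.
rewrite /creation_bound mulr_ge0 ?invr_ge0 ?subr_ge0 ?(ltW q1) //.
by apply: sumr_ge0 => x _; exact: sqr_ge0.
Qed.

Lemma creation_sqr n h Phi : sqr n.+1 (create h Phi) <= creation_bound h * sqr n Phi.
Proof.
have le1 := twisted_le_slice q1 tq Tpos n (create h Phi).
apply: le_trans le1 _.
rewrite /creation_bound -mulrA; apply: ler_wpM2l; first by rewrite invr_ge0 subr_ge0 ltW.
rewrite /slice_ip raddf_sum mulr_suml /=; apply: ler_sum => x _.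
have -> : twisted_ip T n (fun w => ip (b x) h * Phi w) (fun w => ip (b x) h * Phi w) =
    ((nc (ip (b x) h) ^+ 2 * sqr n Phi)%:C)%C.
  rewrite twisted_ipZr twisted_ipZl mulrA [_ * (_^*)%C]mulrC normc_sqr.
  rewrite (twisted_sqr_ip q1 tq Tpos).
  exact: (esym (rmorphM (real_complex R) _ _)).
by [].
Qed.

Lemma creation_sqr0 h Phi : sqr 0 (create h Phi) = 0.
Proof.
rewrite /twisted_sqr (twisted_ip_local q1 tq (Phi' := fun=> 0) (Psi' := fun=> 0)); try by case.
by rewrite /twisted_ip /tensor_ip big1 // => w _; rewrite conjc0 mul0r.
Qed.

Lemma annihilate_sqr n h Psi : sqr n (annihilate h Psi) <= creation_bound h * sqr n.+1 Psi.
Proof.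
set Phi := annihilate h Psi.
have s0 := twisted_sqr_ge0 q1 tq Tpos n Phi.
have s1 := twisted_sqr_ge0 q1 tq Tpos n.+1 Psi.
have [z|nz] := eqVneq (sqr n Phi) 0.
  by rewrite z mulr_ge0 // creation_bound_ge0.
have p : 0 < sqr n Phi by rewrite lt_def nz.
have e : twisted_ip T n.+1 (create h Phi) Psi = ((sqr n Phi)%:C)%C.
  by rewrite twisted_ip_creation (twisted_sqr_ip q1 tq Tpos).
have := cauchy_schwarz (semi_inner_twisted q1 tq Tpos n.+1) (I : setT (create h Phi)) (I : setT Psi).
rewrite e normc_real ger0_norm // -(@ler_pXn2r _ 2) ?nnegrE ?mulr_ge0 ?semi_norm_ge0 //.
rewrite exprMn -!(twisted_sqrE q1 tq Tpos) => le.
rewrite -(ler_pM2l p) -expr2; apply: le_trans le _.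
rewrite mulrCA mulrA; apply: ler_wpM2r => //.
exact: creation_sqr.
Qed.

Lemma create_linear h a Phi Psi :
  create h (fun w => a * Phi w + Psi w) = fun w => a * create h Phi w + create h Psi w.
Proof.
apply/funext => -[|x w] /=; first by rewrite mulr0 addr0.
by rewrite mulrDr mulrCA.
Qed.

Lemma annihilate_linear h a Phi Psi : annihilate h (fun w => a * Phi w + Psi w) =
  fun w => a * annihilate h Phi w + annihilate h Psi w.
Proof.
apply/funext => w; rewrite /annihilate mulr_sumr -big_split; apply: eq_bigr => x _ /=.
by rewrite tensor_end_linear mulrDr mulrCA.
Qed.

Lemma sqrt_bound (x y K : R) : 0 <= x -> 0 <= y -> 0 <= K -> x ^+ 2 <= K * y ^+ 2 ->
  x <= Num.sqrt K * y.
Proof.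
move=> x0 y0 K0 h; rewrite -(@ler_pXn2r _ 2) ?nnegrE ?mulr_ge0 ?sqrtr_ge0 //.
by rewrite exprMn sqr_sqrtr.
Qed.

Lemma create_bounded h : bounded_op T (create h).
Proof.
have key Phi : fock T Phi -> fock T (create h Phi) /\
    fock_norm T (create h Phi) ^+ 2 <= creation_bound h * fock_norm T Phi ^+ 2.
  move=> f; apply: (fock_norm_bounded q1 tq Tpos) => -[|N].
    by rewrite big_geq // mulr_ge0 ?creation_bound_ge0 ?sqr_ge0.
  rewrite big_nat_recl // creation_sqr0 add0r.
  apply: le_trans (_ : creation_bound h * (\sum_(0 <= n < N) sqr n Phi) <= _).
    by rewrite mulr_sumr; apply: ler_sum => n _; exact: creation_sqr.
  by apply: ler_wpM2l; [exact: creation_bound_ge0|exact: (fock_partial q1 tq Tpos)].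
split => [Phi /key[] //|a Phi Psi _ _|]; first exact: create_linear.
exists (Num.sqrt (creation_bound h)) => Phi f.
by apply: sqrt_bound; rewrite ?fock_norm_ge0 ?creation_bound_ge0 //; have [] := key _ f.
Qed.

Lemma annihilate_bounded h : bounded_op T (annihilate h).
Proof.
have key Phi : fock T Phi -> fock T (annihilate h Phi) /\
    fock_norm T (annihilate h Phi) ^+ 2 <= creation_bound h * fock_norm T Phi ^+ 2.
  move=> f; apply: (fock_norm_bounded q1 tq Tpos) => N.
  apply: le_trans (_ : creation_bound h * (\sum_(0 <= n < N) sqr n.+1 Phi) <= _).
    by rewrite mulr_sumr; apply: ler_sum => n _; exact: annihilate_sqr.
  apply: ler_wpM2l; first exact: creation_bound_ge0.
  apply: le_trans (fock_partial q1 tq Tpos N.+1 f).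
  by rewrite big_nat_recl // lerDr (twisted_sqr_ge0 q1 tq Tpos).
split => [Phi /key[] //|a Phi Psi _ _|]; first exact: annihilate_linear.
exists (Num.sqrt (creation_bound h)) => Phi f.
by apply: sqrt_bound; rewrite ?fock_norm_ge0 ?creation_bound_ge0 //; have [] := key _ f.
Qed.

Lemma fock_ip_creation h Phi Psi : fock T Phi -> fock T Psi ->
  fock_ip T Phi (annihilate h Psi) = fock_ip T (create h Phi) Psi.
Proof.
move=> f1 f2; have [fa _ _] := annihilate_bounded h; have [fc _ _] := create_bounded h.
have c1 := fock_ip_cvg q1 tq Tpos f1 (fa _ f2).
have c2 := fock_ip_cvg q1 tq Tpos (fc _ f1) f2.
apply: (complex_cvg_unique c1).
have := c2; rewrite -cvg_shiftS.
have -> // : (fun n => series (fun n => twisted_ip T n (create h Phi) Psi : (R[i])^o) n.+1) =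
   series (fun n => twisted_ip T n Phi (annihilate h Psi) : (R[i])^o).
apply/funext => N; rewrite /series /= big_nat_recl // (_ : twisted_ip T 0 _ _ = 0) ?add0r.
  by apply: eq_bigr => n _; exact: twisted_ip_creation.
rewrite /twisted_ip /tensor_ip big1 // => w _.
have -> : create h Phi w = 0 by rewrite tuple0.
by rewrite conjc0 mul0r.
Qed.

(* The adjoint of a bounded operator is determined on the Fock space. *)
Lemma adjointE (A B : tensor_op) : bounded_op T B ->
  (forall Phi Psi, fock T Phi -> fock T Psi -> fock_ip T Phi (B Psi) = fock_ip T (A Phi) Psi) ->
  bounded_op T (adjoint T A) /\ forall Psi, fock T Psi -> adjoint T A Psi = B Psi.
Proof.
move=> Bb BA.
have [Ab AA] : bounded_op T (adjoint T A) /\ forall Phi Psi, fock T Phi -> fock T Psi ->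
      fock_ip T Phi (adjoint T A Psi) = fock_ip T (A Phi) Psi.
  exact: (@xgetPex _ (fun _ _ => 0) [set B | bounded_op T B /\
    forall Phi Psi, fock T Phi -> fock T Psi ->
      fock_ip T Phi (B Psi) = fock_ip T (A Phi) Psi] (ex_intro _ B (conj Bb BA))).
split => // Psi f; have [fA _ _] := Ab; have [fB _ _] := Bb.
have hs := semi_inner_fock q1 tq Tpos.
have fd := fock_lin q1 tq Tpos (a := -1) (fB _ f) (fA _ f).
have : (fun w => -1 * B Psi w + adjoint T A Psi w) = fun=> 0.
  apply: (fock_nondegenerate q1 tq Tpos fd).
  set Chi := (fun w => -1 * B Psi w + adjoint T A Psi w) in fd *.
  have e0 : fock_ip T Chi Chi = 0.
    have -> := semi_inner_linear hs (-1) fd (fB _ f) (fA _ f).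
    by rewrite (BA _ _ fd f) (AA _ _ fd f) mulN1r addNr.
  by rewrite /fock_norm e0 sqrtr0.
move=> e; apply/funext => w; have := congr1 (fun F => F w) e.
by rewrite /= mulN1r addrC => /eqP; rewrite subr_eq0 => /eqP.
Qed.

Lemma annihilationE h Psi : fock T Psi -> annihilation dot b T h Psi = annihilate h Psi.
Proof.
have [_ h2] := @adjointE (create h) (annihilate h) (annihilate_bounded h) (@fock_ip_creation h).
exact: h2.
Qed.

End FieldOperators.

Section BoundedOperators.
Context (R : realType) (d : nat) (T : 'M[R[i]]_(d * d)).
Local Notation tensor := (tensor R d).
Local Notation tensor_op := (tensor_op R d).
Local Notation nc := Normc.normc.
Implicit Types (Phi Psi : tensor) (a : R[i]).
Local Notation t := (twist_end T).
Context (q : R) (q1 : q < 1) (tq : op_bound 2 2 (t 0) q).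
Hypothesis Tpos : forall (n : nat) (Phi : tensor), homogeneous n Phi ->
        Phi <> (fun _ => 0) -> 0 < tensor_ip n Phi (twist_P T n Phi).

Lemma bounded_op_id : bounded_op T id.
Proof. by split => //; exists 1 => Phi _; rewrite mul1r. Qed.

Lemma bounded_op_zero : bounded_op T (fun _ _ => 0).
Proof.
split => [Phi _|a Phi Psi _ _|]; first exact: (fock0 q1 tq Tpos).
  by apply/funext => w; rewrite mulr0 addr0.
exists 0 => Phi _; rewrite mul0r /fock_norm.
have f0 := fock0 q1 tq Tpos.
set z : tensor := fun=> 0 in f0 *.
have ez : (fun w => -1 * z w + z w) = z by apply/funext => w; rewrite /z mulr0 addr0.
have := semi_inner_linear (semi_inner_fock q1 tq Tpos) (-1) f0 f0 f0.
by rewrite ez mulN1r addNr => ->; rewrite sqrtr0.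
Qed.

Lemma bounded_op_comp (A B : tensor_op) : bounded_op T A -> bounded_op T B ->
  bounded_op T (fun Phi => A (B Phi)).
Proof.
move=> [Af Al [M AM]] [Bf Bl [N BN]]; split => [Phi f|a Phi Psi f g|].
- by apply: Af; exact: Bf.
- by rewrite Bl // Al //; exact: Bf.
exists (`|M| * N) => Phi f; apply: le_trans (AM _ (Bf _ f)) _.
apply: le_trans (_ : `|M| * fock_norm T (B Phi) <= _).
  by apply: ler_wpM2r; [exact: fock_norm_ge0|exact: ler_norm].
by rewrite -mulrA; apply: ler_wpM2l (BN _ f).
Qed.

Lemma bounded_op_lin a (A B : tensor_op) : bounded_op T A -> bounded_op T B ->
  bounded_op T (fun Phi w => a * A Phi w + B Phi w).
Proof.
move=> [Af Al [M AM]] [Bf Bl [N BN]]; split => [Phi f|c Phi Psi f g|].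
- by apply: (fock_lin q1 tq Tpos (Af _ f) (Bf _ f)).
- by rewrite Bl // Al //; apply/funext => w; ring.
exists (nc a * M + N) => Phi f.
apply: le_trans (semi_norm_triangle (semi_inner_fock q1 tq Tpos) a (Af _ f) (Bf _ f)) _.
rewrite mulrDl lerD //; last exact: BN.
by rewrite -mulrA; apply: ler_wpM2l (AM _ f); exact: normc_ge0.
Qed.

Lemma bounded_op_eq (A B : tensor_op) : (forall Phi, fock T Phi -> A Phi = B Phi) ->
  bounded_op T B -> bounded_op T A.
Proof.
move=> e [Bf Bl [M BM]]; split => [Phi f|a Phi Psi f g|].
- by rewrite e //; exact: Bf.
- by rewrite !e // ?Bl //; exact: (fock_lin q1 tq Tpos).
by exists M => Phi f; rewrite e //; exact: BM.
Qed.

End BoundedOperators.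

Section FieldAlgebra.
Context (R : realType) (V : vectType R[i]) (dot : {dot V for Num.conj}).
Local Notation ip := (ip dot).
Context (d : nat) (b : 'I_d -> V) (T : 'M[R[i]]_(d * d)).
Local Notation tensor := (tensor R d).
Local Notation tensor_op := (tensor_op R d).
Local Notation nc := Normc.normc.
Implicit Types (Phi Psi : tensor) (a : R[i]) (x y : V).
Local Notation t := (twist_end T).
Context (q : R) (q1 : q < 1) (tq : op_bound 2 2 (t 0) q) (br : braided T).
Hypothesis Tpos : forall (n : nat) (Phi : tensor), homogeneous n Phi ->
        Phi <> (fun _ => 0) -> 0 < tensor_ip n Phi (twist_P T n Phi).
Local Notation create := (creation dot b).
Local Notation annih := (annihilate dot b T).
Variable (S : V -> V).
Hypothesis Santi : forall a x y, S (a *: x + y) = (a^*)%C *: S x + S y.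
Hypothesis SK : forall x, S (S x) = x.

Definition explicit_field x : tensor_op := fun Phi w => create x Phi w + annih (S x) Phi w.
Local Notation field := explicit_field.

Lemma field_opE x Phi : fock T Phi -> field_op dot b T S x Phi = field x Phi.
Proof. by move=> f; rewrite /field_op /explicit_field (annihilationE dot b q1 tq Tpos). Qed.

Lemma field_bounded x : bounded_op T (field x).
Proof.
have := bounded_op_lin q1 tq Tpos 1 (create_bounded dot b q1 tq Tpos x)
          (annihilate_bounded dot b q1 tq Tpos (S x)).
by apply: (bounded_op_eq q1 tq Tpos) => Phi _; apply/funext => w; rewrite mul1r.
Qed.

Lemma field_linear x a Phi Psi :
  field x (fun w => a * Phi w + Psi w) = fun w => a * field x Phi w + field x Psi w.
Proof.
by apply/funext => w; rewrite /explicit_field create_linear annihilate_linear; ring.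
Qed.

Lemma field_combine a x y Phi :
  field (a *: x + y) Phi = fun w => a * field x Phi w + field y Phi w.
Proof.
apply/funext => w; rewrite /explicit_field Santi.
have -> : create (a *: x + y) Phi w = a * create x Phi w + create y Phi w.
  by case: w => [|z w] /=; rewrite ?mulr0 ?addr0 // ipDr ipZr mulrDl mulrA.
have -> : annih ((a^*)%C *: S x + S y) Phi w = a * annih (S x) Phi w + annih (S y) Phi w.
  rewrite /annihilate mulr_sumr -big_split; apply: eq_bigr => z _ /=.
  by rewrite ipDr ipZr rmorphD rmorphM /= conjcK; ring.
by ring.
Qed.

Lemma field_adjoint x Phi Psi : fock T Phi -> fock T Psi ->
  fock_ip T Phi (field (S x) Psi) = fock_ip T (field x Phi) Psi.
Proof.
move=> f g; have hs := semi_inner_fock q1 tq Tpos.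
have [c1 _ _] := create_bounded dot b q1 tq Tpos x.
have [c2 _ _] := create_bounded dot b q1 tq Tpos (S x).
have [a1 _ _] := annihilate_bounded dot b q1 tq Tpos x.
have [a2 _ _] := annihilate_bounded dot b q1 tq Tpos (S x).
have [X1 _ _] := field_bounded x.
have e1 : field (S x) Psi = fun w => 1 * create (S x) Psi w + annih x Psi w.
  by apply/funext => w; rewrite /explicit_field SK mul1r.
have e2 : field x Phi = fun w => 1 * create x Phi w + annih (S x) Phi w.
  by apply/funext => w; rewrite /explicit_field mul1r.
rewrite e1 (semi_inner_linear hs) ?mul1r; [|exact: f|exact: c2|exact: a1].
rewrite (fock_ip_creation dot b q1 tq Tpos) // (semi_inner_herm hs g (X1 _ f)).
rewrite e2 (semi_inner_linear hs) ?mul1r; [|exact: g|exact: c1|exact: a2].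
rewrite (fock_ip_creation dot b q1 tq Tpos) // rmorphD /=.
rewrite -(semi_inner_herm hs (c2 _ g) f) addrC; congr (_ + _).
exact: (semi_inner_herm hs g (c1 _ f)).
Qed.

End FieldAlgebra.

Section FieldVonNeumann.
Context (R : realType) (V : vectType R[i]) (dot : {dot V for Num.conj}).
Local Notation ip := (ip dot).
Context (d : nat) (b : 'I_d -> V) (T : 'M[R[i]]_(d * d)).
Local Notation tensor := (tensor R d).
Local Notation tensor_op := (tensor_op R d).
Implicit Types (Phi Psi : tensor) (a : R[i]) (x y : V).
Local Notation t := (twist_end T).
Context (q : R) (q1 : q < 1) (tq : op_bound 2 2 (t 0) q) (br : braided T).
Hypothesis Tpos : forall (n : nat) (Phi : tensor), homogeneous n Phi ->
        Phi <> (fun _ => 0) -> 0 < tensor_ip n Phi (twist_P T n Phi).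
Variable (S : V -> V).
Hypothesis Santi : forall a x y, S (a *: x + y) = (a^*)%C *: S x + S y.
Hypothesis SK : forall x, S (S x) = x.
Local Notation field := (explicit_field dot b T S).
Local Notation create := (creation dot b).
Local Notation annih := (annihilate dot b T).
Local Notation field_op := (field_op dot b T S).

Let fE := field_opE dot b q1 tq Tpos S.
Let fB := field_bounded dot b q1 tq Tpos S.

Lemma adjoint_field x Psi : fock T Psi -> adjoint T (field_op x) Psi = field (S x) Psi.
Proof.
move=> f; have [_ h] := @adjointE _ _ T q q1 tq Tpos (field_op x) (field (S x)) (fB _)
   (fun Phi Psi f g => etrans (field_adjoint dot b q1 tq Tpos SK x f g)
     (congr1 (fun F => fock_ip T F Psi) (esym (fE x f)))).
exact: h.
Qed.

Definition spanning (E : set V) : Prop := forall P : V -> Prop,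
  P 0 -> (forall x, E x -> P x) -> (forall a x y, P x -> P y -> P (a *: x + y)) -> forall x, P x.

Lemma field_zero Phi : field 0 Phi = fun=> 0.
Proof.
have := field_combine dot b T Santi (-1) 0 0 Phi.
rewrite scaler0 addr0 => e; apply/funext => w.
by rewrite e mulN1r addNr.
Qed.

Lemma bounded_op_0 (B : tensor_op) : bounded_op T B -> B (fun=> 0) = fun=> 0.
Proof.
move=> [_ Bl _]; have f0 := fock0 q1 tq Tpos.
set z : tensor := fun=> 0 in f0 *.
have ez : (fun w => -1 * z w + z w) = z by apply/funext => w; rewrite /z mulr0 addr0.
have := Bl (-1) z z f0 f0; rewrite ez => e.
by apply/funext => w; rewrite e mulN1r addNr.
Qed.

Lemma commutant_field (E : set V) : spanning E ->
  commutant T (field_op @` E `|` adjoint T @` (field_op @` E)) =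
  [set B | bounded_op T B /\ forall x Phi, fock T Phi -> field x (B Phi) = B (field x Phi)].
Proof.
move=> sE; apply/seteqP; split => B [Bb BC]; have [Bf Bl _] := Bb; split => //.
  apply: sE => [Phi f|x Ex Phi f|a x y hx hy Phi f].
  - by rewrite !field_zero bounded_op_0.
  - rewrite -(fE x (Bf _ f)) -(fE x f); apply: BC => //.
    by left; exists x.
  have [fx _ _] := fB x; have [fy _ _] := fB y.
  by rewrite !field_combine // hx // hy // Bl //; [exact: fx|exact: fy].
move=> A [[x _ <-]|[_ [x _ <-] <-]] Phi f.
  by rewrite !fE //; [exact: BC|exact: Bf].
by rewrite !adjoint_field //; [exact: BC|exact: Bf].
Qed.

Lemma von_neumann_field (E E' : set V) : spanning E -> spanning E' ->
  von_neumann T (field_op @` E) = von_neumann T (field_op @` E').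
Proof. by move=> sE sE'; rewrite /von_neumann !commutant_field. Qed.

Context (hb : orthonormal_basis dot b) (e : 'I_d -> V) (he : linear_basis e).
Local Notation X := (fun i => field_op (e i)).

Lemma linear_basis_spanning : spanning (range e).
Proof.
move=> P P0 hP hD x.
have := memvf x; rewrite -(span_basis he) => xs.
have := coord_span (X := codom_tuple e) xs => ->.
apply: big_ind => //.
- by move=> u v Pu Pv; have := hD 1 u v Pu Pv; rewrite scale1r.
move=> i _; rewrite -[_ *: _]addr0; apply: hD => //; apply: hP.
have : (codom e)`_i \in codom e by apply: mem_nth; rewrite size_codom.
by move=> /codomP[j ->]; exists j.
Qed.

Lemma range_field_op : range X = field_op @` range e.
Proof.
apply/seteqP; split => A.
  by move=> [i _ <-]; exists (e i) => //; exists i.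
by move=> [x [i _ <-] <-]; exists i.
Qed.

Lemma fock_vacuum : fock T (@vacuum R d).
Proof. by apply: (fock_finite q1 tq Tpos (N := 1)) => -[]. Qed.

Lemma eval_word_bounded u : bounded_op T (eval_word X u).
Proof.
elim: u => [|j u IH]; first exact: bounded_op_id.
apply: (bounded_op_comp (A := X j) _ IH).
by apply: (bounded_op_eq q1 tq Tpos (B := field (e j))) => // Phi f; rewrite fE.
Qed.

Lemma eval_word_fock u Phi : fock T Phi -> fock T (eval_word X u Phi).
Proof. by have [h _ _] := eval_word_bounded u; exact: h. Qed.

Lemma eval_word_cons j u Phi : fock T Phi ->
  eval_word X (j :: u) Phi = field (e j) (eval_word X u Phi).
Proof. by move=> f; rewrite /= fE //; exact: eval_word_fock. Qed.

Definition word_combination (s : seq (R[i] * seq 'I_d)) : tensor_op := fun Phi w =>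
  \sum_(cu <- s) cu.1 * eval_word X cu.2 Phi w.

Lemma word_combination_cons c u s Phi : word_combination ((c, u) :: s) Phi =
  fun w => c * eval_word X u Phi w + word_combination s Phi w.
Proof. by apply/funext => w; rewrite /word_combination big_cons. Qed.

Lemma word_combination_bounded s : bounded_op T (word_combination s).
Proof.
elim: s => [|[c u] s IH].
  apply: (bounded_op_eq q1 tq Tpos _ (bounded_op_zero q1 tq Tpos)) => Phi _.
  by apply/funext => w; rewrite /word_combination big_nil.
apply: (bounded_op_eq q1 tq Tpos _
   (bounded_op_lin q1 tq Tpos c (eval_word_bounded u) IH)) => Phi _.
exact: word_combination_cons.
Qed.

Lemma word_combination_von_neumann s :
  von_neumann T (range X) (word_combination s).
Proof.
split; first exact: word_combination_bounded.
move=> B; rewrite range_field_op (commutant_field linear_basis_spanning) => -[Bb Bc] Phi f.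
have [Bf Bl _] := Bb.
have word u : B (eval_word X u Phi) = eval_word X u (B Phi).
  elim: u => [//|j u IH]; rewrite !eval_word_cons //; last exact: Bf.
  by rewrite -IH Bc //; exact: eval_word_fock.
elim: s => [|[c u] s IH].
  rewrite (_ : word_combination [::] _ = fun=> 0) ?(bounded_op_0 Bb).
    by apply/funext => w; rewrite /word_combination big_nil.
  by apply/funext => w; rewrite /word_combination big_nil.
have [sf _ _] := word_combination_bounded s.
by rewrite !word_combination_cons Bl ?IH ?word //; [exact: eval_word_fock|exact: sf].
Qed.

Definition polynomial_vector Phi := exists s, word_combination s (@vacuum R d) = Phi.

Lemma polynomial_vector_fock Phi : polynomial_vector Phi -> fock T Phi.
Proof. by move=> [s <-]; have [h _ _] := word_combination_bounded s; apply: h fock_vacuum. Qed.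

Lemma polynomial_vector_lin a Phi Psi : polynomial_vector Phi -> polynomial_vector Psi ->
  polynomial_vector (fun w => a * Phi w + Psi w).
Proof.
move=> [s <-] [s' <-]; exists ([seq (a * cu.1, cu.2) | cu <- s] ++ s').
apply/funext => w; rewrite /word_combination big_cat big_map mulr_sumr; congr (_ + _).
by apply: eq_bigr => cu _; rewrite mulrA.
Qed.

Lemma polynomial_vector_0 : polynomial_vector (fun=> 0).
Proof. by exists [::]; apply/funext => w; rewrite /word_combination big_nil. Qed.

Lemma polynomial_vector_field x Phi : polynomial_vector Phi -> polynomial_vector (field x Phi).
Proof.
move=> [s <-]; move: x; apply: linear_basis_spanning => [|_ [j _ <-]|a x y hx hy].
- by rewrite field_zero; exact: polynomial_vector_0.
- exists [seq (cu.1, j :: cu.2) | cu <- s]; elim: s => [|[c u] s IH].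
    apply/funext => w; rewrite /word_combination big_nil.
    rewrite (_ : (fun w => _) = fun=> 0) ?(bounded_op_0 (fB _)) //.
    by apply/funext => v; rewrite big_nil.
  rewrite map_cons !word_combination_cons IH field_linear.
  by rewrite (eval_word_cons _ _ fock_vacuum).
by rewrite field_combine //; exact: polynomial_vector_lin.
Qed.

Lemma polynomial_vector_finite N Phi :
  (forall w, (N <= size w)%N -> Phi w = 0) -> polynomial_vector Phi.
Proof.
elim: N Phi => [|N IH] Phi z.
  rewrite (_ : Phi = fun=> 0); first exact: polynomial_vector_0.
  by apply/funext => w; rewrite z.
have vac : polynomial_vector (@vacuum R d).
  exists [:: (1, [::])]; apply/funext => w.
  by rewrite /word_combination big_cons big_nil addr0 mul1r.
pose slice (x : 'I_d) : tensor := fun w => Phi (x :: w).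
have sl (x : 'I_d) : polynomial_vector (slice x) by apply: IH => w h; rewrite /slice z.
have cr (x : 'I_d) : polynomial_vector (create (b x) (slice x)).
  have -> : create (b x) (slice x) =
      fun w => -1 * annih (S (b x)) (slice x) w + field (b x) (slice x) w.
    by apply/funext => w; rewrite /explicit_field; ring.
  apply: polynomial_vector_lin; last exact: polynomial_vector_field.
  apply: IH => w Nw; rewrite /annihilate big1 // => y _.
  have wn : (size w < (size w).+1)%N by [].
  rewrite (op_bound_local (creation_sum_op_bound q1 tq (leqnn (size w).+1))
    (Psi := fun=> 0)) ?tensor_end_zero ?mulr0 //.
  by move=> v vn; rewrite /slice z //= vn ltnS leqW.
have -> : Phi = fun w => Phi [::] * @vacuum R d w +
    \sum_(x < d) create (b x) (slice x) w.
  apply/funext => -[|x w]; first by rewrite mulr1 big1 ?addr0.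
  have [_ on] := hb.
  rewrite mulr0 add0r (bigD1 x) //= on eqxx mul1r big1 ?addr0 // => y yx.
  by rewrite on eq_sym (negbTE yx) mul0r.
apply: polynomial_vector_lin => //.
elim: (index_enum _) => [|x r IHr].
  rewrite (_ : (fun w => _) = fun=> 0); first exact: polynomial_vector_0.
  by apply/funext => w; rewrite big_nil.
rewrite (_ : (fun w => _) = fun w => 1 * create (b x) (slice x) w +
     \sum_(x <- r) create (b x) (slice x) w).
  exact: polynomial_vector_lin.
by apply/funext => w; rewrite big_cons mul1r.
Qed.

Lemma L2_vacuum_fock Phi : fock T Phi -> L2_vacuum T (von_neumann T (range X)) Phi.
Proof.
move=> f; split => // eps eps0.
have [N /(_ N (leqnn N)) hN] := fock_truncation q1 tq Tpos f eps0.
have [|s es] := @polynomial_vector_finite N (fun w => if (size w < N)%N then Phi w else 0).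
  by move=> w; rewrite leqNgt => /negbTE ->.
exists (word_combination s); first exact: word_combination_von_neumann.
by rewrite es.
Qed.

Lemma fock_vector_unique Phi Psi : fock T Phi -> fock T Psi ->
  (forall u, fock_ip T Phi (eval_word X u (@vacuum R d)) =
             fock_ip T Psi (eval_word X u (@vacuum R d))) -> Phi = Psi.
Proof.
move=> f g h; have hs := semi_inner_fock q1 tq Tpos.
pose Chi : tensor := fun w => -1 * Psi w + Phi w.
have fChi : fock T Chi by exact: (fock_lin q1 tq Tpos).
have ort Xi : polynomial_vector Xi -> fock_ip T Chi Xi = 0.
  move=> [s <-]; elim: s => [|[c u] s IH].
    rewrite (_ : word_combination [::] _ = fun=> 0).
      have f0 := fock0 q1 tq Tpos; set z : tensor := fun=> 0 in f0 *.
      have := semi_inner_linear hs (-1) fChi f0 f0.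
      rewrite (_ : (fun w => -1 * z w + z w) = z) ?mulN1r ?addNr //.
      by apply/funext => w; rewrite /z mulr0 addr0.
    by apply/funext => w; rewrite /word_combination big_nil.
  have fu : fock T (eval_word X u (@vacuum R d)) by exact: eval_word_fock fock_vacuum.
  have fs : fock T (word_combination s (@vacuum R d)).
    by apply: polynomial_vector_fock; exists s.
  rewrite word_combination_cons (semi_inner_linear hs _ fChi fu fs) IH addr0.
  rewrite (semi_inner_herm hs fu fChi) (semi_inner_linear hs _ fu g f).
  rewrite (semi_inner_herm hs f fu) (semi_inner_herm hs g fu) h mulN1r addNr.
  by rewrite rmorph0 mulr0.
have n0 : fock_norm T Chi = 0.
  apply/eqP; rewrite eq_le fock_norm_ge0 andbT leNgt; apply/negP => p.
  have [N /(_ N (leqnn N))] := fock_truncation q1 tq Tpos fChi (divr_gt0 p (ltr0n _ 2)).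
  pose Tr : tensor := fun w => if (size w < N)%N then Chi w else 0.
  have fTr : fock T Tr.
    by apply: (fock_finite q1 tq Tpos (N := N)) => w; rewrite /Tr leqNgt => /negbTE ->.
  pose Re : tensor := fun w => -1 * Tr w + Chi w.
  have fRe : fock T Re by exact: (fock_lin q1 tq Tpos).
  rewrite (_ : (fun w => _) = Re :> tensor); last by apply/funext => w; rewrite /Re mulN1r addrC.
  move=> small.
  have e1 : fock_ip T Chi Re = fock_ip T Chi Chi.
    rewrite (semi_inner_linear hs _ fChi fTr fChi) ort ?mulr0 ?add0r //.
    apply: (@polynomial_vector_finite N) => w; by rewrite /Tr leqNgt => /negbTE ->.
  have := cauchy_schwarz hs fChi fRe.
  rewrite e1 (semi_norm_sqr hs fChi) normc_real ger0_norm ?sqr_ge0 // -/(fock_norm T Chi).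
  rewrite -/(fock_norm T Re) expr2 ler_pM2l // leNgt => /negP; apply.
  by apply: lt_trans small _; rewrite ltr_pdivrMr // mulr_natr mulr2n ltrDl.
have := fock_nondegenerate q1 tq Tpos fChi n0 => e0.
apply/funext => w; have := congr1 (fun F => F w) e0.
by rewrite /Chi mulN1r addrC => /eqP; rewrite subr_eq0 => /eqP.
Qed.

End FieldVonNeumann.

Section LegLocality.
Context (R : realType) (d : nat) (T : 'M[R[i]]_(d * d)) (c : 'I_d -> 'I_d -> R[i]).
Local Notation tensor := (tensor R d).
Implicit Types (Phi Psi : tensor) (A B : tensor_end R d).
Local Notation t := (twist_end T).
Local Notation cc := (cap_end c).
Local Notation TT := (braid_product t).
Local Notation L := (pair_last t cc).
Local Notation G := (pair_right t cc).

Definition lowers A k : Prop := forall Phi Psi w,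
  (forall u, size u = (size w + k)%N -> Phi u = Psi u) -> A Phi w = A Psi w.

Lemma lowers1 : lowers 1 0.
Proof. by move=> Phi Psi w h; apply: h; rewrite addn0. Qed.

Lemma lowers_mul A B k l : lowers A k -> lowers B l -> lowers (A * B) (k + l).
Proof.
move=> hA hB Phi Psi w h; rewrite !tensor_end_mulE; apply: hA => u uE.
by apply: hB => v vE; apply: h; rewrite vE uE addnA.
Qed.

Lemma lowers_sum I (r : seq I) (P : pred I) (F : I -> tensor_end R d) k :
  (forall i, P i -> lowers (F i) k) -> lowers (\sum_(i <- r | P i) F i) k.
Proof.
move=> h Phi Psi w e; rewrite !tensor_end_sumE; apply: eq_bigr => i Pi.
by apply: h.
Qed.

Lemma lowers_twist k : lowers (t k) 0.
Proof. by move=> Phi Psi w h; apply: twist_at_local => u uE; apply: h; rewrite addn0. Qed.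

Lemma lowers_cap k : lowers (cc k) 2.
Proof. by move=> Phi Psi w h; apply: cap_local => u uE; apply: h; rewrite addn2. Qed.

Lemma lowers_braid i j : lowers (TT i j) 0.
Proof.
rewrite /braid_product; elim: (index_iota i j) => [|k r IH]; first by rewrite big_nil; exact: lowers1.
by rewrite big_cons; exact: (lowers_mul (lowers_twist k) IH).
Qed.

Lemma lowers_pair_last s r m : lowers (L s r m) 2.
Proof. by apply: lowers_sum => k _; exact: (lowers_mul (lowers_cap k) (lowers_braid _ _)). Qed.

Lemma lowers_pair_right s r m : lowers (G s r m) (m.*2).
Proof.
elim: m r => [|m IH] r; first exact: lowers1.
by rewrite doubleS -addn2; exact: (lowers_mul (IH _) (lowers_pair_last _ _ _)).
Qed.

(* B is A moved one leg to the right. *)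
Definition shifts A B : Prop := forall Phi x w, B Phi (x :: w) = A (fun v => Phi (x :: v)) w.

Lemma shifts1 : shifts 1 1.
Proof. by []. Qed.

Lemma shifts_mul A A' B B' : shifts A A' -> shifts B B' -> shifts (A * B) (A' * B').
Proof.
move=> hA hB Phi x w; rewrite !tensor_end_mulE hA; congr (A _ w).
by apply/funext => v; rewrite hB.
Qed.

Lemma shifts_sum_nat m n (F F' : nat -> tensor_end R d) : (forall i, shifts (F i) (F' i.+1)) ->
  shifts (\sum_(m <= i < n) F i) (\sum_(m.+1 <= i < n.+1) F' i).
Proof.
move=> h Phi x w; rewrite big_add1 /= !tensor_end_sumE; apply: eq_bigr => i _; exact: h.
Qed.

Lemma shifts_twist k : shifts (t k) (t k.+1). Proof. by []. Qed.
Lemma shifts_cap k : shifts (cc k) (cc k.+1). Proof. by []. Qed.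

Lemma shifts_braid i j : shifts (TT i j) (TT i.+1 j.+1).
Proof.
rewrite /braid_product big_add1 /=.
elim: (index_iota i j) => [|k r IH]; first by rewrite !big_nil; exact: shifts1.
by rewrite !big_cons; exact: (shifts_mul (shifts_twist k) IH).
Qed.

Lemma shifts_pair_last s r m : shifts (L s r m) (L s.+1 r.+1 m).
Proof.
apply: shifts_sum_nat => k; rewrite addSn.
exact: (shifts_mul (shifts_cap k) (shifts_braid _ _)).
Qed.

Lemma shifts_pair_right s r m : shifts (G s r m) (G s.+1 r.+1 m).
Proof.
elim: m r => [|m IH] r; first exact: shifts1.
case: r => [|r].
  rewrite /= (_ : L s.+1 1 m.+1 = 0); last by rewrite /pair_last big_geq.
  rewrite (_ : L s 0 m.+1 = 0); last by rewrite /pair_last big_geq.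
  by rewrite !mulr0.
exact: (shifts_mul (IH _) (shifts_pair_last _ _ _)).
Qed.

Lemma braid_catr i j Phi w v : (j < size w)%N -> 
  TT i j Phi (w ++ v) = TT i j (fun u => Phi (u ++ v)) w.
Proof.
rewrite /braid_product => jw.
have : all (fun k => k < j)%N (index_iota i j).
  by apply/allP => k; rewrite mem_index_iota => /andP[].
elim: (index_iota i j) w jw => [|k r IH] w jw /=; first by rewrite !big_nil.
move=> /andP[kj ar]; rewrite !big_cons !tensor_end_mulE /=.
rewrite twist_at_catr; last by lia.
by apply: twist_at_local => u uE; apply: IH; rewrite ?uE.
Qed.

Lemma pair_first_catr Phi w v :
  pair_first t cc (size w).+2 Phi (w ++ v) =
  pair_first t cc (size w).+2 (fun u => Phi (u ++ v)) w.
Proof.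
rewrite /pair_first !tensor_end_sumE big_nat [RHS]big_nat; apply: eq_bigr => j /andP[j1 j2].
rewrite !tensor_end_mulE /= cap_catr //; apply: cap_local => u uE.
by apply: braid_catr; rewrite uE.
Qed.

End LegLocality.

Section Derivation.
Context (R : realType) (V : vectType R[i]) (dot : {dot V for Num.conj}).
Local Notation ip := (ip dot).
Context (d : nat) (b : 'I_d -> V) (T : 'M[R[i]]_(d * d)).
Local Notation tensor := (tensor R d).
Local Notation tensor_op := (tensor_op R d).
Implicit Types (Phi Psi : tensor) (a : R[i]) (x y : V).
Context (hb : orthonormal_basis dot b).
Variable (S : V -> V).
Hypothesis Santi : forall a x y, S (a *: x + y) = (a^*)%C *: S x + S y.
Local Notation c := (fun i j : 'I_d => ip (S (b i)) (b j)).
Hypotheses (br : braided T) (cr : cap_crossing T c).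
Local Notation t := (twist_end T).
Local Notation cc := (cap_end c).
Local Notation G := (pair_right t cc).
Local Notation Ann := (pair_first t cc).
Local Notation create := (creation dot b).
Local Notation annih := (annihilate dot b T).
Local Notation field := (explicit_field dot b T S).

Lemma antilinear0 : S 0 = 0.
Proof.
by have := Santi (-1) 0 0; rewrite scaler0 addr0 rmorphN1 scaleN1r addNr.
Qed.

Lemma cap_vec x (j : 'I_d) : \sum_(i < d) c i j * ip (b i) x = (ip (b j) (S x))^*%C.
Proof.
rewrite -ip_conj [in RHS](basis_expansion hb x).
elim: (index_enum _) => [|i r IH]; first by rewrite !big_nil antilinear0 ip0l.
by rewrite !big_cons Santi ipDl ipZl conjcK IH mulrC.
Qed.

Lemma annihilateE x Phi w : annih (S x) Phi w = Ann (size w).+2 (create x Phi) w.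
Proof.
have term j : (cc 0 * braid_product t 1 j.+1 : tensor_end R d) (create x Phi) w =
    \sum_(i < d) \sum_(k < d) c i k * (ip (b i) x * braid_product t 0 j Phi (k :: w)).
  rewrite tensor_end_mulE /= -[w]cat0s capE //=.
  apply: eq_bigr => i _; apply: eq_bigr => k _; congr (_ * _).
  rewrite (shifts_braid T 0 j).
  have := tensor_end_scale (braid_product t 0 j) (ip (b i) x) Phi.
  by move=> /(congr1 (fun F => F (k :: w))).
rewrite /pair_first tensor_end_sumE big_add1 /=.
rewrite [RHS](eq_bigr _ (fun j _ => term j)).
under [RHS]eq_bigr do rewrite exchange_big.
rewrite [RHS]exchange_big; apply: eq_bigr => k _.
rewrite -cap_vec /creation_sum tensor_end_sumE mulr_sumr; apply: eq_bigr => j _ /=.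
by rewrite mulr_suml; apply: eq_bigr => i _; rewrite mulrA.
Qed.

Definition derivation_sum (N : nat) Phi : tensor := fun w =>
  \sum_(0 <= m < N) (-1) ^+ m * G 0 ((size w).-1 + m) m Phi w.
Local Notation D := derivation_sum.

Lemma pair_right_overflow m : G 0 m m.+1 = 0.
Proof.
elim: m => [|m IH]; first by rewrite /= /pair_last big_geq ?mulr0.
by rewrite [LHS]/= -/(G 0 m m.+1) IH mul0r.
Qed.

Lemma lowers_pair_first E : lowers (Ann E) 2.
Proof.
apply: lowers_sum => j _; exact: (lowers_mul (lowers_cap c 0) (lowers_braid T _ _)).
Qed.

Lemma lowers_eq0 (A : tensor_end R d) k Phi w : lowers A k ->
  (forall u, size u = (size w + k)%N -> Phi u = 0) -> A Phi w = 0.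
Proof. by move=> h e; rewrite (h _ (fun=> 0)) ?tensor_end_zero. Qed.

Lemma pair_right_create s r m x Phi i w :
  G s.+1 r.+1 m (create x Phi) (i :: w) = ip (b i) x * G s r m Phi w.
Proof.
rewrite (shifts_pair_right T c s r m).
by have /(congr1 (fun F => F w)) := tensor_end_scale (G s r m) (ip (b i) x) Phi.
Qed.

Lemma annihilate_support N x Phi : (forall w, (N <= size w)%N -> Phi w = 0) ->
  forall w, (N <= size w)%N -> annih (S x) Phi w = 0.
Proof.
move=> z w Nw; rewrite annihilateE; apply: (lowers_eq0 (@lowers_pair_first _)) => -[|i u] //.
by rewrite addn2 /= => -[un]; rewrite z ?mulr0 // un leqW.
Qed.

Lemma derivation_sum_support N Phi w : (forall w, (N <= size w)%N -> Phi w = 0) ->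
  D N.+1 Phi w = D N Phi w.
Proof.
move=> z; rewrite /D big_nat_recr //= (lowers_eq0 (@lowers_pair_right _ _ T c 0 _ N)) ?mulr0 ?addr0 //.
by move=> u uE; apply: z; rewrite uE -addnn; lia.
Qed.

Lemma derivation_sum_field N x Phi w (y : 'I_d) : (forall w, (N <= size w)%N -> Phi w = 0) ->
  D N.+1 (field x Phi) (rcons w y) =
  field x (fun u => D N Phi (rcons u y)) w + @vacuum R d w * (ip (b y) x * Phi [::]).
Proof.
move=> z.
have -> : D N.+1 (field x Phi) (rcons w y) =
    D N.+1 (create x Phi) (rcons w y) + D N (annih (S x) Phi) (rcons w y).
  rewrite -(derivation_sum_support _ (annihilate_support x z)) /D -big_split.
  apply: eq_bigr => m _ /=; rewrite -mulrDr; congr (_ * _).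
  have := tensor_end_linear (G 0 ((size (rcons w y)).-1 + m) m) 1 (create x Phi) (annih (S x) Phi).
  move=> /(congr1 (fun F => F (rcons w y))); rewrite mul1r => <-.
  by congr (_ _ _); apply/funext => u; rewrite mul1r.
rewrite {1}/D size_rcons [_.-1]/=.
rewrite big_nat_recl // expr0 mul1r.
have rec m : G 0 (size w + m).+1 m.+1 (create x Phi) (rcons w y) =
    G 1 (size w + m).+1 m.+1 (create x Phi) (rcons w y)
    - Ann (size w).+2 (fun u => G 1 (size w + m).+2 m (create x Phi) (rcons u y)) w
    + G 0 (size w + m) m (annih (S x) Phi) (rcons w y).
  have := pair_right_recursion (@twist_end_far _ _ T) (@cap_twist_right _ _ T c)
    (@cap_twist_left _ _ T c) (@cap_far _ _ c) (twist_end_braid br)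
    (cap_twist_crossing cr) (size w) m.
  move=> /(congr1 (fun F : tensor_end R d => F (create x Phi) (rcons w y))) ->.
  rewrite !tensor_end_addE tensor_end_oppE !tensor_end_mulE; congr (_ - _ + _).
    rewrite -cats1 pair_first_catr; congr (Ann _ _ w).
    by apply/funext => u; rewrite cats1.
  apply: (lowers_pair_right T c) => u uE; rewrite annihilateE uE size_rcons.
  by rewrite addSn.
have hC : \sum_(0 <= m < N) (-1) ^+ m * G 0 (size w + m) m (annih (S x) Phi) (rcons w y) =
    D N (annih (S x) Phi) (rcons w y) by rewrite /D size_rcons.
have hB : \sum_(0 <= m < N) (-1) ^+ m *
      Ann (size w).+2 (fun u => G 1 (size w + m).+2 m (create x Phi) (rcons u y)) w =
    annih (S x) (fun u => D N Phi (rcons u y)) w.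
  rewrite annihilateE.
  have := tensor_end_sum (Ann (size w).+2) (index_iota 0 N) xpredT (fun m => (-1) ^+ m)
    (fun m u => G 1 (size w + m).+2 m (create x Phi) (rcons u y)).
  move=> /(congr1 (fun F => F w)) <-.
  apply: (@lowers_pair_first _) => -[|i u] //; first by rewrite addn2.
  rewrite addn2 /= => -[uE]; rewrite /D mulr_sumr; apply: eq_bigr => m _.
  by rewrite pair_right_create size_rcons uE mulrCA.
have hA : create x Phi (rcons w y) - \sum_(0 <= m < N) (-1) ^+ m *
      G 1 (size w + m).+1 m.+1 (create x Phi) (rcons w y) =
    create x (fun u => D N Phi (rcons u y)) w + @vacuum R d w * (ip (b y) x * Phi [::]).
  case: w rec hC hB => [|i w] _ _ _.
    rewrite big1 => [|m _]; last first.
      by rewrite [rcons _ _]/= pair_right_create add0n pair_right_overflow mulr0 mulr0.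
    by rewrite subr0 /= add0r mul1r.
  rewrite [vacuum _]/= mul0r addr0 rcons_cons [creation _ _ _ _ (_ :: w)]/= -(derivation_sum_support _ z).
  rewrite [creation _ _ _ _ _]/= /D size_rcons [_.-1]/= [size (_ :: _)]/=.
  rewrite big_nat_recl // expr0 mul1r addn0 mulrDr mulr_sumr -sumrN; congr (_ + _).
  by apply: eq_bigr => m _; rewrite pair_right_create addnS addSn exprS; ring.
have hS : \sum_(0 <= m < N) (-1) ^+ m.+1 * G 0 (size w + m.+1) m.+1 (create x Phi) (rcons w y) =
    - (\sum_(0 <= m < N) (-1) ^+ m * G 1 (size w + m).+1 m.+1 (create x Phi) (rcons w y))
    + \sum_(0 <= m < N) (-1) ^+ m *
      Ann (size w).+2 (fun u => G 1 (size w + m).+2 m (create x Phi) (rcons u y)) w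
    - \sum_(0 <= m < N) (-1) ^+ m * G 0 (size w + m) m (annih (S x) Phi) (rcons w y).
  have add3 (F A B C : nat -> R[i]) : (forall m, F m = - A m + B m - C m) ->
      \sum_(0 <= m < N) F m = - (\sum_(0 <= m < N) A m) + \sum_(0 <= m < N) B m
        - \sum_(0 <= m < N) C m.
    by move=> h; rewrite -!sumrN -!big_split; apply: eq_bigr => m _; rewrite h.
  by apply: add3 => m; rewrite addnS rec exprS; ring.
rewrite hS -[G 0 (size w + 0) 0 _ _]/(create x Phi (rcons w y)) hC hB.
by rewrite /explicit_field [RHS]addrAC -hA; ring.
Qed.

End Derivation.

Section WordVectors.
Context (R : realType) (V : vectType R[i]) (dot : {dot V for Num.conj}).
Local Notation ip := (ip dot).
Context (d : nat) (b : 'I_d -> V) (T : 'M[R[i]]_(d * d)).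
Local Notation tensor := (tensor R d).
Implicit Types (Phi Psi : tensor) (a : R[i]) (x y : V).
Context (hb : orthonormal_basis dot b).
Variable (S : V -> V).
Hypothesis Santi : forall a x y, S (a *: x + y) = (a^*)%C *: S x + S y.
Local Notation c := (fun i j : 'I_d => ip (S (b i)) (b j)).
Hypotheses (br : braided T) (cr : cap_crossing T c).
Local Notation t := (twist_end T).
Local Notation cc := (cap_end c).
Local Notation G := (pair_right t cc).
Local Notation field := (explicit_field dot b T S).
Local Notation D := (derivation_sum dot b T S).
Variable e : 'I_d -> V.

Definition word_vector (u : seq 'I_d) : tensor :=
  foldr (fun j Psi => field (e j) Psi) (@vacuum R d) u.

Lemma word_vector_support u w : (size u < size w)%N -> word_vector u w = 0.
Proof.
elim: u w => [|j u IH] w uw; first by case: w uw.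
have z w' : ((size u).+1 <= size w')%N -> word_vector u w' = 0 by exact: IH.
rewrite /= /explicit_field -/(word_vector u) (annihilate_support T hb Santi (e j) z) ?addr0; last by apply: ltnW.
by case: w uw => [|i w] //= uw; rewrite IH ?mulr0.
Qed.

Lemma word_vector_derivation u w (y i : 'I_d) :
  D (size u).+1 (word_vector u) (rcons w y) =
  \sum_(m < size u) ip (b y) (e (nth i u m)) * (word_vector (take m u) w *
      word_vector (drop m.+1 u) [::]).
Proof.
elim: u w => [|j u IH] w; first by rewrite big_ord0 /derivation_sum big_nat1 mul1r; case: w.
rewrite [word_vector _]/= (derivation_sum_field hb Santi br cr); last exact: word_vector_support.
have -> : field (e j) (fun v => D (size u).+1 (word_vector u) (rcons v y)) w =
    \sum_(m < size u) ip (b y) (e (nth i u m)) * (word_vector (take m.+1 (j :: u)) w *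
      word_vector (drop m.+1 u) [::]).
  pose F : tensor_end R d := TensorEnd (field_linear dot b T S (e j)).
  have := tensor_end_sum F (index_enum _) xpredT
    (fun m : 'I_(size u) => ip (b y) (e (nth i u m)) * word_vector (drop m.+1 u) [::])
    (fun m => word_vector (take m u)).
  rewrite (_ : (fun v => _) = fun v => D (size u).+1 (word_vector u) (rcons v y)).
    by move=> /(congr1 (fun G => G w)) /= ->; apply: eq_bigr => m _; rewrite mulrAC mulrA.
  by apply/funext => v; rewrite IH; apply: eq_bigr => m _; rewrite mulrAC mulrA.
rewrite big_ord_recl take0 [drop _ _]/= drop0 [nth _ _ _]/= addrC; congr (_ + _).
by rewrite mulrCA.
Qed.

Lemma word_vector_conjugate u x i :
  \sum_(0 <= m < (size u).+1) (-1) ^+ m *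
    \sum_(y < d) (ip (b y) x)^*%C * G 0 m m (word_vector u) [:: y] =
  \sum_(m < size u) ip x (e (nth i u m)) * (word_vector (take m u) [::] *
      word_vector (drop m.+1 u) [::]).
Proof.
transitivity (\sum_(y < d) (ip (b y) x)^*%C * D (size u).+1 (word_vector u) (rcons [::] y)).
  under eq_bigr do rewrite mulr_sumr.
  rewrite exchange_big; apply: eq_bigr => y _.
  by rewrite /derivation_sum mulr_sumr; apply: eq_bigr => m _; rewrite mulrCA.
under eq_bigr do rewrite (word_vector_derivation _ _ _ i) mulr_sumr.
rewrite exchange_big; apply: eq_bigr => m _ /=.
rewrite (ip_expansion hb x) mulr_suml; apply: eq_bigr => y _.
by rewrite mulrA -ip_conj.
Qed.

End WordVectors.

Section Relabel.
Implicit Types (s : seq (nat * nat)) (U V W : nat * nat).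
Local Open Scope nat_scope.

Definition remove2 V m := m - ((V.1 < m) + (V.2 < m)).
Definition relabel V s := [seq (remove2 V U.1, remove2 V U.2) | U <- s].

Lemma size_relabel V s : size (relabel V s) = size s.
Proof. by rewrite size_map. Qed.

Definition endpoints s := [seq U.1 | U <- s] ++ [seq U.2 | U <- s].

Lemma endpoints_cons V s : perm_eq (endpoints (V :: s)) (V.1 :: V.2 :: endpoints s).
Proof. by rewrite /endpoints /= perm_cons -cat1s perm_catCA. Qed.

Lemma endpoints_perm s s' : perm_eq s s' -> perm_eq (endpoints s) (endpoints s').
Proof. by move=> h; apply: perm_cat; apply: perm_map. Qed.

Lemma mem_endpoints U s : U \in s -> (U.1 \in endpoints s) && (U.2 \in endpoints s).
Proof.
move=> h; rewrite !mem_cat (map_f (fun U => U.1) h) /=.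
by rewrite (map_f (fun U => U.2) h) orbT.
Qed.

Lemma uniq_endpoints_cons V s : uniq (endpoints (V :: s)) =
  [&& V.1 != V.2, V.1 \notin endpoints s, V.2 \notin endpoints s & uniq (endpoints s)].
Proof. by rewrite (perm_uniq (endpoints_cons V s)) /= inE negb_or -andbA. Qed.

Lemma remove2_mono V a b : V.1 != V.2 -> a != V.1 -> a != V.2 -> b != V.1 -> b != V.2 ->
  (remove2 V a < remove2 V b) = (a < b).
Proof. by case: V => i j /=; rewrite /remove2 /=; lia. Qed.

Lemma remove2_comm i j k M m : i < k < j -> j < M ->
  m != i -> m != j -> m != k -> m != M ->
  remove2 (remove2 (i, j) k, remove2 (i, j) M) (remove2 (i, j) m) =
  remove2 (remove2 (k, M) i, remove2 (k, M) j) (remove2 (k, M) m).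
Proof.
move=> /andP[ik kj] jM mi mj mk mM.
have -> : remove2 (i, j) k = k.-1 by rewrite /remove2 /=; lia.
have -> : remove2 (i, j) M = M.-2 by rewrite /remove2 /=; lia.
have -> : remove2 (k, M) i = i by rewrite /remove2 /=; lia.
have -> : remove2 (k, M) j = j.-1 by rewrite /remove2 /=; lia.
rewrite /remove2 /=.
case: (ltnP i m) => h1; case: (ltnP j m) => h2; case: (ltnP k m) => h3; case: (ltnP M m) => h4;
  try (exfalso; clear - ik kj jM h1 h2 h3 h4; lia); rewrite /= ?subn0;
  do 4 (case: ltnP => ?); lia.
Qed.

Lemma remove2_ltn V a b : V.1 != V.2 -> remove2 V a < remove2 V b -> a < b.
Proof. by case: V => i j /=; rewrite /remove2 /=; lia. Qed.

Lemma endpoints_relabel V s : endpoints (relabel V s) = map (remove2 V) (endpoints s).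
Proof. by rewrite /endpoints map_cat -!map_comp. Qed.

Lemma uniq_endpoints_relabel V s :
  uniq (endpoints (V :: s)) -> uniq (endpoints (relabel V s)).
Proof.
rewrite uniq_endpoints_cons => /and4P[V12 V1 V2 us].
rewrite endpoints_relabel map_inj_in_uniq // => a b ain bin e.
have nV x : x \in endpoints s -> (x != V.1) && (x != V.2).
  by move=> xs; apply/andP; split; [apply: contraNneq V1|apply: contraNneq V2] => <-.
move: (nV _ ain) (nV _ bin) => /andP[a1 a2] /andP[b1 b2].
by have := remove2_mono V12 a1 a2 b1 b2; have := remove2_mono V12 b1 b2 a1 a2; rewrite e ltnn; lia.
Qed.

End Relabel.

Section MatchingOperators.
Variables (A : pzRingType) (t c : nat -> A).
Hypothesis t_far : forall i j, (i.+1 < j)%N -> t i * t j = t j * t i.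
Hypothesis c_t_right : forall i j, (i <= j)%N -> c i * t j.+2 = t j * c i.
Hypothesis c_t_left : forall i j, (j.+1 < i)%N -> c i * t j = t j * c i.
Hypothesis c_far : forall i j, (i <= j)%N -> c i * c j.+2 = c j * c i.
Hypothesis t_braid : forall i, t i * t i.+1 * t i = t i.+1 * t i * t i.+1.
Hypothesis c_t_cross : forall i, c i * t i.+1 = c i.+1 * t i.
Implicit Types (s : seq (nat * nat)) (U V W : nat * nat).
Local Notation T := (braid_product t).
Local Notation G := (pair_right t c).

Definition pair_op V : A := c V.1 * T V.1.+1 V.2.

Fixpoint matching_op n s : A :=
  if n is n'.+1 then
    if s is V :: s' then matching_op n' (relabel V s') * pair_op V else 1
  else 1.

Arguments matching_op : simpl never.

Lemma matching_op_cons n V s :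
  matching_op n.+1 (V :: s) = matching_op n (relabel V s) * pair_op V.
Proof. by []. Qed.

Lemma pair_op_swap i j k M : (i < k < j)%N -> (j < M)%N ->
  pair_op (remove2 (i, j) k, remove2 (i, j) M) * pair_op (i, j) =
  pair_op (remove2 (k, M) i, remove2 (k, M) j) * pair_op (k, M).
Proof.
move=> ikj jM.
have [k' [M' [kE ME]]] : exists k' M', k = k'.+1 /\ M = M'.+2 by exists k.-1, M.-2; lia.
have -> : remove2 (i, j) k = k' by rewrite /remove2 /=; lia.
have -> : remove2 (i, j) M = M' by rewrite /remove2 /=; lia.
have -> : remove2 (k, M) i = i by rewrite /remove2 /=; lia.
have -> : remove2 (k, M) j = j.-1 by rewrite /remove2 /=; lia.
by rewrite /pair_op /= kE ME; apply: pair_swap_crossing => //; lia.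
Qed.

Lemma matching_op_pull n s1 V s2 : size (s1 ++ s2) = n ->
  uniq (endpoints (s1 ++ V :: s2)) ->
  (forall U, U \in s1 -> (U.1 < V.1 < U.2)%N && (U.2 < V.2)%N) ->
  matching_op n.+1 (s1 ++ V :: s2) = matching_op n (relabel V (s1 ++ s2)) * pair_op V.
Proof.
elim: n s1 V s2 => [|n IH] [|U s1] V s2 //= [sz] us cross.
have := cross U (mem_head _ _); case: U us cross => i j; case: V => k M us cross /= /andP[ikj jM].
set V := (k, M) in us cross *.
have p : perm_eq (V :: (i, j) :: s1 ++ s2) ((i, j) :: s1 ++ V :: s2).
  by rewrite -cat1s -[X in _ ++ X]cat_cons perm_catCA.
have : uniq (endpoints ((i, j) :: s1 ++ V :: s2)) by exact: us.
rewrite -(perm_uniq (endpoints_perm p)) !uniq_endpoints_cons /=.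
move=> /and4P[kM kn Mn /and4P[ij In Jn _]].
have far W : W \in s1 ++ s2 -> forall m, (m == W.1) || (m == W.2) ->
    [&& m != i, m != j, m != k & m != M].
  move=> Ws m mW.
  have me : m \in endpoints (s1 ++ s2).
    by have /andP[h1 h2] := mem_endpoints Ws; case/orP : mW => /eqP ->.
  have me' : m \in endpoints ((i, j) :: s1 ++ s2).
    by rewrite (perm_mem (endpoints_cons _ _)) !inE me !orbT.
  apply/and4P; split; [apply: contraNneq In|apply: contraNneq Jn
    |apply: contraNneq kn|apply: contraNneq Mn] => <- //.
have e12 : relabel (i, j) (s1 ++ V :: s2) = relabel (i, j) s1 ++
    (remove2 (i, j) k, remove2 (i, j) M) :: relabel (i, j) s2.
  by rewrite /relabel map_cat.
rewrite matching_op_cons e12 IH.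
- rewrite [relabel V _]/= matching_op_cons -[LHS]mulrA pair_op_swap // mulrA; congr (matching_op n _ * _ * _).
  rewrite /relabel -map_cat -!map_comp; apply/eq_in_map => W Ws /=.
  have := far _ Ws W.1; rewrite eqxx => /(_ isT)/and4P[a1 a2 a3 a4].
  have := far _ Ws W.2; rewrite eqxx orbT => /(_ isT)/and4P[b1 b2 b3 b4].
  by congr pair; apply: remove2_comm.
- by rewrite size_cat !size_relabel -size_cat.
- by rewrite -e12; exact: uniq_endpoints_relabel.
move=> _ /mapP[W Ws ->] /=.
have Ws' : W \in s1 ++ s2 by rewrite mem_cat Ws.
have := far _ Ws' W.1; rewrite eqxx => /(_ isT)/and4P[a1 a2 a3 a4].
have := far _ Ws' W.2; rewrite eqxx orbT => /(_ isT)/and4P[b1 b2 b3 b4].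
have := cross W; rewrite inE Ws orbT => /(_ isT).
move=> /= /andP[/andP[h1 h2] h3]; have ki : k != i by move: ikj; clear; lia.
have kj : k != j by move: ikj; clear; lia.
have Mi : M != i by move: ikj jM; clear; lia.
have Mj : M != j by move: jM; clear; lia.
by rewrite !remove2_mono // h1 h2 h3.
Qed.

Definition perm_pairs n (sigma : 'S_n) : seq (nat * nat) :=
  [seq (val (sigma m), (n.+1 + m)%N) | m <- enum 'I_n].

Definition outer_first s : bool :=
  pairwise (fun U V => ~~ ((V.1 < U.1) && (U.2 < V.2))%N) s.

Lemma perm_pairs_lift n k (tau : 'S_n) :
  perm_pairs (lift_perm ord_max k tau) =
  rcons [seq (bump k (tau m), (n.+2 + m)%N) | m <- enum 'I_n] (val k, (n.+2 + n)%N).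
Proof.
rewrite /perm_pairs enum_ordSr map_rcons -map_comp lift_perm_id; congr rcons.
apply: eq_map => m /=; congr (_, _).
have -> : widen_ord (leqnSn n) m = lift ord_max m by apply: val_inj; rewrite /= /bump leqNgt ltn_ord.
by rewrite lift_perm_lift.
Qed.

Lemma perm_pairs_uniq n (sigma : 'S_n) : uniq (endpoints (perm_pairs sigma)).
Proof.
have u1 : uniq [seq U.1 | U <- perm_pairs sigma].
  rewrite -map_comp map_inj_uniq ?enum_uniq // => m m' /= /val_inj; exact: perm_inj.
have u2 : uniq [seq U.2 | U <- perm_pairs sigma].
  rewrite -map_comp map_inj_uniq ?enum_uniq // => m m' /= /addnI; exact: val_inj.
rewrite /endpoints cat_uniq u1 u2 andbT /=; apply/hasPn => _ /mapP[_ /mapP[m _ ->] ->] /=.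
apply/negP => /mapP[_ /mapP[m' _ ->] /= e].
by have := ltn_ord (sigma m'); rewrite -e; clear; lia.
Qed.

Lemma relabel_last_pair n (k : 'I_n.+1) (tau : 'S_n) :
  relabel (val k, (n.+2 + n)%N) [seq (bump k (tau m), (n.+2 + m)%N) | m <- enum 'I_n] =
  perm_pairs tau.
Proof.
rewrite /relabel /perm_pairs -map_comp; apply: eq_map => m /=.
have := ltn_ord m; have := ltn_ord (tau m); have := ltn_ord k.
by move=> kn tn mn; congr (_, _); rewrite /remove2 /bump /=; lia.
Qed.

Lemma sum_matching_op n (s : 'S_n -> seq (nat * nat)) :
  (forall sigma, perm_eq (s sigma) (perm_pairs sigma) && outer_first (s sigma)) ->
  \sum_sigma matching_op n (s sigma) = G 0 n n.
Proof.
elim: n s => [|n IH] s hs.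
  by rewrite (big_pred1 1%g) // => sigma /=; apply/esym/eqP/permP => -[].
pose ext (p : 'I_n.+1 * 'S_n) : 'S_n.+1 := lift_perm ord_max p.1 p.2.
have ext_bij : bijective ext.
  apply: inj_card_bij => [[k tau] [k' tau']|]; first rewrite /ext /= => e.
    have ek : k = k' by rewrite -(lift_perm_id ord_max k tau) -(lift_perm_id ord_max k' tau') e.
    subst k'; congr (_, _); apply/permP => m; apply: (@lift_inj _ k).
    by rewrite -!(lift_perm_lift ord_max) e.
  by rewrite card_prod card_ord !card_Sn.
rewrite (reindex ext) /=; last exact: onW_bij.
rewrite -(pair_big xpredT xpredT (fun k tau => matching_op n.+1 (s (lift_perm ord_max k tau)))) /=.
have rest k tau : exists s', [/\ perm_eq s' (perm_pairs tau), outer_first s' &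
    matching_op n.+1 (s (lift_perm ord_max k tau)) =
    matching_op n s' * pair_op (val k, (n.+2 + n)%N)].
  have /andP[] := hs (lift_perm ord_max k tau); set s0 := s _ => sp so.
  set V := (val k, _).
  have us := perm_pairs_uniq (lift_perm ord_max k tau).
  rewrite -(perm_uniq (endpoints_perm sp)) in us.
  rewrite perm_pairs_lift -/V in sp; set L := [seq _ | m <- _] in sp.
  have Vs : V \in s0 by rewrite (perm_mem sp) mem_rcons mem_head.
  case/splitPr: Vs us sp so => s1 s2 us sp so.
  have sp' : perm_eq (s1 ++ s2) L.
    rewrite -(perm_cons V); apply: perm_trans (_ : perm_eq _ (rcons L V)) _; last by rewrite perm_rcons.
    by apply: perm_trans sp; rewrite -cat1s perm_catCA.
  have lastV U : U \in s1 ++ s2 -> [&& U.2 < n.+2 + n, n < U.2 & U.1 != k]%N.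
    rewrite (perm_mem sp') => /mapP[m _ ->] /=; rewrite ltn_add2l ltn_ord /=.
    by rewrite /bump; case: leqP; lia.
  exists (relabel V (s1 ++ s2)); split.
  - by rewrite -(relabel_last_pair k tau); apply: perm_map.
  - rewrite /outer_first /relabel pairwise_map.
    have : outer_first (s1 ++ s2).
      apply: subseq_pairwise so; apply: cat_subseq => //; exact: subseq_cons.
    apply: sub_pairwise => U W; apply: contra => /andP[h1 h2].
    have V12 : V.1 != V.2 by rewrite /V /=; have := ltn_ord k; clear; lia.
    by rewrite (remove2_ltn V12 h1) (remove2_ltn V12 h2).
  apply: matching_op_pull => //.
    by rewrite (perm_size sp') size_map size_enum_ord.
  move=> U Us1; have /lastV/and3P[u1 u2 u3] : U \in s1 ++ s2 by rewrite mem_cat Us1.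
  move: so; rewrite /outer_first pairwise_cat => /and3P[/allrelP /(_ U V Us1 (mem_head _ _))].
  rewrite /V /= u1 andbT -leqNgt => h _ _.
  by have := ltn_ord k; move: h u1 u2 u3; clear; lia.
have choose k : exists s' : 'S_n -> seq (nat * nat), forall tau,
    [/\ perm_eq (s' tau) (perm_pairs tau), outer_first (s' tau) &
    matching_op n.+1 (s (lift_perm ord_max k tau)) =
    matching_op n (s' tau) * pair_op (val k, (n.+2 + n)%N)].
  by have [s' hs'] := choice (rest k); exists s'.
transitivity (\sum_(k < n.+1) G 0 n n * pair_op (val k, (n.+2 + n)%N)).
  apply: eq_bigr => k _; have [s' hs'] := choose k.
  rewrite -(IH s'); last by move=> tau; have [-> -> _] := hs' tau.
  by rewrite mulr_suml; apply: eq_bigr => tau _; have [_ _ ->] := hs' tau.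
rewrite -mulr_sumr [RHS]/= /pair_last big_mkord; congr (_ * _).
by apply: eq_bigr => k _; rewrite /pair_op /= addSnnS.
Qed.

End MatchingOperators.
Arguments matching_op {A} t c n s : simpl never.

Section MatchingContractions.
Context (R : realType) (V : vectType R[i]) (dot : {dot V for Num.conj}).
Local Notation ip := (ip dot).
Context (d : nat) (b : 'I_d -> V) (T : 'M[R[i]]_(d * d)) (S : V -> V).
Local Notation tensor := (tensor R d).
Implicit Types (Phi Psi : tensor) (U P : nat * nat) (s : seq (nat * nat)).
Local Notation c := (fun i j : 'I_d => ip (S (b i)) (b j)).
Local Notation t := (twist_end T).
Local Notation cc := (cap_end c).
Local Notation W := (W_rec dot b T S).

Lemma W_rec_relabel prev P s Phi : uniq (endpoints (P :: prev ++ s)) ->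
  W (rcons prev P) s Phi = W (relabel P prev) (relabel P s) Phi.
Proof.
elim: s prev Phi => [//|[i j] s IH] prev Phi us.
have us' : uniq (endpoints (P :: ((i, j) :: prev) ++ s)).
  have p : perm_eq (P :: prev ++ (i, j) :: s) (P :: ((i, j) :: prev) ++ s).
    by rewrite perm_cons -cat1s perm_catCA.
  by rewrite -(perm_uniq (endpoints_perm p)).
have red m : m \in endpoints ((i, j) :: s) ->
    (m - removed_below (rcons prev P) m)%N =
    (remove2 P m - removed_below (relabel P prev) (remove2 P m))%N.
  move=> ms; rewrite /remove2 -subnDA; congr (m - _)%N.
  rewrite /removed_below -cats1 big_cat big_seq1 /= addnC; congr (_ + _)%N.
  rewrite big_map; apply: eq_big_seq => U Up /=.
  have := us; rewrite uniq_endpoints_cons => /and4P[P12 P1 P2 _].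
  have nP x : x \in endpoints (prev ++ (i, j) :: s) -> (x != P.1) && (x != P.2).
    by move=> xs; apply/andP; split; [apply: contraNneq P1|apply: contraNneq P2] => <-.
  have Us : U \in prev ++ (i, j) :: s by rewrite mem_cat Up.
  have /andP[/nP/andP[u1 u2] /nP/andP[u3 u4]] := mem_endpoints Us.
  have /nP/andP[m1 m2] : m \in endpoints (prev ++ (i, j) :: s).
    move: ms; rewrite /endpoints !map_cat !mem_cat => /orP[] ->; by rewrite ?orbT.
  by rewrite !remove2_mono.
rewrite [LHS]/= [RHS]/= -!red; try by rewrite !(mem_cat, inE) /= ?inE eqxx ?orbT.
exact: (IH ((i, j) :: prev)).
Qed.

Definition succ_pair U := (U.1.+1, U.2.+1).

Lemma relabel_succ P s : P.1 != P.2 ->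
  relabel (succ_pair P) (map succ_pair s) = map succ_pair (relabel P s).
Proof.
move=> P12; rewrite /relabel -!map_comp; apply: eq_map => U.
by rewrite /= /succ_pair /remove2 /=; congr (_, _); clear - P12; lia.
Qed.

Lemma lowers_matching n s : size s = n -> lowers (matching_op t cc n s) (n.*2).
Proof.
elim: n s => [|n IH] [|P s] //=; first by move=> _; exact: lowers1.
move=> [sz].
rewrite doubleS -addn2 matching_op_cons.
apply: lowers_mul; first by apply: IH; rewrite size_relabel.
exact: (lowers_mul (lowers_cap c _) (lowers_braid T _ _)).
Qed.

Lemma contractionE i Phi (w : seq 'I_d) : (i <= size w)%N -> Defs.contraction dot b S i.+1 Phi w = cc i Phi w.
Proof. by move=> iw; rewrite /= /cap iw. Qed.

Lemma W_rec_matching n s Phi w : size s = n -> size w = 1%N -> uniq (endpoints s) ->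
  (forall U, U \in s -> (U.1 < n)%N) ->
  W [::] (map succ_pair s) Phi w = matching_op t cc n s Phi w.
Proof.
elim: n s Phi => [|n IH] [|[i j] s] Phi //.
move=> [sz] w1 us lt; rewrite [map _ _]/= [LHS]/=.
rewrite /removed_below !big_nil !subn0 matching_op_cons.
have ij : (i, j).1 != (i, j).2 by move: us; rewrite uniq_endpoints_cons => /and4P[].
rewrite -/(succ_pair (i, j)) -[[:: succ_pair _]]/(rcons [::] (succ_pair (i, j))) W_rec_relabel; last first.
  rewrite cat0s -[_ :: map _ _]/(map succ_pair ((i, j) :: s)).
  have -> : endpoints (map succ_pair ((i, j) :: s)) = map succn (endpoints ((i, j) :: s)).
    by rewrite /endpoints map_cat -!map_comp.
  by rewrite map_inj_uniq // => x y [].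
rewrite relabel_succ // IH //.
- rewrite tensor_end_mulE; apply: lowers_matching; first by rewrite size_relabel.
  move=> u uE; rewrite contractionE; last first.
    by rewrite uE w1 -addnn; have := lt _ (mem_head _ _); rewrite /=; clear; lia.
  rewrite /pair_op tensor_end_mulE; congr (cap _ _ _ _).
  by apply/funext => v; rewrite twist_prodE.
- by rewrite size_relabel.
- exact: uniq_endpoints_relabel.
move=> _ /mapP[U Us ->] /=.
have := lt _ (mem_head _ _); have := lt U; rewrite inE Us orbT => /(_ isT) /=.
have U1 : U.1 != i.
  move: us; rewrite uniq_endpoints_cons => /and4P[_ h _ _].
  by apply: contraNneq h => /= <-; have /andP[] := mem_endpoints Us.
rewrite /remove2 /=; move: (U.1) U1 => u; case: (ltnP i u); case: (ltnP j u) => _; rewrite /= => iu /eqP; lia.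
Qed.

End MatchingContractions.

Section PermMatchings.
Variable n : nat.
Local Notation m := (2 * n + 1)%N.
Implicit Types (sigma : 'S_n) (pi : {set {set 'I_m}}) (x y : 'I_m) (j k : 'I_n).

Definition left_leg j : 'I_m := @Ordinal m j ltac:(have := ltn_ord j; lia).
Definition centre_leg : 'I_m := @Ordinal m n ltac:(lia).
Definition right_leg j : 'I_m := @Ordinal m (n.+1 + j) ltac:(have := ltn_ord j; lia).

Variant leg_spec x : Prop :=
| LeftLeg j of x = left_leg j
| CentreLeg of x = centre_leg
| RightLeg j of x = right_leg j.

Lemma legP x : leg_spec x.
Proof.
have xm := ltn_ord x; case: (ltngtP x n) => h.
- by apply: (@LeftLeg _ (Ordinal h)); apply: val_inj.
- have h' : (x - n.+1 < n)%N by lia.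
  by apply: (@RightLeg _ (Ordinal h')); apply: val_inj => /=; lia.
- by apply: CentreLeg; apply: val_inj.
Qed.

Definition perm_block sigma j : {set 'I_m} := [set left_leg (sigma j); right_leg j]%SET.

Definition perm_matching sigma : {set {set 'I_m}} :=
  ([set perm_block sigma j | j : 'I_n] :|: [set [set centre_leg]])%SET.

Lemma left_leg_inj : injective left_leg.
Proof. by move=> j k /(congr1 val) /= /val_inj. Qed.

Lemma right_leg_inj : injective right_leg.
Proof. by move=> j k /(congr1 val) /= /addnI/val_inj. Qed.

Lemma left_centre j : (left_leg j == centre_leg) = false.
Proof. by apply/eqP => /(congr1 val) /=; have := ltn_ord j; lia. Qed.

Lemma left_right j k : (left_leg j == right_leg k) = false.
Proof. by apply/eqP => /(congr1 val) /=; have := ltn_ord j; lia. Qed.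

Lemma right_centre j : (right_leg j == centre_leg) = false.
Proof. by apply/eqP => /(congr1 val) /=; lia. Qed.

(* The block of x, as a fibre of a function. *)
Definition block_index sigma x : option 'I_n :=
  if insub (val x) is Some j then Some ((sigma^-1)%g j)
  else if (n < x)%N then insub (x - n.+1)%N else None.

Lemma block_index_left sigma j : block_index sigma (left_leg j) = Some ((sigma^-1)%g j).
Proof. by rewrite /block_index /= valK. Qed.

Lemma block_index_right sigma j : block_index sigma (right_leg j) = Some j.
Proof.
rewrite /block_index /= insubN; last by lia.
by rewrite leq_addr addKn valK.
Qed.

Lemma block_index_centre sigma : block_index sigma centre_leg = None.
Proof. by rewrite /block_index /= insubN ?ltnn. Qed.

Lemma mem_perm_block sigma j x : (x \in perm_block sigma j) = (block_index sigma x == Some j).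
Proof.
rewrite !inE; case: (legP x) => [k|//|k] ->.
- rewrite block_index_left left_right orbF (inj_eq left_leg_inj) [RHS](inj_eq Some_inj).
  by apply/eqP/eqP => [->|<-]; rewrite ?permK ?permKV.
- by rewrite block_index_centre eq_sym left_centre eq_sym right_centre.
by rewrite block_index_right eq_sym left_right (inj_eq right_leg_inj) [RHS](inj_eq Some_inj).
Qed.

Lemma mem_centre_block sigma x : (x \in [set centre_leg]%SET) = (block_index sigma x == None).
Proof.
rewrite !inE; case: (legP x) => [k|//|k] ->.
- by rewrite block_index_left left_centre.
- by rewrite block_index_centre !eqxx.
by rewrite block_index_right right_centre.
Qed.

Lemma perm_matchingP sigma (B : {set 'I_m}) : reflect
  ((exists j, B = perm_block sigma j) \/ B = [set centre_leg]%SET) (B \in perm_matching sigma).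
Proof.
rewrite /perm_matching !inE; apply: (iffP orP) => [[/imsetP[j _ ->]|/eqP ->]|[[j ->]|->]].
- by left; exists j.
- by right.
- by left; apply: imset_f.
by right.
Qed.

Lemma perm_matching_cover sigma x : exists2 B, B \in perm_matching sigma & x \in B.
Proof.
case e : (block_index sigma x) => [j|].
  by exists (perm_block sigma j); [apply/perm_matchingP; left; exists j|rewrite mem_perm_block e].
by exists [set centre_leg]%SET; [apply/perm_matchingP; right|rewrite (mem_centre_block sigma) e].
Qed.

Lemma perm_matching_trivial sigma (B C : {set 'I_m}) x :
  B \in perm_matching sigma -> C \in perm_matching sigma -> x \in B -> x \in C -> B = C.
Proof.
move=> /perm_matchingP[[j ->]|->] /perm_matchingP[[k ->]|->] //.
- by rewrite !mem_perm_block => /eqP -> /eqP[->].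
- by rewrite mem_perm_block (mem_centre_block sigma) => /eqP ->.
by rewrite mem_perm_block (mem_centre_block sigma) => /eqP ->.
Qed.

Lemma perm_matching_pair sigma x y : (x < y)%N ->
  reflect (exists j, x = left_leg (sigma j) /\ y = right_leg j)
    ([set x; y]%SET \in perm_matching sigma).
Proof.
move=> xy; apply: (iffP (perm_matchingP _ _)) => [[[j e]|e]|[j [-> ->]]]; last by left; exists j.
  have := set21 x y; have := set22 x y; rewrite e !inE.
  move=> /orP[] /eqP ye /orP[] /eqP xe; move: xy; rewrite ?xe ?ye ?ltnn //.
    by rewrite /=; have := ltn_ord (sigma j); lia.
  by move=> _; exists j.
have := set21 x y; have := set22 x y; rewrite e !inE => /eqP ye /eqP xe.
by move: xy; rewrite xe ye ltnn.
Qed.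

Lemma B_perm_matching sigma : B_matching (perm_matching sigma).
Proof.
apply/and3P; split.
- apply/andP; split.
    apply/and3P; split.
    + apply/eqP/setP => x; rewrite inE; have [B Bm xB] := perm_matching_cover sigma x.
      by apply/bigcupP; exists B.
    + apply/finset.trivIsetP => B C Bm Cm; apply: contraR => /pred0Pn[x /andP[xB xC]].
      by apply/eqP; exact: (perm_matching_trivial Bm Cm xB xC).
    apply/negP => /perm_matchingP[[j]|] /setP.
      by move=> /(_ (right_leg j)); rewrite !inE eqxx orbT.
    by move=> /(_ centre_leg); rewrite !inE eqxx.
  apply/forallP => B; apply/implyP => /perm_matchingP[[j]|] ->.
    by rewrite cards2; case: (_ != _).
  by rewrite cards1.
- by apply/existsP; exists centre_leg; rewrite eqxx; apply/perm_matchingP; right.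
apply/forallP => x; apply/implyP => xn; apply/existsP.
exists (right_leg ((sigma^-1)%g (Ordinal xn))); rewrite leq_addr.
apply/perm_matchingP; left; exists ((sigma^-1)%g (Ordinal xn)).
by rewrite /perm_block permKV; congr ([set _; _]%SET); apply: val_inj.
Qed.

Lemma perm_matching_inj : injective perm_matching.
Proof.
move=> sigma tau e; apply/permP => j.
have : perm_block sigma j \in perm_matching tau.
  by rewrite -e; apply/perm_matchingP; left; exists j.
move=> /perm_matchingP[[k]|] /setP h.
  have := h (right_leg j); rewrite !mem_perm_block !block_index_right eqxx => /esym/eqP[jk].
  subst k; have := h (left_leg (sigma j)).
  rewrite !mem_perm_block !block_index_left permK eqxx => /esym/eqP[] /(congr1 tau).
  by rewrite permKV.
have := h (right_leg j); rewrite mem_perm_block block_index_right eqxx.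
by rewrite (mem_centre_block sigma) block_index_right.
Qed.

Lemma B_matchingP pi : B_matching pi -> exists sigma, pi = perm_matching sigma.
Proof.
move=> /and3P[/andP[/and3P[/eqP cov /finset.trivIsetP triv no0] _] /existsP[z /andP[/eqP zn zpi]] /forallP hl].
have same (B C : {set 'I_m}) x : B \in pi -> C \in pi -> x \in B -> x \in C -> B = C.
  move=> Bm Cm xB xC; apply/eqP; apply: contraT => /(triv _ _ Bm Cm)/pred0P/(_ x) /=.
  by rewrite xB xC.
have ex k : exists j, [set left_leg k; right_leg j]%SET \in pi.
  have := hl (left_leg k); rewrite /= ltn_ord => /existsP[l /andP[nl lpi]].
  case: (legP l) nl lpi => [j ->|->|j ->] /=; rewrite ?ltnn //; last by exists j.
  by have := ltn_ord j; lia.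
have [g hg] := choice ex.
have ginj : injective g.
  move=> k k' e; have := hg k; have := hg k'; rewrite e => h' h.
  have := same _ _ (right_leg (g k')) h h'; rewrite !inE eqxx !orbT => /(_ isT isT)/setP/(_ (left_leg k)).
  by rewrite !inE eqxx !left_right !orbF => /esym/eqP; exact: left_leg_inj.
exists ((perm ginj)^-1)%g; set sigma := (_^-1)%g.
have sub (B : {set 'I_m}) : B \in perm_matching sigma -> B \in pi.
  move=> /perm_matchingP[[j ->]|->].
    rewrite /perm_block; have := hg (sigma j).
    by rewrite -(permE ginj) permKV.
  by rewrite (_ : centre_leg = z) //; apply: val_inj.
apply/setP => B; apply/idP/idP; last exact: sub.
move=> Bpi; have /set0Pn[x xB] : B != finset.set0 by apply: contraNneq no0 => <-.
have [C Cm xC] := perm_matching_cover sigma x.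
by rewrite (same _ _ x Bpi (sub _ Cm) xB xC).
Qed.

Lemma admissible_perm_pairs sigma s : admissible_order (perm_matching sigma) s ->
  let s' := [seq (val V.1, val V.2) | V <- s] in
  perm_eq s' (perm_pairs sigma) /\ outer_first s'.
Proof.
move=> [us ms ns]; split.
  have -> : perm_pairs sigma = [seq (val V.1, val V.2) |
      V <- [seq (left_leg (sigma j), right_leg j) | j <- enum 'I_n]].
    by rewrite -map_comp.
  apply/perm_map/uniq_perm => //.
    by rewrite map_inj_uniq ?enum_uniq // => j k /(congr1 snd); exact: right_leg_inj.
  move=> [x y]; rewrite ms /=; apply/andP/mapP => [[xy /(perm_matching_pair _ xy)[j [-> ->]]]|].
    by exists j; rewrite ?mem_enum.
  move=> [j _ [-> ->]]; have lr : (left_leg (sigma j) < right_leg j)%N.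
    by rewrite /=; have := ltn_ord (sigma j); lia.
  by split => //; apply/(perm_matching_pair _ lr); exists j.
rewrite /outer_first pairwise_map.
case: s us ms ns => [//|V0 s] us ms ns; set s0 := V0 :: s in us ms ns *.
apply/(pairwiseP V0) => i j /[!inE] il jl ij /=.
apply/negP => /andP[h1 h2].
have nis := mem_nth V0 il; have njs := mem_nth V0 jl.
have : nested (nth V0 s0 j) (nth V0 s0 i).
  by move: (nis); rewrite ms => /andP[h3 _]; rewrite /nested h1 h3 h2.
by move=> /(ns _ _ njs nis); rewrite !index_uniq //; lia.
Qed.

End PermMatchings.

Section SumOverMatchings.
Context (R : realType) (V : vectType R[i]) (dot : {dot V for Num.conj}).
Local Notation ip := (ip dot).
Context (d : nat) (b : 'I_d -> V) (T : 'M[R[i]]_(d * d)) (S : V -> V).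
Local Notation tensor := (tensor R d).
Local Notation c := (fun i j : 'I_d => ip (S (b i)) (b j)).
Hypotheses (br : braided T) (cr : cap_crossing T c).
Local Notation t := (twist_end T).
Local Notation cc := (cap_end c).

Lemma sum_W_op (ord : forall m, {set {set 'I_m}} -> seq ('I_m * 'I_m)) n (Phi : tensor) w :
  (forall m (pi : {set {set 'I_m}}), incomplete_matching pi -> admissible_order pi (ord m pi)) ->
  size w = 1%N ->
  \sum_(pi : {set {set 'I_(2 * n + 1)}} | B_matching pi) W_op dot b T S (ord _ pi) Phi w =
  pair_right t cc 0 n n Phi w.
Proof.
move=> hord w1.
pose s (sigma : 'S_n) := [seq (val U.1, val U.2) | U <- ord _ (perm_matching sigma)].
have hs sigma : perm_eq (s sigma) (perm_pairs sigma) && outer_first (s sigma).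
  have /and3P[im _ _] := B_perm_matching sigma.
  by have [-> ->] := admissible_perm_pairs (hord _ _ im).
have -> : \sum_(pi : {set {set 'I_(2 * n + 1)}} | B_matching pi) W_op dot b T S (ord _ pi) Phi w =
    \sum_(pi in [set perm_matching sigma | sigma : 'S_n]%SET) W_op dot b T S (ord _ pi) Phi w.
  apply: eq_bigl => pi; apply/idP/imsetP => [/B_matchingP[sigma ->]|[sigma _ ->]].
    by exists sigma.
  exact: B_perm_matching.
rewrite big_imset /=; last by move=> sigma tau _ _; exact: perm_matching_inj.
rewrite -(sum_matching_op (@twist_end_far _ _ T) (@cap_twist_right _ _ T c)
    (@cap_twist_left _ _ T c) (@cap_far _ _ c) (twist_end_braid br)
    (cap_twist_crossing cr) hs) tensor_end_sumE.
apply: eq_bigr => sigma _; have /andP[sp _] := hs sigma.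
rewrite -(W_rec_matching dot b T S).
- by rewrite /W_op /s -map_comp.
- by rewrite (perm_size sp) size_map size_enum_ord.
- exact: w1.
- by rewrite (perm_uniq (endpoints_perm sp)) perm_pairs_uniq.
by move=> U; rewrite (perm_mem sp) => /mapP[j _ ->] /=.
Qed.

End SumOverMatchings.

Lemma superexponential_sum_bounded (R : realType) (u : nat -> R) (C q : R) :
  (forall n, 0 <= u n) -> 0 <= C -> 0 <= q < 1 -> (forall n, u n.+1 <= C * q ^+ n * u n) ->
  exists M, forall N, \sum_(0 <= n < N) u n <= M.
Proof.
move=> u0 C0 /andP[q0 q1] uS.
have : geometric C q @ \oo --> (0 : R) by apply: cvg_geometric; rewrite ger0_norm.
move=> /cvgrPdist_lt/(_ 2^-1 ltac:(lra)) [n0 _ small].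
have half k : u (n0 + k)%N <= u n0 * 2^-1 ^+ k.
  elim: k => [|k IH]; first by rewrite addn0 expr0 mulr1.
  rewrite addnS; apply: le_trans (uS _) _.
  have /ltW := small (n0 + k)%N (leq_addr _ _).
  rewrite sub0r normrN ger0_norm ?mulr_ge0 ?exprn_ge0 // => h.
  rewrite exprS mulrCA; apply: le_trans (_ : 2^-1 * u (n0 + k)%N <= _).
    by apply: ler_wpM2r.
  by apply: ler_wpM2l => //; lra.
exists (\sum_(0 <= n < n0) u n + u n0 * 2) => N.
apply: le_trans (_ : \sum_(0 <= n < n0 + N) u n <= _).
  rewrite [leRHS](@big_cat_nat _ _ _ N) //= ?leq_addl // lerDl.
  by apply: sumr_ge0 => n _.
rewrite (@big_cat_nat _ _ _ n0) //= ?leq_addr // lerD2l.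
have -> : \sum_(n0 <= n < n0 + N) u n = \sum_(0 <= k < N) u (n0 + k)%N.
  rewrite -{1}[n0]add0n big_addn addKn.
  by apply: eq_bigr => k _; rewrite addnC.
apply: le_trans (_ : \sum_(0 <= k < N) u n0 * 2^-1 ^+ k <= _).
  by apply: ler_sum => k _; exact: half.
rewrite -mulr_sumr; apply: ler_wpM2l => //.
have h0 : (0 : R) <= 2^-1 by lra.
have h1 : (2^-1 : R) < 1 by lra.
apply: le_trans (geometric_sum_le N h0 h1) _.
by rewrite (_ : 1 - 2^-1 = 2^-1 :> R) ?invrK //; lra.
Qed.

Lemma sum_even_odd (W : nmodType) (F : nat -> W) N :
  \sum_(0 <= k < 2 * N) F k = \sum_(0 <= n < N) (F (2 * n)%N + F (2 * n + 1)%N).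
Proof.
elim: N => [|N IH]; first by rewrite muln0 !big_geq.
rewrite [RHS]big_nat_recr //= -IH (_ : (2 * N.+1 = (2 * N).+2)%N); last by lia.
by rewrite !big_nat_recr //= addrA addn1.
Qed.

Section ConjugateVector.
Context (R : realType) (V : vectType R[i]) (dot : {dot V for Num.conj}).
Local Notation ip := (ip dot).
Context (d : nat) (b : 'I_d -> V) (T : 'M[R[i]]_(d * d)) (S : V -> V).
Local Notation tensor := (tensor R d).
Local Notation nc := Normc.normc.
Implicit Types (Phi Psi : tensor) (f : V).
Local Notation c := (fun i j : 'I_d => ip (S (b i)) (b j)).
Hypotheses (br : braided T) (cr : cap_crossing T c).
Local Notation t := (twist_end T).
Local Notation cc := (cap_end c).
Local Notation G := (pair_right t cc).
Local Notation L := (pair_last t cc).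
Context (q : R) (q1 : q < 1) (tq : op_bound 2 2 (t 0) q).
Hypothesis Tpos : forall (n : nat) (Phi : tensor), homogeneous n Phi ->
        Phi <> (fun _ => 0) -> 0 < tensor_ip n Phi (twist_P T n Phi).
Context (ord : forall m, {set {set 'I_m}} -> seq ('I_m * 'I_m)).
Hypothesis hord : forall m (pi : {set {set 'I_m}}),
  incomplete_matching pi -> admissible_order pi (ord pi).

Fixpoint pair_bound (n : nat) : R :=
  if n is m.+1 then pair_bound m * (cap_bound c * (q ^+ n / (1 - q))) else 1.

Lemma pair_last_op_bound n :
  op_bound (n.*2.+3) (n.*2.+1) (L 0 n.+1 n.+1) (cap_bound c * (q ^+ n.+1 / (1 - q))).
Proof.
have [q0 _] := tq; have k0 : 0 <= cap_bound c by exact: sqrtr_ge0.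
have term k : k \in index_iota 0 n.+1 -> op_bound (n.*2.+3) (n.*2.+1)
    (cc k * braid_product t k.+1 (n.+1 + n.+1)) (cap_bound c * q ^+ (n.+1 + n.+1 - k.+1)).
  rewrite mem_index_iota => /andP[_ kn].
  apply: (op_bound_comp (A := braid_product t k.+1 (n.+1 + n.+1)) (B := cc k)).
    by apply: (braid_op_bound q1 tq); lia.
  by apply: cap_op_bound; lia.
apply: op_bound_le (op_bound_sum term) _.
rewrite -mulr_sumr; apply: ler_wpM2l => //.
rewrite big_nat_rev /=; apply: le_trans (_ : \sum_(0 <= k < n.+1) q ^+ n.+1 * q ^+ k <= _).
  rewrite big_nat [leRHS]big_nat; apply: ler_sum => k /andP[_ kn].
  by rewrite -exprD (_ : (_ - _ = n.+1 + k)%N) //; lia.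
rewrite -mulr_sumr; apply: ler_wpM2l; first exact: exprn_ge0.
exact: (geometric_sum_le _ q0 q1).
Qed.

Lemma pair_right_op_bound n : op_bound (n.*2.+1) 1 (G 0 n n) (pair_bound n).
Proof.
elim: n => [|n IH]; first exact: op_bound_id.
rewrite doubleS; exact: (op_bound_comp (pair_last_op_bound n) IH).
Qed.

Lemma pair_bound_ge0 n : 0 <= pair_bound n.
Proof. by have [] := pair_right_op_bound n. Qed.

Definition pairing_vector n f : tensor := fun u =>
  \sum_(pi : {set {set 'I_(2 * n + 1)}} | B_matching pi)
      tensor_adjoint (2 * n + 1) 1 (W_op dot b T S (ord pi)) (vec_tensor dot b f) u.

Lemma tensor_ip_delta n k (A : tensor_end R d) Phi Psi : lowers A k ->
  \sum_(w : (n + k).-tuple 'I_d)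
     (tensor_ip n (A (fun u => (u == w :> seq 'I_d)%:R)) Phi)^*%C * Psi w =
  tensor_ip n Phi (A Psi).
Proof.
move=> lA.
transitivity (\sum_(w : (n + k).-tuple 'I_d) \sum_(v : n.-tuple 'I_d)
    (Phi v)^*%C * (Psi w * A (fun u => (u == w :> seq 'I_d)%:R) v)).
  apply: eq_bigr => w _; rewrite /tensor_ip rmorph_sum mulr_suml; apply: eq_bigr => v _.
  by rewrite rmorphM /= conjcK; ring.
rewrite exchange_big; apply: eq_bigr => v _ /=.
rewrite -mulr_sumr; congr (_ * _).
have := tensor_end_sum A (index_enum _) xpredT (fun w : (n + k).-tuple 'I_d => Psi w)
   (fun w u => (u == w :> seq 'I_d)%:R).
move=> /(congr1 (fun F => F (v : seq 'I_d))) <-.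
apply: lA => u; rewrite size_tuple => /eqP un.
rewrite (bigD1 (Tuple un)) //= eqxx mulr1 big1 ?addr0 // => w wu.
by rewrite (_ : (u == w :> seq 'I_d) = false) ?mulr0 //; apply: contraNF wu => /eqP uw; apply/eqP/val_inj.
Qed.

Lemma pairing_vectorE n f Psi :
  tensor_ip (2 * n + 1) (pairing_vector n f) Psi =
  tensor_ip 1 (vec_tensor dot b f) (G 0 n n Psi).
Proof.
have -> : (2 * n + 1 = 1 + n.*2)%N by lia.
rewrite -(@tensor_ip_delta 1 n.*2 (G 0 n n) (vec_tensor dot b f) Psi (@lowers_pair_right R d T c 0 n n)).
apply: eq_bigr => w _; congr (_^*%C * _).
rewrite /pairing_vector.
transitivity (\sum_(pi : {set {set 'I_(2 * n + 1)}} | B_matching pi)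
   tensor_ip 1 (W_op dot b T S (ord pi) (fun u => (u == w :> seq 'I_d)%:R)) (vec_tensor dot b f)).
  apply: eq_bigr => pi _; rewrite /tensor_adjoint size_tuple.
  by rewrite (_ : (_ == _)%N = true) //; apply/eqP; lia.
rewrite /tensor_ip exchange_big; apply: eq_bigr => v _ /=.
by rewrite -(sum_W_op br cr _ _ hord) ?size_tuple // rmorph_sum mulr_suml.
Qed.

Lemma pairing_vector_sum n f Psi :
  tensor_ip (2 * n + 1) (pairing_vector n f) Psi =
  \sum_(y < d) (ip (b y) f)^*%C * G 0 n n Psi [:: y].
Proof.
rewrite pairing_vectorE tensor_ip_cons; apply: eq_bigr => y _.
exact: (sum_tuple_nil (fun w => (vec_tensor dot b f (y :: w))^*%C * G 0 n n Psi (y :: w))).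
Qed.

Lemma tensor_ip_le n Phi Psi :
  nc (tensor_ip n Phi Psi) <= tensor_norm n Phi * tensor_norm n Psi.
Proof. exact: (cauchy_schwarz (semi_inner_tensor R d n) (I : setT Phi) (I : setT Psi)). Qed.

Lemma pairing_vector_norm n f : tensor_norm (2 * n + 1) (pairing_vector n f) <=
  pair_bound n * tensor_norm 1 (vec_tensor dot b f).
Proof.
set p := pairing_vector n f; have p0 := tensor_norm_ge0 (2 * n + 1) p.
have := tensor_ip_le 1 (vec_tensor dot b f) (G 0 n n p).
rewrite -pairing_vectorE -/p (semi_norm_sqr (semi_inner_tensor R d _)) //.
rewrite normc_real ger0_norm ?sqr_ge0 // -/(tensor_norm _ _) => le.
have [pz|pz] := eqVneq (tensor_norm (2 * n + 1) p) 0.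
  by rewrite pz mulr_ge0 ?pair_bound_ge0 ?tensor_norm_ge0.
have pp : 0 < tensor_norm (2 * n + 1) p by rewrite lt_def pz.
rewrite -(ler_pM2r pp) -expr2; apply: le_trans le _.
rewrite [leRHS]mulrAC [leRHS]mulrC; apply: ler_wpM2l; first exact: tensor_norm_ge0.
have [_ /(_ p)] := pair_right_op_bound n.
by rewrite (_ : n.*2.+1 = (2 * n + 1)%N) //; lia.
Qed.

Local Notation low := (creation_lower q).

Lemma twist_Pinv_spec n Phi : homogeneous n (twist_Pinv T n Phi) /\
  forall w, size w = n -> twist_P T n (twist_Pinv T n Phi) w = Phi w.
Proof.
have cn : 0 < low ^+ n by rewrite exprn_gt0 // creation_lower_gt0.
apply: (@xgetPex _ (fun=> 0) [set Psi | homogeneous n Psi /\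
    forall w, size w = n -> twist_P T n Psi w = Phi w]).
rewrite twist_PE.
apply: (@injective_surjective _ _ n (twist_P_end T n)) => [|Psi z w wn].
  exact: (twist_P_local q1 tq).
have := twist_P_op_lower q1 tq br n Psi.
rewrite (tensor_norm_local (Phi := twist_P_end T n Psi) (Psi := fun=> 0)) ?tensor_norm0; last by move=> v vn; rewrite z.
rewrite pmulr_rle0 // => h.
have /tensor_norm2_eq0 -> // : tensor_norm2 n Psi = 0.
by rewrite -tensor_norm2E (_ : tensor_norm n Psi = 0) ?expr0n //; apply/eqP; rewrite eq_le h tensor_norm_ge0.
Qed.

Lemma twist_Pinv_sqr n Phi :
  twisted_sqr T n (twist_Pinv T n Phi) <= (low ^+ n)^-1 * tensor_norm n Phi ^+ 2.
Proof.
have cn : 0 < low ^+ n by rewrite exprn_gt0 // creation_lower_gt0.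
have [_ h] := twist_Pinv_spec n Phi; set Psi := twist_Pinv T n Phi in h *.
rewrite /twisted_sqr /twisted_ip (tensor_ip_local (Phi' := Psi) (Psi' := Phi)) //.
apply: le_trans (_ : nc (tensor_ip n Psi Phi) <= _).
  by apply: le_trans (ler_norm _) _; exact: normc_ler.
apply: le_trans (tensor_ip_le _ _ _) _.
rewrite expr2 mulrA; apply: ler_wpM2r; first exact: tensor_norm_ge0.
rewrite mulrC ler_pdivlMr // mulrC.
apply: le_trans (twist_P_op_lower q1 tq br n Psi) _.
by rewrite -twist_PE (tensor_norm_local (Psi := Phi)).
Qed.

Definition conjugate_vector f : tensor := fun w =>
  if odd (size w) then conjugate_term dot b T S ord (size w)./2 f w else 0.

Lemma conjugate_vector_odd n f w : size w = (2 * n + 1)%N ->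
  conjugate_vector f w = (-1) ^+ n * twist_Pinv T (2 * n + 1) (pairing_vector n f) w.
Proof.
move=> wn; have sz : size w = n.*2.+1 by lia.
by rewrite /conjugate_vector sz /= odd_double uphalf_double.
Qed.

Lemma conjugate_vector_even n f w : size w = (2 * n)%N -> conjugate_vector f w = 0.
Proof. by move=> wn; rewrite /conjugate_vector wn mul2n odd_double. Qed.

Lemma conjugate_partial_sum f N w : \sum_(0 <= n < N) conjugate_term dot b T S ord n f w =
  if (size w < 2 * N)%N then conjugate_vector f w else 0.
Proof.
have hom n : size w != (2 * n + 1)%N -> conjugate_term dot b T S ord n f w = 0.
  by move=> wn; rewrite /conjugate_term (proj1 (twist_Pinv_spec _ _)) // mulr0.
elim: N => [|N IH]; first by rewrite big_geq.
rewrite big_nat_recr //= IH.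
have [e|ne] := eqVneq (size w) (2 * N + 1)%N.
  rewrite (_ : (size w < 2 * N)%N = false) 1?(_ : (size w < 2 * N.+1)%N = true) ?add0r; try by lia.
  by rewrite (conjugate_vector_odd _ e).
rewrite hom // addr0.
have [e|ne'] := eqVneq (size w) (2 * N)%N.
  by rewrite (conjugate_vector_even _ e) !if_same.
by rewrite (_ : (size w < 2 * N)%N = (size w < 2 * N.+1)%N) //; lia.
Qed.

Lemma conjugate_vector_sqr_even n f : twisted_sqr T (2 * n) (conjugate_vector f) = 0.
Proof.
rewrite /twisted_sqr (twisted_ip_local q1 tq (Phi' := fun=> 0) (Psi' := fun=> 0)).
- by rewrite /twisted_ip /tensor_ip big1 // => w _; rewrite conjc0 mul0r.
- by move=> w /conjugate_vector_even.
- by move=> w /conjugate_vector_even.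
Qed.

Lemma conjugate_vector_sqr_odd n f : twisted_sqr T (2 * n + 1) (conjugate_vector f) =
  twisted_sqr T (2 * n + 1) (twist_Pinv T (2 * n + 1) (pairing_vector n f)).
Proof.
set Psi := twist_Pinv _ _ _; rewrite /twisted_sqr; congr complex.Re.
rewrite (twisted_ip_local q1 tq (Phi' := fun w => (-1) ^+ n * Psi w)
  (Psi' := fun w => (-1) ^+ n * Psi w)); try by move=> w /conjugate_vector_odd.
rewrite twisted_ipZl twisted_ipZr mulrA rmorphXn rmorphN1 -exprMn mulrNN mulr1.
by rewrite expr1n mul1r.
Qed.

Lemma conjugate_vector_fock f : fock T (conjugate_vector f).
Proof.
have [q0 _] := tq; have l0 := creation_lower_gt0 q.
pose F := tensor_norm 1 (vec_tensor dot b f).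
pose u n := (low ^+ (2 * n + 1))^-1 * (pair_bound n * F) ^+ 2.
pose C := (cap_bound c / (1 - q) / low) ^+ 2.
have u0 n : 0 <= u n by rewrite mulr_ge0 ?sqr_ge0 // invr_ge0 exprn_ge0 ?ltW.
have [||||M uM] := @superexponential_sum_bounded R u C q.
- exact: u0.
- exact: sqr_ge0.
- by rewrite q0.
- move=> n.
  have -> : u n.+1 = C * q ^+ (2 * n.+1) * u n.
    rewrite /u /C [pair_bound _.+1]/= (_ : (2 * n.+1 + 1 = 2 + (2 * n + 1))%N); last by lia.
    rewrite exprD invfM -[(low ^+ 2)^-1]exprVn.
    rewrite (_ : q ^+ (2 * n.+1) = (q ^+ n.+1) ^+ 2); last by rewrite -exprM mulnC.
    by ring.
  apply: ler_wpM2r; first exact: u0.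
  apply: ler_wpM2l; first exact: sqr_ge0.
  by apply: ler_wiXn2l; rewrite ?(ltW q1) //; lia.
apply: (fock_bounded q1 tq Tpos (M := M)) => N.
apply: le_trans (_ : \sum_(0 <= k < 2 * N) twisted_sqr T k (conjugate_vector f) <= _).
  rewrite [leRHS](@big_cat_nat _ _ _ N) //=; last by lia.
  by rewrite lerDl; apply: sumr_ge0 => k _; exact: (twisted_sqr_ge0 q1 tq Tpos).
rewrite sum_even_odd; apply: le_trans (uM N); apply: ler_sum => n _.
rewrite conjugate_vector_sqr_even add0r conjugate_vector_sqr_odd.
apply: le_trans (twist_Pinv_sqr _ _) _; apply: ler_wpM2l.
  by rewrite invr_ge0 exprn_ge0 ?ltW.
rewrite ler_pXn2r ?nnegrE ?tensor_norm_ge0 ?mulr_ge0 ?pair_bound_ge0 ?tensor_norm_ge0 //.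
exact: pairing_vector_norm.
Qed.

Lemma conjugate_series_cvg f : (fun N => fock_norm T (fun w => conjugate_vector f w -
    \sum_(0 <= n < N) conjugate_term dot b T S ord n f w)) @ \oo --> (0 : R).
Proof.
apply/cvgrPdist_lt => e e0.
have [N0 small] := fock_truncation q1 tq Tpos (@conjugate_vector_fock f) e0.
exists N0 => // N /= N0N; rewrite sub0r normrN ger0_norm ?fock_norm_ge0 //.
have h : (N0 <= 2 * N)%N by lia.
apply: le_lt_trans (small _ h); rewrite le_eqVlt; apply/orP; left; apply/eqP.
by congr (fock_norm T _); apply/funext => w; rewrite conjugate_partial_sum.
Qed.

Lemma conjugate_vector_pairing f Phi N : (forall w, (N <= size w)%N -> Phi w = 0) ->
  fock_ip T (conjugate_vector f) Phi =
  \sum_(0 <= n < N) (-1) ^+ n * \sum_(y < d) (ip (b y) f)^*%C * G 0 n n Phi [:: y].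
Proof.
move=> z; have fP := fock_finite q1 tq Tpos z.
have big0 k : (N <= k)%N -> twisted_ip T k (conjugate_vector f) Phi = 0.
  move=> Nk; rewrite (twisted_ip_local q1 tq (Phi' := conjugate_vector f) (Psi' := fun=> 0)) //.
    rewrite twisted_ipE tensor_end_zero /tensor_ip big1 // => w _; exact: mulr0.
  by move=> w wk; rewrite z // wk.
have even0 n : twisted_ip T (2 * n) (conjugate_vector f) Phi = 0.
  rewrite (twisted_ip_local q1 tq (Phi' := fun=> 0) (Psi' := Phi)) //.
    by rewrite /twisted_ip /tensor_ip big1 // => w _; rewrite conjc0 mul0r.
  by move=> w /conjugate_vector_even.
have odd n : twisted_ip T (2 * n + 1) (conjugate_vector f) Phi =
    (-1) ^+ n * \sum_(y < d) (ip (b y) f)^*%C * G 0 n n Phi [:: y].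
  rewrite -pairing_vector_sum.
  set Psi := twist_Pinv T (2 * n + 1) (pairing_vector n f).
  rewrite (twisted_ip_local q1 tq (Phi' := fun w => (-1) ^+ n * Psi w) (Psi' := Phi)) //; last first.
    by move=> w /conjugate_vector_odd.
  rewrite twisted_ipZl rmorphXn rmorphN1; congr (_ * _).
  rewrite (twisted_ip_herm q1 tq Tpos) /twisted_ip.
  rewrite (tensor_ip_local (Phi' := Phi) (Psi' := pairing_vector n f)) //; last first.
    by have [_ h] := twist_Pinv_spec (2 * n + 1) (pairing_vector n f).
  by rewrite -(semi_inner_herm (semi_inner_tensor R d _)).
have lim : series (fun n => twisted_ip T n (conjugate_vector f) Phi : (R[i])^o) @ \oo -->
    (\sum_(0 <= k < 2 * N) twisted_ip T k (conjugate_vector f) Phi : (R[i])^o).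
  apply: cvg_near_cst; exists (2 * N)%N => // M /= NM.
  rewrite /series /= (@big_cat_nat _ _ _ (2 * N)) //= [X in _ + X](_ : _ = 0) ?addr0 //.
  by rewrite big_nat big1 // => k /andP[h _]; apply: big0; lia.
rewrite (complex_cvg_unique (fock_ip_cvg q1 tq Tpos (@conjugate_vector_fock f) fP) lim).
by rewrite sum_even_odd; apply: eq_bigr => n _; rewrite even0 add0r odd.
Qed.

End ConjugateVector.

Section LinearExtension.
Context (K : choiceType) (F : comPzRingType) (g : K -> F).
Implicit Types (r s : malg K F).

Definition linear_extension r : F := \sum_(k <- msupp r) mcoeff k r * g k.

Lemma linear_extension_superset r (e : seq K) : uniq e -> {subset msupp r <= e} ->
  linear_extension r = \sum_(k <- e) mcoeff k r * g k.
Proof.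
move=> ue sub; rewrite [RHS](bigID (fun k => k \in msupp r)) /= addrC big1 => [|k]; last first.
  by move=> /mcoeff_outdom ->; rewrite mul0r.
rewrite add0r -big_filter; apply: perm_big; apply: uniq_perm.
- exact: fset_uniq.
- exact: filter_uniq.
by move=> k; rewrite mem_filter andb_idr //; exact: sub.
Qed.

Lemma linear_extensionD r s :
  linear_extension (r + s) = linear_extension r + linear_extension s.
Proof.
pose e := undup (msupp (r + s) ++ msupp r ++ msupp s).
have ue : uniq e := undup_uniq _.
rewrite !(@linear_extension_superset _ e) //.
- by rewrite -big_split; apply: eq_bigr => k _; rewrite mcoeffD mulrDl.
- by move=> k ks; rewrite mem_undup !mem_cat ks !orbT.
- by move=> k ks; rewrite mem_undup !mem_cat ks !orbT.
by move=> k ks; rewrite mem_undup !mem_cat ks.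
Qed.

Lemma linear_extension0 : linear_extension 0 = 0.
Proof. by rewrite /linear_extension big1 // => k _; rewrite mcoeff0 mul0r. Qed.

Lemma linear_extension_sum I (l : seq I) (P : pred I) (r : I -> malg K F) :
  linear_extension (\sum_(i <- l | P i) r i) = \sum_(i <- l | P i) linear_extension (r i).
Proof. exact: (big_morph _ linear_extensionD linear_extension0). Qed.

Lemma linear_extensionU k x : linear_extension (mkmalgU k x) = x * g k.
Proof.
rewrite (@linear_extension_superset _ [:: k]) //; first by rewrite big_seq1 mcoeffUU.
by move=> k' /(fsubsetP msuppU_le); rewrite !inE.
Qed.

End LinearExtension.

Section ConjugateSystems.
Context (R : realType) (V : vectType R[i]) (dot : {dot V for Num.conj}).
Local Notation ip := (ip dot).
Context (d : nat) (b : 'I_d -> V) (hb : orthonormal_basis dot b).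
Context (T : 'M[R[i]]_(d * d)).
Local Notation tensor := (tensor R d).
Implicit Types (Phi Psi : tensor) (a : R[i]) (x y : V).
Variable (S : V -> V).
Hypothesis Santi : forall a x y, S (a *: x + y) = (a^*)%C *: S x + S y.
Hypothesis SK : forall x, S (S x) = x.
Local Notation c := (fun i j : 'I_d => ip (S (b i)) (b j)).
Hypotheses (br : braided T) (cr : cap_crossing T c).
Context (q : R) (q1 : q < 1) (tq : op_bound 2 2 (twist_end T 0) q).
Hypothesis Tpos : forall (n : nat) (Phi : tensor), homogeneous n Phi ->
        Phi <> (fun _ => 0) -> 0 < tensor_ip n Phi (twist_P T n Phi).
Context (e : 'I_d -> V) (he : linear_basis e).
Context (f : 'I_d -> V) (hf : forall i j, ip (f i) (e j) = (i == j)%:R).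
Context (ord : forall m, {set {set 'I_m}} -> seq ('I_m * 'I_m)).
Hypothesis hord : forall m (pi : {set {set 'I_m}}),
    incomplete_matching pi -> admissible_order pi (ord pi).
Local Notation X := (fun i => field_op dot b T S (e i)).
Local Notation Omega := (@vacuum R d).
Local Notation Xi := (fun i => conjugate_vector dot b T S ord (f i)).

Lemma eval_word_Omega_fock u : fock T (eval_word X u Omega).
Proof. exact: (eval_word_fock q1 tq Tpos (fock_vacuum q1 tq Tpos)). Qed.

Lemma eval_word_vacuum u : eval_word X u Omega = word_vector dot b T S e u.
Proof.
have fO := fock_vacuum q1 tq Tpos.
elim: u => [//|j u IH].
by rewrite (eval_word_cons dot b q1 tq Tpos) // IH.
Qed.

Lemma fock_ip_vacuum Phi : fock T Phi -> fock_ip T Omega Phi = Phi [::].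
Proof.
move=> fP; apply: (complex_cvg_unique (fock_ip_cvg q1 tq Tpos (fock_vacuum q1 tq Tpos) fP)).
apply: cvg_near_cst; exists 1%N => // N /= N1.
rewrite /series /= big_ltn // big_nat big1 ?addr0 => [|n /andP[n1 _]].
  rewrite /twisted_ip /tensor_ip (sum_tuple_nil (fun w => (Omega w)^*%C * twist_P T 0 Phi w)).
  by rewrite (_ : Omega [::] = 1) // conjc1 mul1r.
rewrite (twisted_ip_local q1 tq (Phi' := fun=> 0) (Psi' := Phi)) //.
  by rewrite /twisted_ip /tensor_ip big1 // => w _; rewrite conjc0 mul0r.
by move=> [|j w] wn //; move: n1; rewrite -wn.
Qed.

Lemma vacuum_stateE u : vacuum_state T (eval_word X u) = word_vector dot b T S e u [::].
Proof.
rewrite /vacuum_state fock_ip_vacuum ?eval_word_vacuum //.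
by rewrite -eval_word_vacuum; exact: eval_word_Omega_fock.
Qed.

Lemma conjugate_vector_word i u : fock_ip T (Xi i) (eval_word X u Omega) =
  \sum_(m < size u | nth i u m == i)
    vacuum_state T (eval_word X (take m u)) * vacuum_state T (eval_word X (drop m.+1 u)).
Proof.
rewrite eval_word_vacuum (conjugate_vector_pairing br cr q1 tq Tpos hord _ (N := (size u).+1)).
  rewrite (word_vector_conjugate hb Santi br cr _ _ _ i) [RHS]big_mkcond.
  apply: eq_bigr => m _; rewrite !vacuum_stateE hf eq_sym.
  by case: eqP => _; rewrite ?mul1r ?mul0r.
exact: word_vector_support.
Qed.

Lemma fock_ip_eval_poly Psi p : fock T Psi -> fock_ip T Psi (eval_poly X p Omega) =
  linear_extension (fun u => fock_ip T Psi (eval_word X u Omega)) p.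
Proof.
move=> fPsi; rewrite /linear_extension.
have hs := semi_inner_fock q1 tq Tpos.
have -> : eval_poly X p Omega =
    word_combination dot b T S e [seq (mcoeff u p, u) | u <- msupp p] Omega.
  by apply/funext => w; rewrite /word_combination big_map.
elim: (msupp p : seq _) => [|u l IH].
  have f0 := fock0 q1 tq Tpos; set z : tensor := fun=> 0 in f0 *.
  rewrite big_nil (_ : word_combination _ _ _ _ _ _ _ = z).
    have := semi_inner_linear hs (-1) fPsi f0 f0.
    rewrite (_ : (fun w => -1 * z w + z w) = z) ?mulN1r ?addNr //.
    by apply/funext => w; rewrite /z mulr0 addr0.
  by apply/funext => w; rewrite /word_combination big_nil.
have fO := fock_vacuum q1 tq Tpos.
have fu := @eval_word_Omega_fock u.
have [fl _ _] : bounded_op T (word_combination dot b T S e [seq (mcoeff u p, u) | u <- l]).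
  exact: word_combination_bounded q1 tq Tpos _ _ _.
rewrite /= word_combination_cons (semi_inner_linear hs _ fPsi fu (fl _ fO)) IH.
by rewrite big_cons.
Qed.

Lemma conjugate_vector_system : conjugate_system T (von_neumann T (range X)) X Xi.
Proof.
have fXi i : fock T (Xi i) by exact: (conjugate_vector_fock br cr q1 tq Tpos hord).
split=> [//|i|i p].
  exact: (L2_vacuum_fock q1 tq Tpos Santi SK hb he).
rewrite fock_ip_eval_poly //.
transitivity (linear_extension (fun uv =>
  vacuum_state T (eval_word X uv.1) * vacuum_state T (eval_word X uv.2)) (free_diff i p)); last by [].
rewrite /free_diff linear_extension_sum; apply: eq_bigr => u _.
rewrite linear_extension_sum conjugate_vector_word mulr_sumr.
by apply: eq_bigr => m _; rewrite linear_extensionU.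
Qed.

Lemma conjugate_system_unique (Upsilon : 'I_d -> tensor) i :
  conjugate_system T (von_neumann T (range X)) X Upsilon -> Upsilon i = Xi i.
Proof.
move=> [_ h1 h2]; have [_ _ h3] := conjugate_vector_system.
have [fU _] := h1 i.
apply: (fock_vector_unique q1 tq Tpos Santi hb he) => // [|u].
  exact: (conjugate_vector_fock br cr q1 tq Tpos hord).
have := etrans (h2 i (mkmalgU u 1)) (esym (h3 i (mkmalgU u 1))).
rewrite !fock_ip_eval_poly ?linear_extensionU ?mul1r //.
exact: (conjugate_vector_fock br cr q1 tq Tpos hord).
Qed.

End ConjugateSystems.

Lemma standard_spanning (R : realType) (V : vectType R[i]) (dot : {dot V for Num.conj})
  (H : set V) (hH : standard_subspace dot H) (J : V -> V) (Delta : 'End(V))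
  (hJD : polar_decomposition dot (tomita H) J Delta) : spanning H.
Proof.
have [_ hJ hS] := hJD; have [[H0 _] _ _ _] := hH.
move=> P P0 hP lin x; have [h [h' [Hh Hh' ->]]] := standard_total hH hJ hS x.
by rewrite addrC; apply: lin; apply: hP.
Qed.

Theorem theorem4p3
  (R : realType) (V : vectType R[i]) (dot : {dot V for Num.conj})
  (d : nat) (b : 'I_d -> V) (hb : orthonormal_basis dot b)
  (H : set V) (hH : standard_subspace dot H)
  (J : V -> V) (Delta : 'End(V)) (hJD : polar_decomposition dot (tomita H) J Delta)
  (T : 'M[R[i]]_(d * d)) (q : R)
  (hT : strict_twist T) (hTcomp : compatible dot b Delta T)
  (hTcross : crossing_symmetric dot b J Delta T) (hTbraid : braided T)
  (hTq : opnorm T = q) (hq : q < 1)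
  (e : 'I_d -> V) (he : linear_basis e)
  (f : 'I_d -> V) (hf : forall i j, ip dot (f i) (e j) = (i == j)%:R)
  (ord : forall m, {set {set 'I_m}} -> seq ('I_m * 'I_m))
  (hord : forall m (pi : {set {set 'I_m}}),
    incomplete_matching pi -> admissible_order pi (ord m pi)) :
  let X := fun i => field_op dot b T (tomita H) (e i) in
  (exists Xi : 'I_d -> tensor R d,
     conjugate_system T (araki_woods dot b T H) X Xi) /\
  (forall Xi : 'I_d -> tensor R d,
     conjugate_system T (araki_woods dot b T H) X Xi ->
     forall i, fock T (Xi i) /\
       (fun N => fock_norm T (fun w =>
          Xi i w - \sum_(0 <= n < N) conjugate_term dot b T (tomita H) ord n (f i) w))
         @ \oo --> (0 : R)).
Proof.
move=> X; have [_ hJ hS] := hJD; have [_ _ Tpos] := hT.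
have tq : op_bound 2 2 (twist_end T 0) q by rewrite -hTq; exact: opnorm_op_bound.
have Santi := tomita_antilinear hJ hS.
have SK := tomitaK hH hJ hS.
have cr := tomita_cap_crossing hb hH hJD hTcross.
have AW : araki_woods dot b T H = von_neumann T (range X).
  rewrite range_field_op; apply: (von_neumann_field dot b hq tq Tpos Santi SK).
    exact: (standard_spanning hH hJD).
  exact: linear_basis_spanning he.
rewrite AW; split.
  exists (fun i => conjugate_vector dot b T (tomita H) ord (f i)).
  exact: (conjugate_vector_system hb Santi SK hTbraid cr hq tq Tpos he hf hord).
move=> Xi sys i.
rewrite (conjugate_system_unique hb Santi SK hTbraid cr hq tq Tpos he hf hord i sys).
split; first exact: (conjugate_vector_fock hTbraid cr hq tq Tpos hord).
exact: (conjugate_series_cvg hTbraid cr hq tq Tpos hord).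
Qed.
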